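(* Let $R>1$, $\Omega_{\mathrm{shell}}=\{x\in\mathbb{R}^d:1<|x|<R\}$, and for $r>0,\epsilon>0$ let $D(r,\epsilon)=\{x\in\mathbb{R}^d:||x|-r|\ge\epsilon\}$. Then for every $\epsilon>0$, as $l,k\to\infty$ with $l/k\to w>s(R)$ (and $m$ arbitrary, $1\le m\le\dim H_l$), $$\frac{\|u_{klm}\|_{L^\infty(D(w/g_R(w),\epsilon)\cap\Omega_{\mathrm{shell}})}}{\|u_{klm}\|_{L^\infty(\Omega_{\mathrm{shell}})}}\to0 .$$ (Here $1<w/g_R(w)<R$.)
   Context: $L u=-\Delta u+\frac{c^2}{|x|^2}u$ on $\mathbb{R}^d$, $d\ge2$, $c\ge0$; $\nu_l=\sqrt{(l+\tfrac d2-1)^2+c^2}$. $J_\nu,Y_\nu$ are the Bessel functions of the first and second kinds. $a_{\nu,k}$ is the $k$-th positive zero of $f_{\nu,R}(z)=J_\nu(z)Y_\nu(Rz)-Y_\nu(z)J_\nu(Rz)$. $\{Y_{lm}\}$ is an orthonormal basis of the space $H_l$ of spherical harmonics of degree $l$ on $S^{d-1}$. The Dirichlet eigenfunctions of $L$ in $\Omega_{\mathrm{shell}}$ are, in spherical coordinates $x=r\xi$, $u_{klm}(r,\xi)=r^{1-d/2}\big[J_{\nu_l}(a_{\nu_l,k})Y_{\nu_l}(a_{\nu_l,k}r)-Y_{\nu_l}(a_{\nu_l,k})J_{\nu_l}(a_{\nu_l,k}r)\big]Y_{lm}(\xi)$. $g_R$ is the unique solution on $[0,\infty)$ of $$y'(w)=\frac{\arccos\!\big(\frac{w}{Ry}\big)-\arccos\!\big(\frac{w}{y}\big)\mathbf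 1_{\{|w|\le|y|\}}}{R\sqrt{1-\big(\frac{w}{Ry}\big)^2}-\sqrt{1-\big(\frac{w}{y}\big)^2}\,\mathbf 1_{\{|w|\le|y|\}}},\qquad y(0)=\frac{\pi}{R-1},$$ and $s(R)$ is the unique $w>0$ with $g_R(w)=w$ ($w/g_R(w)$ is strictly increasing from $0$ to $R$). *)

(* Defs.v *)
From Stdlib Require Import Reals Lra List ClassicalEpsilon.
Import ListNotations.
Open Scope R_scope.

Definition RInt (f : R -> R) (a b : R) : R :=
  epsilon (inhabits 0)
    (fun I => exists pr : Riemann_integrable f a b, RiemannInt pr = I).

Definition RInt_0_inf (f : R -> R) : R :=
  epsilon (inhabits 0)
    (fun L => (forall b, 0 <= b -> exists pr : Riemann_integrable f 0 b, True) /\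
              forall eps, 0 < eps -> exists B, forall b, B <= b ->
                 Rabs (RInt f 0 b - L) < eps).

(** ** Bessel functions of real order nu, for x > 0 (Schlaefli integrals,
    DLMF 10.9.6 and 10.9.7). *)
Definition BesselJ (nu x : R) : R :=
  / PI * RInt (fun th => cos (x * sin th - nu * th)) 0 PI
  - sin (nu * PI) / PI * RInt_0_inf (fun t => exp (- x * sinh t - nu * t)).

Definition BesselY (nu x : R) : R :=
  / PI * RInt (fun th => sin (x * sin th - nu * th)) 0 PI
  - / PI * RInt_0_inf
      (fun t => (exp (nu * t) + exp (- nu * t) * cos (nu * PI)) * exp (- x * sinh t)).

Definition fcross (nu Rr z : R) : R :=
  BesselJ nu z * BesselY nu (Rr * z) - BesselY nu z * BesselJ nu (Rr * z).

Definition is_kth_pos_zero (f : R -> R) (k : nat) (z : R) : Prop :=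
  (1 <= k)%nat /\ 0 < z /\ f z = 0 /\
  exists L : list R, NoDup L /\ length L = (k - 1)%nat /\
    forall y, In y L <-> (0 < y < z /\ f y = 0).

Definition a_zero (nu Rr : R) (k : nat) : R :=
  epsilon (inhabits 0) (is_kth_pos_zero (fcross nu Rr) k).

Definition nu_l (d : nat) (c : R) (l : nat) : R :=
  sqrt ((INR l + INR d / 2 - 1) ^ 2 + c ^ 2).

Definition in_Rd (d : nat) (x : nat -> R) : Prop := forall i, (d <= i)%nat -> x i = 0.

Definition norm_d (d : nat) (x : nat -> R) : R :=
  sqrt (fold_right Rplus 0 (map (fun i => x i ^ 2) (seq 0 d))).

Definition on_sphere (d : nat) (xi : nat -> R) : Prop := in_Rd d xi /\ norm_d d xi = 1.

(** ** Polynomials in d variables (list of monomials (coefficient, exponents)). *)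
Definition mpoly := list (R * list nat).

Definition mono_eval (d : nat) (m : R * list nat) (x : nat -> R) : R :=
  fst m * fold_right Rmult 1 (map (fun i => x i ^ (nth i (snd m) 0%nat)) (seq 0 d)).

Definition mpoly_eval (d : nat) (P : mpoly) (x : nat -> R) : R :=
  fold_right Rplus 0 (map (fun m => mono_eval d m x) P).

Definition mono_deg (d : nat) (m : R * list nat) : nat :=
  fold_right plus 0%nat (map (fun i => nth i (snd m) 0%nat) (seq 0 d)).

Definition homogeneous (d l : nat) (P : mpoly) : Prop :=
  Forall (fun m => mono_deg d m = l) P.

Definition lap_mono (d : nat) (m : R * list nat) : mpoly :=
  map (fun i => let a := nth i (snd m) 0%nat in
         (fst m * INR a * INR (a - 1),
          map (fun j => if Nat.eqb j i then (nth j (snd m) 0 - 2)%nat else nth j (snd m) 0%nat)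
              (seq 0 d)))
      (seq 0 d).

Definition laplacian (d : nat) (P : mpoly) : mpoly := flat_map (lap_mono d) P.

Definition harmonic (d : nat) (P : mpoly) : Prop :=
  forall x, mpoly_eval d (laplacian d P) x = 0.

Definition spherical_harmonic (d l : nat) (Y : (nat -> R) -> R) : Prop :=
  exists P : mpoly, homogeneous d l P /\ harmonic d P /\
    forall xi, on_sphere d xi -> Y xi = mpoly_eval d P xi.

(** ** The eigenfunction u_{klm}, with Y_{lm} replaced by the spherical harmonic Y. *)
Definition u_fun (d : nat) (c Rr : R) (l k : nat) (Y : (nat -> R) -> R)
    (x : nat -> R) : R :=
  let r := norm_d d x in
  let nu := nu_l d c l in
  let a := a_zero nu Rr k in
  Rpower r (1 - INR d / 2) *
  (BesselJ nu a * BesselY nu (a * r) - BesselY nu a * BesselJ nu (a * r)) *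
  Y (fun i => x i / r).

Definition shell (d : nat) (Rr : R) (x : nat -> R) : Prop :=
  in_Rd d x /\ 1 < norm_d d x < Rr.

Definition Dset (d : nat) (r eps : R) (x : nat -> R) : Prop :=
  in_Rd d x /\ Rabs (norm_d d x - r) >= eps.

(** sup of |f| over S (0 for empty S); equals the L^infty norm for the
    continuous functions considered here. *)
Definition sup_norm (S : (nat -> R) -> Prop) (f : (nat -> R) -> R) : R :=
  epsilon (inhabits 0)
    (is_lub (fun y => y = 0 \/ exists x, S x /\ y = Rabs (f x))).

Definition ind_le (w y : R) : R := if Rle_dec (Rabs w) (Rabs y) then 1 else 0.

Definition gR_rhs (Rr w y : R) : R :=
  (acos (w / (Rr * y)) - acos (w / y) * ind_le w y) /
  (Rr * sqrt (1 - (w / (Rr * y)) ^ 2) - sqrt (1 - (w / y) ^ 2) * ind_le w y).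

Definition is_gR (Rr : R) (g : R -> R) : Prop :=
  g 0 = PI / (Rr - 1) /\
  (forall eps, 0 < eps -> exists delta, 0 < delta /\ forall h, 0 < h < delta ->
      Rabs ((g h - g 0) / h - gR_rhs Rr 0 (g 0)) < eps) /\
  (forall w, 0 < w -> derivable_pt_lim g w (gR_rhs Rr w (g w))).

Definition nat_to_infty (u : nat -> nat) : Prop :=
  forall M : nat, exists N : nat, forall n, (N <= n)%nat -> (M <= u n)%nat.

(* Main.v *)
(** Put [t = ln (x / nu)]. Bessel's equation becomes [v'' + nu^2 (e^(2t) - 1) v = 0], whose
    coefficient does not depend on the eigenvalue: the shell is the window [[tau, tau + ln R]] with
    [a = nu e^tau], and the turning point is always [t = 0].

    Writing [J = M cos psi], [Y = M sin psi], the cross product vanishes exactly when the phase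
    increment [psi (tau + ln R) - psi tau] is a multiple of [PI]. An energy argument shows that
    every such level is crossed upwards only, so the k-th zero is the unique [tau] with increment
    [k PI]. Sturm comparison on a fine partition gives the increment as [nu] times the increment of
    the action [S - atan S], [S = sqrt (e^(2t) - 1)], up to [o(nu)]. The equation for [g_R] has the
    first integral [w (action (ln (R g / w)) - action (ln (g / w))) = PI], hence
    [tau -> ln (g_R w / w)].

    Left of the turning point [v^2] is convex and grows fast. Right of it the adiabatic invariant
    [v'^2 / (nu S) + nu S v^2] is constant up to bounded factors, so [v^2] at distance [delta] is at
    most of order [S(s) / S(delta)] times its value at a critical point [s] near [0]; this is small
    because [S(0) = 0]. *)

Require Import Defs.
From Coquelicot Require Import Coquelicot.
From Stdlib Require FinFun.
From Stdlib Require Import Reals Lra Lia ZArith List.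
From Stdlib Require Import Classical ClassicalEpsilon FunctionalExtensionality.
Open Scope R_scope.

(** * Integrals depending on a parameter *)

(** Three facts about [J] and [Y] carry the proof: the two relations between neighbouring orders,
    which give the differential equation, and linear independence, which makes the Wronskian
    nonzero. All three are drawn from the defining integrals.

    The zero [a_zero] is an [epsilon] choice whose specification lists all smaller zeros, so an
    asymptotic description of large zeros would not identify it: every zero has to be enumerated.
    The phase does this, since the zeros correspond one to one to the levels [INR (S n) * PI]. An
    error [o(nu)] in the phase is tolerable because the action increment is strictly monotone in
    [tau] wherever the window reaches beyond the turning point.

    The first integral of the equation for [g_R] has two delicate places: [w = 0], where it exists
    only as a limit, and [g w = w], where the indicator switches and only continuity is used. That
    [w < Rr * g w] holds throughout is itself a consequence of the first integral. The condition
    [w > s(R)] says [g w < w]: the turning point lies strictly inside the window. *)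

Lemma ex_derive_continuity_pt (f : R -> R) (x : R) : ex_derive f x -> continuity_pt f x.
Proof.
  intros H. apply continuity_pt_filterlim.
  exact (@ex_derive_continuous R_AbsRing R_NormedModule f x H).
Qed.

Lemma ex_RInt_cont (f : R -> R) (a b : R) :
  (forall x, continuous f x) -> ex_RInt f a b.
Proof. intros Hf. apply (@ex_RInt_continuous R_CompleteNormedModule). intros; apply Hf. Qed.

Lemma is_RInt_deriv (f df : R -> R) (a b : R) :
  (forall x, is_derive f x (df x)) -> (forall x, continuous df x) ->
  is_RInt df a b (f b - f a).
Proof.
  intros H1 H2. exact (@is_RInt_derive R_CompleteNormedModule f df a b
    (fun x _ => H1 x) (fun x _ => H2 x)).
Qed.

Lemma RInt_linear3 (f g k : R -> R) (p q r a b : R) :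
  (forall x, continuous f x) -> (forall x, continuous g x) -> (forall x, continuous k x) ->
  RInt (fun t => p * f t + q * g t + r * k t) a b
  = p * RInt f a b + q * RInt g a b + r * RInt k a b.
Proof.
  intros Hf Hg Hk. apply is_RInt_unique.
  rapply @is_RInt_plus; [rapply @is_RInt_plus|]; rapply @is_RInt_scal;
    apply RInt_correct; now apply ex_RInt_cont.
Qed.

Lemma Defs_RInt_eq (f : R -> R) (a b : R) :
  (forall x, continuous f x) -> Defs.RInt f a b = RInt f a b.
Proof.
  intros Hf. unfold Defs.RInt.
  set (P := fun I : R => exists pr : Riemann_integrable f a b, RiemannInt pr = I).
  assert (HP : P (epsilon (inhabits 0) P)).
  { apply epsilon_spec.
    exists (RiemannInt (ex_RInt_Reals_0 _ _ _ (ex_RInt_cont f a b Hf))).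
    now eexists. }
  destruct HP as [pr Hpr]. rewrite <- Hpr. symmetry. apply RInt_Reals.
Qed.

Lemma Defs_RInt_0_inf_eq (f : R -> R) (L : R) :
  (forall x, continuous f x) -> is_lim (fun b => RInt f 0 b) p_infty L ->
  RInt_0_inf f = L.
Proof.
  intros Hf HL. unfold RInt_0_inf.
  match goal with |- epsilon _ ?Q = _ => set (P := Q) end.
  assert (HP : P (epsilon (inhabits 0) P)).
  { apply epsilon_spec. exists L. split.
    - intros b _. exists (ex_RInt_Reals_0 _ _ _ (ex_RInt_cont f 0 b Hf)). exact I.
    - intros eps He. apply is_lim_spec in HL. destruct (HL (mkposreal eps He)) as [B HB].
      exists (B + 1). intros b Hb. rewrite Defs_RInt_eq by exact Hf. apply HB. lra. }
  destruct HP as [_ HP].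
  cut (is_lim (fun b => RInt f 0 b) p_infty (epsilon (inhabits 0) P)).
  { intros H. apply is_lim_unique in H. apply is_lim_unique in HL. congruence. }
  apply is_lim_spec. intros eps. destruct (HP eps (cond_pos eps)) as [B HB].
  exists B. intros b Hb. rewrite <- (Defs_RInt_eq _ _ _ Hf). apply HB. lra.
Qed.

(** Differentiation under the integral sign goes through this test: a pointwise bound of order
    [h ^ 2] on the remainder survives integration, also over a half-line. *)
Lemma is_derive_of_quadratic_remainder (f : R -> R) (x l C r : R) :
  0 < r -> (forall h, Rabs h <= r -> Rabs (f (x + h) - f x - h * l) <= C * h ^ 2) ->
  is_derive f x l.
Proof.
  intros Hr H. apply is_derive_Reals. intros eps He.
  set (C' := Rabs C + 1).
  assert (HC' : 0 < C') by (unfold C'; pose proof (Rabs_pos C); lra).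
  assert (Hd : 0 < Rmin r (eps / C')).
  { apply Rmin_pos; [exact Hr|]. now apply Rdiv_lt_0_compat. }
  exists (mkposreal _ Hd). intros h Hh0 Hh. simpl in Hh.
  pose proof (Rmin_l r (eps / C')). pose proof (Rmin_r r (eps / C')).
  assert (Hah : 0 < Rabs h) by now apply Rabs_pos_lt.
  specialize (H h ltac:(lra)).
  replace ((f (x + h) - f x) / h - l) with ((f (x + h) - f x - h * l) / h)
    by (now field).
  unfold Rdiv. rewrite Rabs_mult, Rabs_inv.
  apply Rmult_lt_reg_r with (Rabs h); [exact Hah|].
  rewrite Rmult_assoc, Rinv_l, Rmult_1_r by lra.
  eapply Rle_lt_trans; [exact H|].
  rewrite <- (pow2_abs h).
  assert (G1 : C * Rabs h ^ 2 <= C' * Rabs h * Rabs h).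
  { unfold C'. pose proof (Rle_abs C). nra. }
  assert (G2 : C' * Rabs h < eps).
  { apply Rlt_le_trans with (C' * (eps / C')); [apply Rmult_lt_compat_l; lra|].
    right. field. lra. }
  nra.
Qed.

(** * The Bessel equation from the Schlaefli integrals *)

Lemma exp_taylor1 (u : R) : Rabs (exp u - 1 - u) <= u ^ 2 * exp (Rabs u).
Proof.
  pose proof (exp_ineq1_le u) as H1. pose proof (exp_ineq1_le (- u)) as H2.
  pose proof (exp_pos u) as H3. pose proof (exp_pos (- u)) as H3'.
  assert (H4 : exp u * exp (- u) = 1) by (rewrite <- exp_plus, Rplus_opp_r; apply exp_0).
  rewrite Rabs_pos_eq by lra.
  assert (H5 : exp u - 1 <= u * exp u) by nra.
  destruct (Rle_dec 0 u) as [Hu|Hu].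
  - rewrite Rabs_pos_eq by lra. nra.
  - pose proof (exp_ineq1_le (Rabs u)). pose proof (Rabs_pos u). nra.
Qed.

Lemma sin_taylor1 (p u : R) : Rabs (sin (p + u) - sin p - u * cos p) <= u ^ 2.
Proof.
  assert (Hc : forall x y, Rabs (cos x - cos y) <= Rabs (x - y)).
  { intros x y.
    destruct (MVT_gen cos y x (fun t => - sin t)) as [c [_ Hc]].
    - intros; auto_derive; [easy|ring].
    - intros; apply continuity_cos.
    - rewrite Hc, Rabs_mult, Rabs_Ropp.
      assert (Rabs (sin c) <= 1) by (apply Rabs_le; pose proof (SIN_bound c); lra).
      pose proof (Rabs_pos (x - y)). nra. }
  destruct (MVT_gen sin p (p + u) cos) as [c [Hcb H]].
  - intros; auto_derive; [easy|ring].
  - intros; apply continuity_sin.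
  - rewrite H. replace (cos c * (p + u - p) - u * cos p) with (u * (cos c - cos p)) by ring.
    rewrite Rabs_mult. specialize (Hc c p).
    assert (Rabs (c - p) <= Rabs u).
    { revert Hcb. unfold Rmin, Rmax.
      destruct (Rle_dec p (p + u)); intros; apply Rabs_le; split_Rabs; lra. }
    rewrite <- pow2_abs. pose proof (Rabs_pos u). nra.
Qed.

(** * The half-line integrals in the Schlaefli formulas *)

Definition kern (mu x t : R) : R := exp (- x * sinh t + mu * t).

Lemma kern_continuous mu x t : continuous (kern mu x) t.
Proof. rapply @ex_derive_continuous. unfold kern, sinh. auto_derive. easy. Qed.

Lemma sinh_ge_quadratic t : 0 <= t -> t ^ 2 / 4 <= sinh t.
Proof.
  intros Ht. unfold sinh.
  assert (H1 : exp (- t) <= 1) by (rewrite <- exp_0; destruct Ht as [Ht|<-];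
    [left; apply exp_increasing; lra| rewrite Ropp_0; lra]).
  assert (H2 : 1 + t + t ^ 2 / 2 <= exp t).
  { destruct (MVT_gen (fun u => exp u - 1 - u - u ^ 2 / 2) 0 t (fun u => exp u - 1 - u))
      as [c [_ Hc]].
    - intros; auto_derive; [easy|field].
    - intros; apply ex_derive_continuity_pt. auto_derive. easy.
    - rewrite exp_0 in Hc. pose proof (exp_ineq1_le c). nra. }
  lra.
Qed.

Lemma sinh_nonneg t : 0 <= t -> 0 <= sinh t.
Proof. intros Ht. pose proof (sinh_ge_quadratic t Ht). nra. Qed.

Lemma sinh_le_exp t : 0 <= t -> sinh t <= exp t.
Proof.
  intros Ht. unfold sinh. pose proof (exp_pos t). pose proof (exp_pos (- t)). lra.
Qed.

Lemma exp_le a b : a <= b -> exp a <= exp b.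
Proof. intros [H| ->]; [left; now apply exp_increasing|lra]. Qed.

Lemma kern_le mu x t : 0 < x -> 0 <= t ->
  kern mu x t <= exp ((mu + 1) ^ 2 / x) * exp (- t).
Proof.
  intros Hx Ht. unfold kern. rewrite <- exp_plus. apply exp_le.
  pose proof (sinh_ge_quadratic t Ht) as H.
  (* Completing the square: the difference of the two sides is [(x * t / 2 - (mu + 1)) ^ 2 / x].
     Using [mu + 1] in place of [mu] leaves the integrable factor [exp (- t)] over. *)
  assert (H0 : (mu + 1) * t <= x * (t ^ 2 / 4) + (mu + 1) ^ 2 / x).
  { assert (0 <= (x * t / 2 - (mu + 1)) ^ 2 / x).
    { apply Rmult_le_pos; [apply pow2_ge_0|left; now apply Rinv_0_lt_compat]. }
    replace ((x * t / 2 - (mu + 1)) ^ 2 / x)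
      with (x * (t ^ 2 / 4) + (mu + 1) ^ 2 / x - (mu + 1) * t) in H0 by (field; lra). lra. }
  nra.
Qed.

Lemma kern_integral_bounded mu x b : 0 < x -> 0 <= b ->
  RInt (kern mu x) 0 b <= exp ((mu + 1) ^ 2 / x).
Proof.
  intros Hx Hb. set (C := exp ((mu + 1) ^ 2 / x)).
  assert (HI : is_RInt (fun t => C * exp (- t)) 0 b (C * (1 - exp (- b)))).
  { replace (C * (1 - exp (- b))) with (- C * exp (- b) - (- C * exp (- 0)))
      by (rewrite Ropp_0, exp_0; ring).
    apply (is_RInt_deriv (fun t => - C * exp (- t))).
    - intros; auto_derive; [easy|ring].
    - intros; rapply @ex_derive_continuous; auto_derive; easy. }
  apply Rle_trans with (RInt (fun t => C * exp (- t)) 0 b).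
  - apply RInt_le; [exact Hb|apply ex_RInt_cont, kern_continuous|eexists; exact HI|].
    intros t Ht. apply kern_le; lra.
  - rewrite (is_RInt_unique _ _ _ _ HI).
    assert (0 < C) by apply exp_pos. pose proof (exp_pos (- b)). nra.
Qed.

Lemma is_lim_increasing_bounded (F : R -> R) (M : R) :
  (forall a b, 0 <= a <= b -> F a <= F b) -> (forall b, 0 <= b -> F b <= M) ->
  exists L : R, is_lim F p_infty L.
Proof.
  intros Hinc HM.
  destruct (completeness (fun y => exists b, 0 <= b /\ y = F b)) as [L [HL1 HL2]].
  - exists M. intros y [b [Hb ->]]. now apply HM.
  - exists (F 0), 0. split; [lra|easy].
  - exists L. apply is_lim_spec. intros eps.
    assert (HB : exists B, 0 <= B /\ L - eps < F B).
    { apply NNPP. intros Hn. pose proof (cond_pos eps).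
      assert (L <= L - eps); [|lra]. apply HL2. intros y [b [Hb ->]].
      apply Rnot_lt_le. intros Hlt. apply Hn. now exists b. }
    destruct HB as [B [HB1 HB2]]. exists B. intros b Hb.
    assert (F B <= F b) by (apply Hinc; lra).
    assert (F b <= L) by (apply HL1; exists b; split; [lra|easy]).
    apply Rabs_def1; lra.
Qed.

Definition Kint (mu x : R) : R := real (Lim (fun b => RInt (kern mu x) 0 b) p_infty).

Lemma Kint_correct mu x : 0 < x ->
  is_lim (fun b => RInt (kern mu x) 0 b) p_infty (Kint mu x).
Proof.
  intros Hx.
  destruct (is_lim_increasing_bounded (fun b => RInt (kern mu x) 0 b)
              (exp ((mu + 1) ^ 2 / x))) as [L HL].
  - intros a b Hab.
    rewrite <- (RInt_Chasles (kern mu x) 0 a b) by (apply ex_RInt_cont, kern_continuous).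
    assert (0 <= RInt (kern mu x) a b).
    { apply RInt_ge_0; [lra|apply ex_RInt_cont, kern_continuous|].
      intros; left; apply exp_pos. }
    unfold plus; simpl. lra.
  - intros b Hb. now apply kern_integral_bounded.
  - unfold Kint. rewrite (is_lim_unique _ _ _ HL). exact HL.
Qed.

Lemma is_lim_linear3 (F G H : R -> R) (p q r lF lG lH : R) :
  is_lim F p_infty lF -> is_lim G p_infty lG -> is_lim H p_infty lH ->
  is_lim (fun b => p * F b + q * G b + r * H b) p_infty (p * lF + q * lG + r * lH).
Proof.
  intros H1 H2 H3.
  apply is_lim_plus'; [apply is_lim_plus'|].
  - exact (is_lim_scal_l _ p _ _ H1).
  - exact (is_lim_scal_l _ q _ _ H2).
  - exact (is_lim_scal_l _ r _ _ H3).
Qed.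

Lemma kern_cosh mu x t : cosh t * kern mu x t = (kern (mu + 1) x t + kern (mu - 1) x t) / 2.
Proof.
  unfold kern, cosh.
  replace (- x * sinh t + (mu + 1) * t) with ((- x * sinh t + mu * t) + t) by ring.
  replace (- x * sinh t + (mu - 1) * t) with ((- x * sinh t + mu * t) + - t) by ring.
  rewrite !exp_plus. field.
Qed.

Lemma kern_sinh mu x t : sinh t * kern mu x t = (kern (mu + 1) x t - kern (mu - 1) x t) / 2.
Proof.
  unfold kern.
  replace (- x * sinh t + (mu + 1) * t) with ((- x * sinh t + mu * t) + t) by ring.
  replace (- x * sinh t + (mu - 1) * t) with ((- x * sinh t + mu * t) + - t) by ring.
  rewrite !exp_plus. unfold sinh. field.
Qed.

Lemma kern_vanishes mu x : 0 < x -> is_lim (kern mu x) p_infty 0.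
Proof.
  intros Hx. set (C := exp ((mu + 1) ^ 2 / x)).
  assert (HC : 0 < C) by apply exp_pos.
  apply is_lim_spec. intros eps. exists (C / eps). intros b Hb.
  assert (He := cond_pos eps).
  assert (Hb0 : 0 < b) by (apply Rlt_trans with (2 := Hb), Rdiv_lt_0_compat; lra).
  pose proof (kern_le mu x b Hx ltac:(lra)) as H1. fold C in H1.
  assert (0 < kern mu x b) by apply exp_pos.
  rewrite Rminus_0_r, Rabs_pos_eq by lra.
  apply Rle_lt_trans with (1 := H1).
  pose proof (exp_ineq1_le b). pose proof (exp_pos (- b)).
  assert (exp b * exp (- b) = 1) by (rewrite <- exp_plus, Rplus_opp_r; apply exp_0).
  assert (C < eps * b).
  { apply Rmult_lt_reg_r with (/ eps); [now apply Rinv_0_lt_compat|].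
    unfold Rdiv in Hb. replace (eps * b * / eps) with b by (field; lra). exact Hb. }
  assert (eps * b * exp (- b) <= eps) by nra. nra.
Qed.

(** Integrates the derivative [(mu - x * cosh t) * kern mu x t]. The [1] is the boundary value at
    [t = 0]; in [J] and [Y] it cancels against the boundary terms of [Tint_recurrence]. *)
Lemma Kint_recurrence mu x : 0 < x ->
  x * (Kint (mu + 1) x + Kint (mu - 1) x) = 2 * (mu * Kint mu x + 1).
Proof.
  intros Hx.
  assert (H : forall b, RInt (fun t => (- x / 2) * kern (mu + 1) x t
        + (- x / 2) * kern (mu - 1) x t + mu * kern mu x t) 0 b = kern mu x b - 1).
  { intros b. apply is_RInt_unique.
    replace (kern mu x b - 1) with (kern mu x b - kern mu x 0).
    - apply is_RInt_deriv.
      + intros t.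
        replace (- x / 2 * kern (mu + 1) x t + - x / 2 * kern (mu - 1) x t + mu * kern mu x t)
          with (- x * (cosh t * kern mu x t) + mu * kern mu x t)
          by (rewrite kern_cosh; field).
        unfold kern, sinh, cosh. auto_derive; [easy|]. unfold Rminus, Rdiv. field.
      + intros t. rapply @ex_derive_continuous. unfold kern, sinh. auto_derive. easy.
    - f_equal. unfold kern, sinh.
      rewrite Ropp_0, exp_0. replace (_ + mu * 0) with 0 by field. apply exp_0. }
  pose proof (is_lim_linear3 _ _ _ (- x / 2) (- x / 2) mu _ _ _
    (Kint_correct (mu + 1) x Hx) (Kint_correct (mu - 1) x Hx) (Kint_correct mu x Hx)) as L1.
  assert (L2 : is_lim (fun b => kern mu x b - 1) p_infty (0 + - 1)).
  { apply is_lim_plus'; [now apply kern_vanishes|apply is_lim_const]. }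
  apply (is_lim_ext _ (fun b => kern mu x b - 1)) in L1.
  2:{ intros b. rewrite <- H. symmetry. apply RInt_linear3; intros; apply kern_continuous. }
  apply is_lim_unique in L1. apply is_lim_unique in L2. rewrite L1 in L2.
  injection L2. lra.
Qed.

Lemma Kint_derive mu x : 0 < x ->
  is_derive (Kint mu) x ((Kint (mu - 1) x - Kint (mu + 1) x) / 2).
Proof.
  intros Hx.
  (* The remainder of [exp (- h * sinh t)] is at most [h ^ 2 * sinh t ^ 2 * exp (x / 2 * sinh t)]:
     giving up half of [x] pays for the exponential, and [sinh t <= exp t] raises the order by 2. *)
  apply is_derive_of_quadratic_remainder with (C := Kint (mu + 2) (x / 2)) (r := x / 2); [lra|].
  intros h Hh.
  assert (Hxh : 0 < x + h) by (split_Rabs; lra).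
  assert (Hint : forall b, 0 <= b ->
    Rabs (1 * RInt (kern mu (x + h)) 0 b + (-1) * RInt (kern mu x) 0 b
      + h * RInt (fun t => sinh t * kern mu x t) 0 b)
    <= h ^ 2 * RInt (kern (mu + 2) (x / 2)) 0 b).
  { intros b Hb.
    assert (Hcs : forall t, continuous (fun t => sinh t * kern mu x t) t).
    { intros t. rapply @ex_derive_continuous. unfold kern, sinh. auto_derive. easy. }
    rewrite <- RInt_linear3; try (intros; apply kern_continuous); [|exact Hcs].
    assert (Hc3 : forall t, continuous (fun t => 1 * kern mu (x + h) t
        + -1 * kern mu x t + h * (sinh t * kern mu x t)) t).
    { intros t. rapply @ex_derive_continuous. unfold kern, sinh. auto_derive. easy. }
    eapply Rle_trans; [apply abs_RInt_le; [exact Hb|now apply ex_RInt_cont]|].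
    replace (h ^ 2 * RInt (kern (mu + 2) (x / 2)) 0 b)
      with (RInt (fun t => h ^ 2 * kern (mu + 2) (x / 2) t) 0 b).
    2:{ apply is_RInt_unique. rapply @is_RInt_scal. apply RInt_correct, ex_RInt_cont, kern_continuous. }
    apply RInt_le; [exact Hb| | |].
    - apply ex_RInt_cont. intros t. rapply @continuous_comp; [apply Hc3|].
      rapply @continuous_Rabs.
    - apply ex_RInt_cont. intros t. rapply @ex_derive_continuous. unfold kern, sinh.
      auto_derive. easy.
    - intros t Ht.
      pose proof (exp_taylor1 (- h * sinh t)) as HT.
      assert (Hs := sinh_nonneg t ltac:(lra)). assert (Hs2 := sinh_le_exp t ltac:(lra)).
      assert (E1 : kern mu (x + h) t = kern mu x t * exp (- h * sinh t)).
      { unfold kern. rewrite <- exp_plus. f_equal. ring. }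
      rewrite E1.
      replace (_ + _) with (kern mu x t * (exp (- h * sinh t) - 1 - (- h * sinh t))) by ring.
      assert (Hk : 0 < kern mu x t) by apply exp_pos.
      rewrite Rabs_mult, (Rabs_pos_eq (kern mu x t)) by lra.
      apply Rle_trans with (kern mu x t * ((- h * sinh t) ^ 2 * exp (x / 2 * sinh t))).
      { apply Rmult_le_compat_l; [lra|]. eapply Rle_trans; [exact HT|].
        apply Rmult_le_compat_l; [apply pow2_ge_0|]. apply exp_le.
        rewrite Rabs_mult, Rabs_Ropp, (Rabs_pos_eq (sinh t)) by lra. nra. }
      assert (E2 : kern (mu + 2) (x / 2) t = kern mu x t * exp (x / 2 * sinh t) * (exp t * exp t)).
      { unfold kern. rewrite <- !exp_plus. f_equal. field. }
      rewrite E2. pose proof (exp_pos t). pose proof (exp_pos (x / 2 * sinh t)).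
      assert (0 < kern mu x t * exp (x / 2 * sinh t)) by nra.
      assert (sinh t * sinh t <= exp t * exp t) by nra.
      assert (0 <= h ^ 2) by apply pow2_ge_0.
      replace (kern mu x t * ((- h * sinh t) ^ 2 * exp (x / 2 * sinh t)))
        with (h ^ 2 * ((kern mu x t * exp (x / 2 * sinh t)) * (sinh t * sinh t))) by ring.
      apply Rmult_le_compat_l; [easy|]. apply Rmult_le_compat_l; lra. }
  assert (Hs : is_lim (fun b => RInt (fun t => sinh t * kern mu x t) 0 b) p_infty
      (/ 2 * Kint (mu + 1) x + (- / 2) * Kint (mu - 1) x + 0 * Kint mu x)).
  { apply is_lim_ext with (2 := is_lim_linear3 _ _ _ (/ 2) (- / 2) 0 _ _ _
      (Kint_correct (mu + 1) x Hx) (Kint_correct (mu - 1) x Hx) (Kint_correct mu x Hx)).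
    intros b. rewrite <- RInt_linear3 by (intros; apply kern_continuous).
    apply RInt_ext. intros t _. rewrite kern_sinh.
    match goal with |- @eq _ ?l ?r => change (@eq R l r) end. field. }
  pose proof (is_lim_linear3 _ _ _ 1 (-1) h _ _ _
    (Kint_correct mu (x + h) Hxh) (Kint_correct mu x Hx) Hs) as L1.
  pose proof (is_lim_scal_l _ (h ^ 2) _ _ (Kint_correct (mu + 2) (x / 2) ltac:(lra))) as L2.
  cbn [Rbar_mult Rbar_mult'] in L2.
  match type of L1 with is_lim _ _ (Finite ?l) =>
    replace (Kint mu (x + h) - Kint mu x - h * ((Kint (mu - 1) x - Kint (mu + 1) x) / 2))
    with l by field end.
  rewrite (Rmult_comm _ (h ^ 2)).
  match type of L1 with is_lim ?F _ (Finite ?l) => apply Rabs_le; split;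
    [ cut (Rbar_le (- (h ^ 2 * Kint (mu + 2) (x / 2))) l); [easy|]
    | cut (Rbar_le l (h ^ 2 * Kint (mu + 2) (x / 2))); [easy|] ] end.
  - refine (is_lim_le_loc _ _ p_infty _ _ _ (is_lim_opp _ _ _ L2) L1).
    exists 0. intros b Hb. specialize (Hint b ltac:(lra)). apply Rabs_le_between in Hint. lra.
  - refine (is_lim_le_loc _ _ p_infty _ _ _ L1 L2).
    exists 0. intros b Hb. specialize (Hint b ltac:(lra)). apply Rabs_le_between in Hint. lra.
Qed.

(* The offset [al] covers both the cosine ([al = PI / 2]) and the sine ([al = 0]) integrals. *)
Definition tkern (al nu x th : R) : R := sin (al + (x * sin th - nu * th)).

Definition Tint (al nu x : R) : R := RInt (tkern al nu x) 0 PI.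

Lemma tkern_continuous al nu x th : continuous (tkern al nu x) th.
Proof. rapply @ex_derive_continuous. unfold tkern. auto_derive. easy. Qed.

Lemma tkern_shift al nu x th :
  tkern al (nu - 1) x th = sin (al + (x * sin th - nu * th)) * cos th
    + cos (al + (x * sin th - nu * th)) * sin th /\
  tkern al (nu + 1) x th = sin (al + (x * sin th - nu * th)) * cos th
    - cos (al + (x * sin th - nu * th)) * sin th.
Proof.
  unfold tkern. split; rewrite <- ?sin_plus, <- ?sin_minus; f_equal; ring.
Qed.

(** Integrates the derivative of [- cos] of the phase, whose inner factor is [x * cos th - nu]; by
    the addition theorems the two neighbouring kernels add up to [2 * cos th] times the middle
    one. *)
Lemma Tint_recurrence al nu x :
  x * (Tint al (nu - 1) x + Tint al (nu + 1) x)
  = 2 * (nu * Tint al nu x + cos al - cos (al - nu * PI)).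
Proof.
  assert (H : RInt (fun th => (x / 2) * tkern al (nu - 1) x th
        + (x / 2) * tkern al (nu + 1) x th + (- nu) * tkern al nu x th) 0 PI
      = - cos (al + (x * sin PI - nu * PI)) - (- cos (al + (x * sin 0 - nu * 0)))).
  { apply is_RInt_unique.
    apply (is_RInt_deriv (fun th => - cos (al + (x * sin th - nu * th)))).
    - intros th. destruct (tkern_shift al nu x th) as [-> ->]. unfold tkern.
      auto_derive; [easy|]. unfold Rminus. field.
    - intros th. rapply @ex_derive_continuous. unfold tkern. auto_derive. easy. }
  rewrite RInt_linear3 in H by (intros; apply tkern_continuous).
  rewrite sin_PI, sin_0 in H.
  replace (al + (x * 0 - nu * PI)) with (al - nu * PI) in H by ring.
  replace (al + (x * 0 - nu * 0)) with al in H by ring.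
  unfold Tint. lra.
Qed.

Lemma Tint_derive al nu x :
  is_derive (Tint al nu) x ((Tint al (nu - 1) x - Tint al (nu + 1) x) / 2).
Proof.
  apply is_derive_of_quadratic_remainder with (C := PI) (r := 1); [lra|].
  intros h _. unfold Tint.
  set (dk := fun th => sin th * cos (al + (x * sin th - nu * th))).
  assert (Hdk : forall th, continuous dk th).
  { intros th. rapply @ex_derive_continuous. unfold dk. auto_derive. easy. }
  assert (E : (RInt (tkern al (nu - 1) x) 0 PI - RInt (tkern al (nu + 1) x) 0 PI) / 2
     = RInt dk 0 PI).
  { replace ((RInt (tkern al (nu - 1) x) 0 PI - RInt (tkern al (nu + 1) x) 0 PI) / 2)
      with (/ 2 * RInt (tkern al (nu - 1) x) 0 PI + (- / 2) * RInt (tkern al (nu + 1) x) 0 PI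
         + 0 * RInt dk 0 PI) by (unfold Rdiv; ring).
    rewrite <- RInt_linear3 by (try exact Hdk; intros; apply tkern_continuous).
    apply RInt_ext. intros th _. destruct (tkern_shift al nu x th) as [-> ->]. unfold dk.
    match goal with |- @eq _ ?l ?r => change (@eq R l r) end. field. }
  rewrite E.
  replace (RInt (tkern al nu (x + h)) 0 PI - RInt (tkern al nu x) 0 PI - h * RInt dk 0 PI)
    with (1 * RInt (tkern al nu (x + h)) 0 PI + (-1) * RInt (tkern al nu x) 0 PI
       + (- h) * RInt dk 0 PI) by ring.
  rewrite <- RInt_linear3 by (try exact Hdk; intros; apply tkern_continuous).
  replace (PI * h ^ 2) with ((PI - 0) * h ^ 2) by ring.
  apply abs_RInt_le_const.
  - pose proof PI_RGT_0; lra.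
  - apply ex_RInt_cont. intros th. rapply @ex_derive_continuous. unfold tkern, dk.
    auto_derive. easy.
  - intros th _.
    pose proof (sin_taylor1 (al + (x * sin th - nu * th)) (h * sin th)) as H.
    unfold tkern, dk.
    replace (al + ((x + h) * sin th - nu * th))
      with (al + (x * sin th - nu * th) + h * sin th) by ring.
    match type of H with _ <= ?rr => apply Rle_trans with rr end.
    + eapply Rle_trans; [|exact H]. right. f_equal. ring.
    + rewrite Rpow_mult_distr. pose proof (SIN_bound th). pose proof (pow2_ge_0 h).
      assert (sin th ^ 2 <= 1) by nra. nra.
Qed.

Lemma BesselJ_eq nu x : 0 < x ->
  BesselJ nu x = / PI * Tint (PI / 2) nu x - sin (nu * PI) / PI * Kint (- nu) x.
Proof.
  intros Hx. unfold BesselJ. f_equal; f_equal.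
  - rewrite Defs_RInt_eq.
    2:{ intros t. rapply @ex_derive_continuous. auto_derive. easy. }
    apply RInt_ext. intros th _. unfold tkern. now rewrite <- cos_sin.
  - apply Defs_RInt_0_inf_eq.
    { intros t. rapply @ex_derive_continuous. unfold sinh. auto_derive. easy. }
    apply is_lim_ext with (2 := Kint_correct (- nu) x Hx).
    intros b. apply RInt_ext. intros t _. unfold kern. f_equal. ring.
Qed.

Lemma BesselY_eq nu x : 0 < x ->
  BesselY nu x = / PI * Tint 0 nu x - / PI * (Kint nu x + cos (nu * PI) * Kint (- nu) x).
Proof.
  intros Hx. unfold BesselY. f_equal; f_equal.
  - rewrite Defs_RInt_eq.
    2:{ intros t. rapply @ex_derive_continuous. auto_derive. easy. }
    apply RInt_ext. intros th _. unfold tkern. now rewrite Rplus_0_l.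
  - apply Defs_RInt_0_inf_eq.
    { intros t. rapply @ex_derive_continuous. unfold sinh. auto_derive. easy. }
    replace (Kint nu x + cos (nu * PI) * Kint (- nu) x)
      with (1 * Kint nu x + cos (nu * PI) * Kint (- nu) x + 0 * Kint nu x) by ring.
    apply is_lim_ext with (2 := is_lim_linear3 _ _ _ 1 (cos (nu * PI)) 0 _ _ _
      (Kint_correct nu x Hx) (Kint_correct (- nu) x Hx) (Kint_correct nu x Hx)).
    intros b. rewrite <- RInt_linear3 by (intros; apply kern_continuous).
    apply RInt_ext. intros t _. unfold kern. rewrite !exp_plus.
    replace (- nu * t) with (- (nu * t)) by ring.
    match goal with |- @eq _ ?l ?r => change (@eq R l r) end. ring.
Qed.

(** These relations hold with the same signs for [J] and [Y] and together imply Bessel's equation.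
    They are required for every real order because the second derivative at order [nu] involves
    [nu - 2] and [nu + 2]. *)
Record bessel_family (f : R -> R -> R) : Prop := {
  bf_derive : forall nu x, 0 < x -> is_derive (f nu) x ((f (nu - 1) x - f (nu + 1) x) / 2);
  bf_rec : forall nu x, 0 < x -> x * (f (nu - 1) x + f (nu + 1) x) = 2 * nu * f nu x }.

Lemma locally_pos x : 0 < x -> locally x (fun y => 0 < y).
Proof. intros Hx. apply (open_gt 0). exact Hx. Qed.

Lemma trig_shift_PI nu :
  sin ((nu - 1) * PI) = - sin (nu * PI) /\ sin ((nu + 1) * PI) = - sin (nu * PI) /\
  cos ((nu - 1) * PI) = - cos (nu * PI) /\ cos ((nu + 1) * PI) = - cos (nu * PI).
Proof.
  replace ((nu - 1) * PI) with (nu * PI - PI) by ring.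
  replace ((nu + 1) * PI) with (nu * PI + PI) by ring.
  rewrite sin_minus, cos_minus, sin_plus, cos_plus, sin_PI, cos_PI.
  repeat split; ring.
Qed.

Lemma is_derive_lin3 (f g k : R -> R) (p q r x lf lg lk : R) :
  is_derive f x lf -> is_derive g x lg -> is_derive k x lk ->
  is_derive (fun y => p * f y + q * g y + r * k y) x (p * lf + q * lg + r * lk).
Proof.
  intros Hf Hg Hk.
  rapply @is_derive_plus; [rapply @is_derive_plus|]; now apply is_derive_scal.
Qed.

(** The sign change of [sin (nu * PI)] under unit shifts makes up for [Kint] having order [- nu],
    where the shifts run backwards, so both integrals obey the same relations. *)
Lemma bessel_family_J : bessel_family BesselJ.
Proof.
  assert (HP := PI_RGT_0).
  split; intros nu x Hx; destruct (trig_shift_PI nu) as [S1 [S2 [C1 C2]]].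
  - rewrite !BesselJ_eq by exact Hx. rewrite S1, S2.
    apply (is_derive_ext_loc (fun y => / PI * Tint (PI / 2) nu y
      + (- (sin (nu * PI) / PI)) * Kint (- nu) y + 0 * Tint (PI / 2) nu y)).
    { apply filter_imp with (2 := locally_pos x Hx). intros y Hy.
      rewrite BesselJ_eq by exact Hy. simpl. ring. }
    pose proof (is_derive_lin3 _ _ _ (/ PI) (- (sin (nu * PI) / PI)) 0 _ _ _ _
      (Tint_derive (PI / 2) nu x) (Kint_derive (- nu) x Hx) (Tint_derive (PI / 2) nu x)) as H.
    evar_last; [exact H|].
    replace (- (nu - 1)) with (- nu + 1) by ring. replace (- (nu + 1)) with (- nu - 1) by ring.
    field. lra.
  - rewrite !BesselJ_eq by exact Hx. rewrite S1, S2.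
    pose proof (Tint_recurrence (PI / 2) nu x) as H1.
    pose proof (Kint_recurrence (- nu) x Hx) as H2.
    rewrite cos_PI2 in H1. rewrite cos_shift in H1.
    replace (- (nu - 1)) with (- nu + 1) by ring. replace (- (nu + 1)) with (- nu - 1) by ring.
    transitivity (/ PI * (x * (Tint (PI / 2) (nu - 1) x + Tint (PI / 2) (nu + 1) x))
      + sin (nu * PI) / PI * (x * (Kint (- nu + 1) x + Kint (- nu - 1) x))); [field; lra|].
    rewrite H1, H2. field. lra.
Qed.

Lemma bessel_family_Y : bessel_family BesselY.
Proof.
  assert (HP := PI_RGT_0).
  split; intros nu x Hx; destruct (trig_shift_PI nu) as [S1 [S2 [C1 C2]]].
  - rewrite !BesselY_eq by exact Hx. rewrite C1, C2.
    apply (is_derive_ext_loc (fun y => / PI * Tint 0 nu y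
      + (- / PI) * Kint nu y + (- (cos (nu * PI) / PI)) * Kint (- nu) y)).
    { apply filter_imp with (2 := locally_pos x Hx). intros y Hy.
      rewrite BesselY_eq by exact Hy. simpl. field. lra. }
    pose proof (is_derive_lin3 _ _ _ (/ PI) (- / PI) (- (cos (nu * PI) / PI)) _ _ _ _
      (Tint_derive 0 nu x) (Kint_derive nu x Hx) (Kint_derive (- nu) x Hx)) as H.
    evar_last; [exact H|].
    replace (- (nu - 1)) with (- nu + 1) by ring. replace (- (nu + 1)) with (- nu - 1) by ring.
    field. lra.
  - rewrite !BesselY_eq by exact Hx. rewrite C1, C2.
    pose proof (Tint_recurrence 0 nu x) as H1.
    pose proof (Kint_recurrence nu x Hx) as H2.
    pose proof (Kint_recurrence (- nu) x Hx) as H3.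
    rewrite cos_0, Rminus_0_l, cos_neg in H1.
    replace (- (nu - 1)) with (- nu + 1) by ring. replace (- (nu + 1)) with (- nu - 1) by ring.
    transitivity (/ PI * (x * (Tint 0 (nu - 1) x + Tint 0 (nu + 1) x))
      - / PI * (x * (Kint (nu + 1) x + Kint (nu - 1) x))
      + cos (nu * PI) / PI * (x * (Kint (- nu + 1) x + Kint (- nu - 1) x))); [field; lra|].
    rewrite H1, H2, H3. field. lra.
Qed.

(* In the variable [t = ln (x / nu)] Bessel's equation becomes
   [v'' + nu^2 (e^(2t) - 1) v = 0]; its turning point is [t = 0]. *)
Definition sol (nu : R) (v v' : R -> R) : Prop :=
  (forall t, is_derive v t (v' t)) /\
  (forall t, is_derive v' t (- (nu ^ 2 * (exp (2 * t) - 1)) * v t)).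

(** Differentiation in [t] is [x * d/dx], so the second derivative brings in the orders [nu - 2] and
    [nu + 2]. The recurrence at [nu - 1] and [nu + 1] removes them; the one at [nu] removes the
    remaining neighbours. *)
Lemma bessel_family_sol (f : R -> R -> R) (nu : R) : bessel_family f -> 0 < nu ->
  sol nu (fun t => f nu (nu * exp t))
    (fun t => nu * exp t * ((f (nu - 1) (nu * exp t) - f (nu + 1) (nu * exp t)) / 2)).
Proof.
  intros [Hd Hr] Hnu.
  assert (Hx : forall t, 0 < nu * exp t) by (intros; apply Rmult_lt_0_compat; [easy|apply exp_pos]).
  assert (Hc : forall mu t, is_derive (fun t => f mu (nu * exp t)) t
     ((nu * exp t) * ((f (mu - 1) (nu * exp t) - f (mu + 1) (nu * exp t)) / 2))).
  { intros mu t.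
    apply (is_derive_comp (f mu) (fun t => nu * exp t)); [now apply Hd|].
    auto_derive; [easy|ring]. }
  split; [apply Hc|].
  intros t. set (x := nu * exp t).
  assert (He : is_derive (fun t => nu * exp t) t x) by (unfold x; auto_derive; [easy|ring]).
  assert (Hdiff := is_derive_lin3 _ _ _ (/ 2) (- / 2) 0 _ _ _ _
    (Hc (nu - 1) t) (Hc (nu + 1) t) (Hc nu t)).
  apply (is_derive_ext (fun t => (nu * exp t) * (/ 2 * f (nu - 1) (nu * exp t)
    + - / 2 * f (nu + 1) (nu * exp t) + 0 * f nu (nu * exp t)))).
  { intros s. simpl. field. }
  evar_last. { rapply (is_derive_mult _ _ _ _ _ He Hdiff). intros; apply Rmult_comm. }
  unfold plus, mult; simpl. fold x.
  replace (nu - 1 + 1) with nu by ring. replace (nu + 1 - 1) with nu by ring.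
  pose proof (Hr (nu - 1) x (Hx t)) as H1. pose proof (Hr (nu + 1) x (Hx t)) as H2.
  pose proof (Hr nu x (Hx t)) as H0.
  replace (nu - 1 + 1) with nu in H1 by ring. replace (nu + 1 - 1) with nu in H2 by ring.
  replace (exp (2 * t)) with (exp t * exp t) by (rewrite <- exp_plus; f_equal; ring).
  replace (- (nu * (nu * 1) * (exp t * exp t - 1)) * f nu x)
    with ((nu ^ 2 - x ^ 2) * f nu x) by (unfold x; ring).
  assert (E : x * f (nu - 1 - 1) x = 2 * (nu - 1) * f (nu - 1) x - x * f nu x) by lra.
  assert (E' : x * f (nu + 1 + 1) x = 2 * (nu + 1) * f (nu + 1) x - x * f nu x) by lra.
  transitivity (x / 2 * (f (nu - 1) x - f (nu + 1) x) + x / 4 * (x * f (nu - 1 - 1) x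
     - 2 * (x * f nu x) + x * f (nu + 1 + 1) x)); [field|].
  rewrite E, E'.
  transitivity (nu / 2 * (x * (f (nu - 1) x + f (nu + 1) x)) - x ^ 2 * f nu x); [field|].
  rewrite H0. field.
Qed.

(** * Calculus on intervals *)

Lemma is_derive_continuity_pt (f : R -> R) (x l : R) : is_derive f x l -> continuity_pt f x.
Proof. intros H. apply ex_derive_continuity_pt. now exists l. Qed.

(** Differentiability is asked only inside the interval because [action] and [Theta] are
    differentiated away from one exceptional point, which is then placed at an endpoint. *)
Lemma MVT_interior (f df : R -> R) (a b : R) : a < b ->
  (forall x, a < x < b -> is_derive f x (df x)) ->
  (forall x, a <= x <= b -> continuity_pt f x) ->
  exists c, a < c < b /\ f b - f a = df c * (b - a).
Proof.
  intros Hab Hd Hc.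
  assert (pr1 : forall c, a < c < b -> derivable_pt f c).
  { intros c Hcc. exists (df c). now apply is_derive_Reals, Hd. }
  assert (pr2 : forall c, a < c < b -> derivable_pt id c).
  { intros c _. apply derivable_pt_id. }
  destruct (MVT f id a b pr1 pr2 Hab Hc) as [c [P H]].
  { intros c _. apply derivable_continuous_pt, derivable_pt_id. }
  exists c. split; [exact P|].
  assert (E1 : derive_pt f c (pr1 c P) = df c).
  { apply derive_pt_eq_0. now apply is_derive_Reals, Hd. }
  assert (E2 : derive_pt id c (pr2 c P) = 1) by (apply derive_pt_eq_0, derivable_pt_lim_id).
  rewrite E1, E2 in H. unfold id in H. lra.
Qed.

Lemma deriv_nonneg_le (f df : R -> R) (a b : R) : a <= b ->
  (forall x, a <= x <= b -> is_derive f x (df x)) ->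
  (forall x, a < x < b -> 0 <= df x) -> f a <= f b.
Proof.
  intros [Hab| ->] Hd Hp; [|lra].
  destruct (MVT_interior f df a b Hab) as [c [Hc E]].
  - intros x Hx. apply Hd. lra.
  - intros x Hx. eapply is_derive_continuity_pt, Hd, Hx.
  - specialize (Hp c Hc). nra.
Qed.

Lemma deriv_pos_lt (f df : R -> R) (a b : R) : a < b ->
  (forall x, a <= x <= b -> is_derive f x (df x)) ->
  (forall x, a < x < b -> 0 < df x) -> f a < f b.
Proof.
  intros Hab Hd Hp.
  destruct (MVT_interior f df a b Hab) as [c [Hc E]].
  - intros x Hx. apply Hd. lra.
  - intros x Hx. eapply is_derive_continuity_pt, Hd, Hx.
  - specialize (Hp c Hc). nra.
Qed.

Lemma deriv_zero_const (f : R -> R) (a b : R) : a <= b ->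
  (forall x, a < x < b -> is_derive f x 0) ->
  (forall x, a <= x <= b -> continuity_pt f x) -> f a = f b.
Proof.
  intros [Hab| ->] Hd Hc; [|easy].
  destruct (MVT_interior f (fun _ => 0) a b Hab Hd Hc) as [c [_ E]]. lra.
Qed.

Lemma deriv_zero_const_line (f : R -> R) (a b : R) :
  (forall x, is_derive f x 0) -> f a = f b.
Proof.
  intros Hd.
  assert (Hc : forall x, continuity_pt f x) by (intros; eapply is_derive_continuity_pt, Hd).
  destruct (Rle_dec a b).
  - now apply deriv_zero_const.
  - symmetry. apply deriv_zero_const; auto; lra.
Qed.

Lemma continuity_pt_pos (f : R -> R) (c : R) : continuity_pt f c -> 0 < f c ->
  exists d, 0 < d /\ forall x, Rabs (x - c) < d -> 0 < f x.
Proof.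
  intros Hc Hp. destruct (Hc (f c) Hp) as [d [Hd H]]. exists d. split; [exact Hd|].
  intros x Hx. destruct (Req_dec x c) as [->|Hne]; [easy|].
  specialize (H x (conj (conj I (not_eq_sym Hne)) Hx)).
  unfold dist in H; simpl in H; unfold Rdist in H. split_Rabs; lra.
Qed.

Lemma first_zero (f : R -> R) (a b : R) : a <= b ->
  (forall x, a <= x <= b -> continuity_pt f x) -> 0 < f a -> f b <= 0 ->
  exists c, a < c <= b /\ f c = 0 /\ forall x, a <= x < c -> 0 < f x.
Proof.
  intros Hab Hc Ha Hb.
  set (E := fun x => a <= x <= b /\ forall y, a <= y <= x -> 0 < f y).
  assert (HEa : E a).
  { split; [lra|]. intros y Hy. now replace y with a by lra. }
  destruct (completeness E) as [c [Hc1 Hc2]].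
  - exists b. intros x [Hx _]. lra.
  - now exists a.
  - assert (Hac : a <= c) by now apply Hc1.
    assert (Hcb : c <= b) by (apply Hc2; intros x [Hx _]; lra).
    assert (Hlt : forall x, a <= x < c -> 0 < f x).
    { intros x Hx. apply NNPP. intros Hn.
      assert (c <= x); [|lra]. apply Hc2. intros y [Hy1 Hy2].
      apply Rnot_lt_le. intros Hxy. apply Hn, Hy2. lra. }
    assert (Hfc : f c = 0).
    { destruct (Rtotal_order (f c) 0) as [Hn|[H0|Hp]]; [|exact H0|].
      - destruct (continuity_pt_pos (fun x => - f x) c) as [d [Hd H]].
        + apply continuity_pt_opp, Hc. lra.
        + lra.
        + destruct (Req_dec a c) as [->|Hne]; [lra|].
          pose proof (Rmax_l a (c - d / 2)). pose proof (Rmax_r a (c - d / 2)).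
          assert (Rmax a (c - d / 2) < c) by (apply Rmax_lub_lt; lra).
          specialize (Hlt (Rmax a (c - d / 2)) ltac:(lra)).
          specialize (H (Rmax a (c - d / 2)) ltac:(apply Rabs_def1; lra)). lra.
      - destruct (continuity_pt_pos f c) as [d [Hd H]]; [apply Hc; lra|easy|].
        assert (c < b) by (destruct Hcb as [?| ->]; [easy|lra]).
        pose proof (Rmin_l b (c + d / 2)). pose proof (Rmin_r b (c + d / 2)).
        assert (c < Rmin b (c + d / 2)) by (apply Rmin_glb_lt; lra).
        assert (HE : E (Rmin b (c + d / 2))).
        { split; [lra|]. intros y Hy. destruct (Rlt_dec y c); [apply Hlt; lra|].
          apply H. apply Rabs_def1; lra. }
        specialize (Hc1 _ HE). lra. }
    exists c. split; [|now split]. split; [|easy].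
    destruct Hac as [?| ->]; [easy|lra].
Qed.

Lemma derive_pos_sign (f : R -> R) (c l : R) : is_derive f c l -> f c = 0 -> 0 < l ->
  exists d, 0 < d /\ (forall x, c - d < x < c -> f x < 0) /\ (forall x, c < x < c + d -> 0 < f x).
Proof.
  intros Hd H0 Hl. apply is_derive_Reals in Hd.
  destruct (Hd l Hl) as [d H]. exists d. split; [apply cond_pos|].
  assert (Hq : forall h, h <> 0 -> Rabs h < d -> 0 < f (c + h) / h).
  { intros h Hh1 Hh2. specialize (H h Hh1 Hh2). rewrite H0, Rminus_0_r in H.
    split_Rabs; lra. }
  split; intros x Hx; specialize (Hq (x - c) ltac:(lra) ltac:(apply Rabs_def1; lra));
    replace (c + (x - c)) with x in Hq by ring.
  - assert (0 < / (c - x)) by (apply Rinv_0_lt_compat; lra).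
    replace (f x / (x - c)) with (- (f x * / (c - x))) in Hq by (field; lra). nra.
  - assert (0 < / (x - c)) by (apply Rinv_0_lt_compat; lra). unfold Rdiv in Hq. nra.
Qed.

(** If [f] were nonpositive at [b], it would reach a first zero from positive values, where its
    slope cannot be positive. A start with [f a = 0] is first moved to positive values by the slope
    at [a]. *)
Lemma upcrossing (f df : R -> R) (a b : R) :
  (forall x, is_derive f x (df x)) -> (forall x, f x = 0 -> 0 < df x) ->
  a < b -> 0 <= f a -> 0 < f b.
Proof.
  intros Hd Hz Hab Ha. apply Rnot_le_lt. intros Hb.
  assert (Ha' : exists a', a <= a' < b /\ 0 < f a').
  { destruct Ha as [Ha|Ha]; [exists a; lra|].
    destruct (derive_pos_sign f a (df a)) as [d [Hd0 [_ H]]]; auto.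
    pose proof (Rmin_l b (a + d)). pose proof (Rmin_r b (a + d)).
    assert (a < Rmin b (a + d)) by (apply Rmin_glb_lt; lra).
    exists ((a + Rmin b (a + d)) / 2). split; [lra|]. apply H. lra. }
  destruct Ha' as [a' [Ha1 Ha2]].
  destruct (first_zero f a' b) as [c [Hc1 [Hc2 Hc3]]]; try lra.
  { intros x _. eapply is_derive_continuity_pt, Hd. }
  destruct (derive_pos_sign f c (df c)) as [d [Hd0 [H _]]]; auto.
  pose proof (Rmax_l a' (c - d)). pose proof (Rmax_r a' (c - d)).
  assert (Rmax a' (c - d) < c) by (apply Rmax_lub_lt; lra).
  specialize (H ((Rmax a' (c - d) + c) / 2) ltac:(lra)).
  specialize (Hc3 ((Rmax a' (c - d) + c) / 2) ltac:(lra)). lra.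
Qed.

(** * Wronskian and phase *)

(** [auto_derive] expresses the derivative of an abstract function as an eta-expanded [Derive]; this
    replaces it by the value known from [H]. *)
Ltac derive_with H :=
  match type of H with
  | is_derive ?f ?x ?l =>
      let E := fresh in
      assert (E : Derive (fun y : R => f y) x = l) by exact (is_derive_unique f x l H);
      rewrite E; clear E
  end.

Lemma sol_ext nu v v' w w' : (forall t, v t = w t) -> (forall t, v' t = w' t) ->
  sol nu v v' -> sol nu w w'.
Proof.
  intros E E' [H1 H2]. split; intros t.
  - rewrite <- E'. now apply (is_derive_ext v).
  - rewrite <- E. now apply (is_derive_ext v').
Qed.

Lemma sol_comb nu A A' B B' (p q : R) : sol nu A A' -> sol nu B B' ->
  sol nu (fun t => p * A t + q * B t) (fun t => p * A' t + q * B' t).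
Proof.
  intros [HA HA'] [HB HB']. split; intros t.
  - rapply @is_derive_plus; apply is_derive_scal; auto.
  - evar_last.
    { rapply @is_derive_plus; apply is_derive_scal; [apply HA'|apply HB']. }
    unfold plus; simpl. ring.
Qed.

Lemma wronskian_const nu A A' B B' : sol nu A A' -> sol nu B B' ->
  forall s t, A s * B' s - A' s * B s = A t * B' t - A' t * B t.
Proof.
  intros [HA HA'] [HB HB'] s t.
  apply (deriv_zero_const_line (fun t => A t * B' t - A' t * B t)).
  intros x. auto_derive.
  { repeat split; eexists; eauto. }
  derive_with (HA x). derive_with (HB x). derive_with (HA' x). derive_with (HB' x). ring.
Qed.

(** Gronwall for [v ^ 2 + v' ^ 2], whose derivative is [2 * v * v' * (1 - nu ^ 2 * (exp (2 * x) -
    1))]. The last factor is bounded to the left of any point, hence the [Rmax] in [C]; the weight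
    is [exp (- C * x)] right of [t0] and [exp (C * x)] left of it. *)
Lemma sol_unique_zero nu v v' t0 : sol nu v v' -> v t0 = 0 -> v' t0 = 0 -> forall t, v t = 0.
Proof.
  intros [Hv Hv'] H0 H0' t.
  set (C := 1 + nu ^ 2 * (exp (2 * Rmax t t0) + 1)).
  assert (HC : forall x, x <= Rmax t t0 -> Rabs (1 - nu ^ 2 * (exp (2 * x) - 1)) <= C).
  { intros x Hx. pose proof (exp_pos (2 * x)).
    assert (exp (2 * x) <= exp (2 * Rmax t t0)) by (apply exp_le; lra).
    pose proof (pow2_ge_0 nu). unfold C. apply Rabs_le. split; nra. }
  assert (HE : forall x, x <= Rmax t t0 ->
    Rabs (2 * v x * v' x * (1 - nu ^ 2 * (exp (2 * x) - 1))) <= C * (v x ^ 2 + v' x ^ 2)).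
  { intros x Hx. rewrite Rabs_mult. specialize (HC x Hx).
    assert (Rabs (2 * v x * v' x) <= v x ^ 2 + v' x ^ 2).
    { pose proof (pow2_ge_0 (v x + v' x)). pose proof (pow2_ge_0 (v x - v' x)).
      apply Rabs_le. split; lra. }
    pose proof (Rabs_pos (2 * v x * v' x)).
    pose proof (Rabs_pos (1 - nu ^ 2 * (exp (2 * x) - 1))). nra. }
  assert (Hd : forall k x, is_derive (fun x => exp (k * x) * (v x ^ 2 + v' x ^ 2)) x
    (exp (k * x) * (k * (v x ^ 2 + v' x ^ 2) + 2 * v x * v' x * (1 - nu ^ 2 * (exp (2 * x) - 1))))).
  { intros k x. auto_derive.
    { repeat split; [now exists (v' x)|eexists; apply Hv']. }
    derive_with (Hv x). derive_with (Hv' x). ring. }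
  assert (Hz : exists k, exp (k * t) * (v t ^ 2 + v' t ^ 2) <= 0).
  { destruct (Rle_dec t0 t) as [Hle|Hle].
    - exists (- C).
      cut (- (exp (- C * t0) * (v t0 ^ 2 + v' t0 ^ 2)) <= - (exp (- C * t) * (v t ^ 2 + v' t ^ 2))).
      { rewrite H0, H0'. lra. }
      apply (deriv_nonneg_le (fun x => - (exp (- C * x) * (v x ^ 2 + v' x ^ 2)))
        (fun x => - (exp (- C * x) * (- C * (v x ^ 2 + v' x ^ 2)
           + 2 * v x * v' x * (1 - nu ^ 2 * (exp (2 * x) - 1)))))); [easy| |].
      + intros x _. rapply @is_derive_opp. apply Hd.
      + intros x Hx. specialize (HE x ltac:(pose proof (Rmax_l t t0); lra)).
        apply Rabs_le_between in HE. pose proof (exp_pos (- C * x)). nra.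
    - exists C.
      cut (exp (C * t) * (v t ^ 2 + v' t ^ 2) <= exp (C * t0) * (v t0 ^ 2 + v' t0 ^ 2)).
      { rewrite H0, H0'. lra. }
      apply (deriv_nonneg_le (fun x => exp (C * x) * (v x ^ 2 + v' x ^ 2)) _ t t0 ltac:(lra)
        (fun x _ => Hd C x)).
      intros x Hx. specialize (HE x ltac:(pose proof (Rmax_r t t0); lra)).
      apply Rabs_le_between in HE. pose proof (exp_pos (C * x)). nra. }
  destruct Hz as [k Hk]. pose proof (exp_pos (k * t)).
  assert (v t ^ 2 + v' t ^ 2 <= 0) by nra.
  nra.
Qed.

(** [W / (A ^ 2 + B ^ 2)] is the derivative of the argument of the vector [(A, B)]. Obtaining [psi]
    by integration avoids branches of the argument; the constant of integration drops out of the
    increments. *)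
Lemma phase_exists nu A A' B B' W : sol nu A A' -> sol nu B B' -> W <> 0 ->
  (forall t, A t * B' t - A' t * B t = W) ->
  exists psi, (forall t, is_derive psi t (W / (A t ^ 2 + B t ^ 2))) /\
    forall s t, A s * B t - B s * A t
      = sqrt (A s ^ 2 + B s ^ 2) * sqrt (A t ^ 2 + B t ^ 2) * sin (psi t - psi s).
Proof.
  intros [HA HA'] [HB HB'] HW0 HW.
  assert (HM : forall t, 0 < A t ^ 2 + B t ^ 2).
  { intros t. specialize (HW t). destruct (Req_dec (A t) 0) as [E|E].
    - assert (B t <> 0) by (intros E'; rewrite E, E' in HW; apply HW0; lra).
      pose proof (pow2_gt_0 _ H). pose proof (pow2_ge_0 (A t)). lra.
    - pose proof (pow2_gt_0 _ E). pose proof (pow2_ge_0 (B t)). lra. }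
  set (dpsi := fun t => W / (A t ^ 2 + B t ^ 2)).
  assert (Hcont : forall t, continuous dpsi t).
  { intros t. rapply @ex_derive_continuous. unfold dpsi. auto_derive.
    repeat split; [now exists (A' t)|now exists (B' t)|]. specialize (HM t). simpl in HM. lra. }
  exists (fun t => RInt dpsi 0 t). set (psi := fun t => RInt dpsi 0 t).
  assert (Hpsi : forall t, is_derive psi t (dpsi t)).
  { intros t. apply (is_derive_RInt dpsi psi 0 t); [|apply Hcont].
    apply filter_forall. intros b.
    exact (@RInt_correct R_CompleteNormedModule dpsi 0 b (ex_RInt_cont dpsi 0 b Hcont)). }
  split; [exact Hpsi|].
  assert (HM2 : forall t, sqrt (A t ^ 2 + B t ^ 2) ^ 2 = A t ^ 2 + B t ^ 2).
  { intros t. apply pow2_sqrt. specialize (HM t). lra. }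
  assert (HM0 : forall t, 0 < sqrt (A t ^ 2 + B t ^ 2)) by (intros; now apply sqrt_lt_R0).
  assert (HDM : forall t, is_derive (fun t => sqrt (A t ^ 2 + B t ^ 2)) t
     ((A t * A' t + B t * B' t) / sqrt (A t ^ 2 + B t ^ 2))).
  { intros t. auto_derive.
    - repeat split; [now exists (A' t)|now exists (B' t)|]. specialize (HM t). simpl in HM. lra.
    - derive_with (HA t). derive_with (HB t).
      specialize (HM0 t). simpl in HM0 |- *. field. lra. }
  set (M := fun t => sqrt (A t ^ 2 + B t ^ 2)) in *.
  assert (HM0' : forall t, 0 < M t) by exact HM0.
  assert (HM2' : forall t, M t ^ 2 = A t ^ 2 + B t ^ 2) by exact HM2.
  assert (HDM' : forall t, is_derive M t ((A t * A' t + B t * B' t) / M t)) by exact HDM.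
  assert (Hdp : forall t, dpsi t = W / M t ^ 2) by (intros; now rewrite HM2').
  assert (Hexs : forall t, ex_derive A t /\ ex_derive B t /\ ex_derive M t /\ ex_derive psi t).
  { intros t. repeat split; eexists; eauto. }
  (* Rotating the unit vector (A, B) / M back by psi gives a constant vector. *)
  set (X := fun t => (A t * cos (psi t) + B t * sin (psi t)) / M t).
  set (Z := fun t => (B t * cos (psi t) - A t * sin (psi t)) / M t).
  assert (HX : forall t, is_derive X t 0).
  { intros t. destruct (Hexs t) as [e1 [e2 [e3 e4]]]. specialize (HM0' t).
    unfold X. auto_derive; [repeat split; auto; lra|].
    derive_with (HA t). derive_with (HB t). derive_with (Hpsi t). derive_with (HDM' t).
    rewrite Hdp, <- (HW t).
    apply Rmult_eq_reg_r with (M t ^ 3); [|apply pow_nonzero; lra].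
    rewrite Rmult_0_l.
    transitivity ((M t ^ 2 - (A t ^ 2 + B t ^ 2)) * (A' t * cos (psi t) + B' t * sin (psi t))).
    2: now rewrite HM2'; ring.
    field. lra. }
  assert (HZ : forall t, is_derive Z t 0).
  { intros t. destruct (Hexs t) as [e1 [e2 [e3 e4]]]. specialize (HM0' t).
    unfold Z. auto_derive; [repeat split; auto; lra|].
    derive_with (HA t). derive_with (HB t). derive_with (Hpsi t). derive_with (HDM' t).
    rewrite Hdp, <- (HW t).
    apply Rmult_eq_reg_r with (M t ^ 3); [|apply pow_nonzero; lra].
    rewrite Rmult_0_l.
    transitivity ((M t ^ 2 - (A t ^ 2 + B t ^ 2)) * (B' t * cos (psi t) - A' t * sin (psi t))).
    2: now rewrite HM2'; ring.
    field. lra. }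
  intros s t. fold (M s) (M t).
  assert (HAX : forall u, A u = M u * (X s * cos (psi u) - Z s * sin (psi u))).
  { intros u. rewrite (deriv_zero_const_line X s u HX), (deriv_zero_const_line Z s u HZ).
    unfold X, Z. specialize (HM0' u). pose proof (sin2_cos2 (psi u)) as E. unfold Rsqr in E.
    transitivity (A u * (sin (psi u) * sin (psi u) + cos (psi u) * cos (psi u)));
      [rewrite E; ring|field; lra]. }
  assert (HBX : forall u, B u = M u * (X s * sin (psi u) + Z s * cos (psi u))).
  { intros u. rewrite (deriv_zero_const_line X s u HX), (deriv_zero_const_line Z s u HZ).
    unfold X, Z. specialize (HM0' u). pose proof (sin2_cos2 (psi u)) as E. unfold Rsqr in E.
    transitivity (B u * (sin (psi u) * sin (psi u) + cos (psi u) * cos (psi u)));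
      [rewrite E; ring|field; lra]. }
  assert (HXZ : X s ^ 2 + Z s ^ 2 = 1).
  { unfold X, Z. specialize (HM0' s). pose proof (sin2_cos2 (psi s)) as E. unfold Rsqr in E.
    transitivity ((A s ^ 2 + B s ^ 2) * (sin (psi s) * sin (psi s) + cos (psi s) * cos (psi s))
      / M s ^ 2); [field; lra|]. rewrite E, <- HM2'. field. lra. }
  rewrite (HAX t), (HBX t), (HAX s), (HBX s), sin_minus. fold (M s) (M t).
  transitivity (M s * M t * (X s ^ 2 + Z s ^ 2)
    * (sin (psi t) * cos (psi s) - cos (psi t) * sin (psi s))); [ring|rewrite HXZ; ring].
Qed.

(** * Sturm comparison and the growth of the phase *)

(* The local frequency; [sqrt] is [0] on negative numbers, so it vanishes left of [t = 0]. *)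
Definition freq (nu t : R) : R := nu * sqrt (exp (2 * t) - 1).

Lemma freq_mono nu s t : 0 <= nu -> s <= t -> freq nu s <= freq nu t.
Proof.
  intros Hn Hst. apply Rmult_le_compat_l; [easy|]. apply sqrt_le_1_alt.
  pose proof (exp_le (2 * s) (2 * t)). lra.
Qed.

Lemma freq_nonneg nu t : 0 <= nu -> 0 <= freq nu t.
Proof. intros Hn. apply Rmult_le_pos; [easy|apply sqrt_pos]. Qed.

Lemma freq_le0 nu t : t <= 0 -> freq nu t = 0.
Proof.
  intros Ht. unfold freq. rewrite sqrt_neg_0; [ring|].
  pose proof (exp_le (2 * t) 0 ltac:(lra)). rewrite exp_0 in H. lra.
Qed.

Lemma exp2_ge1 t : 0 <= t -> 0 <= exp (2 * t) - 1.
Proof. intros Ht. pose proof (exp_ineq1_le (2 * t)). lra. Qed.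

Lemma freq_sq nu t : 0 <= t -> freq nu t ^ 2 = nu ^ 2 * (exp (2 * t) - 1).
Proof.
  intros Ht. unfold freq. rewrite Rpow_mult_distr, pow2_sqrt; [easy|]. now apply exp2_ge1.
Qed.

(** The mixed Wronskian of [v] and [sin (m * (u - s))] does not decrease while the sine is
    nonnegative. It is [m * v s >= 0] at [s], but would be [- m * v g < 0] at the next zero
    [g = s + PI / m] of the sine. *)
Lemma sturm_upper nu v v' m s t : sol nu v v' -> 0 < m -> s < t ->
  (forall u, s <= u <= t -> m ^ 2 <= nu ^ 2 * (exp (2 * u) - 1)) ->
  0 <= v s -> (forall u, s < u < t -> 0 < v u) -> m * (t - s) <= PI.
Proof.
  intros [Hv Hv'] Hm Hst HQ Hs Hpos. apply Rnot_lt_le. intros Hlt.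
  set (g := s + PI / m). assert (HPI := PI_RGT_0).
  assert (Hsg : s < g) by (unfold g; assert (0 < PI / m) by (now apply Rdiv_lt_0_compat); lra).
  assert (Hmg : m * (g - s) = PI) by (unfold g; field; lra).
  assert (Hgt : g < t) by nra.
  assert (H : v s * (m * cos (m * (s - s))) - v' s * sin (m * (s - s))
     <= v g * (m * cos (m * (g - s))) - v' g * sin (m * (g - s))).
  { apply (deriv_nonneg_le (fun u => v u * (m * cos (m * (u - s))) - v' u * sin (m * (u - s)))
      (fun u => (nu ^ 2 * (exp (2 * u) - 1) - m ^ 2) * v u * sin (m * (u - s)))); [lra| |].
    - intros u _. auto_derive.
      + repeat split; eexists; eauto.
      + derive_with (Hv u). derive_with (Hv' u). unfold Rminus. ring.
    - intros u Hu. specialize (HQ u ltac:(lra)). specialize (Hpos u ltac:(lra)).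
      assert (0 <= sin (m * (u - s))) by (apply sin_ge_0; nra).
      apply Rmult_le_pos; [|easy]. apply Rmult_le_pos; lra. }
  rewrite Hmg, cos_PI, sin_PI, Rminus_diag, Rmult_0_r, cos_0, sin_0 in H.
  specialize (Hpos g ltac:(lra)). nra.
Qed.

(** The same Wronskian with the inequality reversed: it vanishes at [s] and does not increase, yet
    for [m * (t - s) < PI] it would be [- v' t * sin (m * (t - s)) > 0] at [t]. The bound [m] is
    kept apart from [freq], which may be 0. *)
Lemma sturm_lower nu v v' m s t : sol nu v v' -> 0 < m -> s < t ->
  (forall u, s <= u <= t -> nu ^ 2 * (exp (2 * u) - 1) <= m ^ 2) ->
  v s = 0 -> v t = 0 -> v' t < 0 -> (forall u, s < u < t -> 0 < v u) -> PI <= m * (t - s).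
Proof.
  intros [Hv Hv'] Hm Hst HQ Hs Ht Ht' Hpos. apply Rnot_lt_le. intros Hlt.
  assert (H : - (v s * (m * cos (m * (s - s))) - v' s * sin (m * (s - s)))
     <= - (v t * (m * cos (m * (t - s))) - v' t * sin (m * (t - s)))).
  { apply (deriv_nonneg_le
      (fun u => - (v u * (m * cos (m * (u - s))) - v' u * sin (m * (u - s))))
      (fun u => (m ^ 2 - nu ^ 2 * (exp (2 * u) - 1)) * v u * sin (m * (u - s)))); [lra| |].
    - intros u _. auto_derive.
      + repeat split; eexists; eauto.
      + derive_with (Hv u). derive_with (Hv' u). unfold Rminus. ring.
    - intros u Hu. specialize (HQ u ltac:(lra)). specialize (Hpos u ltac:(lra)).
      assert (0 <= sin (m * (u - s))) by (apply sin_ge_0; nra).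
      apply Rmult_le_pos; [|easy]. apply Rmult_le_pos; lra. }
  rewrite Rminus_diag, Rmult_0_r, sin_0, Hs, Ht in H.
  assert (0 < sin (m * (t - s))) by (apply sin_gt_0; nra). nra.
Qed.

(** To be used with [A] equal to [J] and [B] equal to [Y] or [- Y], the sign being the one that
    makes [(A, B)] rotate in the positive direction. *)
Record phased (nu W : R) (A A' B B' psi : R -> R) : Prop := {
  ph_nu : 0 < nu;
  ph_W : 0 < W;
  ph_A : sol nu A A';
  ph_B : sol nu B B';
  ph_wronskian : forall t, A t * B' t - A' t * B t = W;
  ph_derive : forall t, is_derive psi t (W / (A t ^ 2 + B t ^ 2));
  ph_sin : forall s t, A s * B t - B s * A t
      = sqrt (A s ^ 2 + B s ^ 2) * sqrt (A t ^ 2 + B t ^ 2) * sin (psi t - psi s) }.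

Lemma ph_modulus_pos nu W A A' B B' psi : phased nu W A A' B B' psi ->
  forall t, 0 < A t ^ 2 + B t ^ 2.
Proof.
  intros H t. pose proof (ph_W _ _ _ _ _ _ _ H). pose proof (ph_wronskian _ _ _ _ _ _ _ H t).
  pose proof (pow2_ge_0 (A t)). pose proof (pow2_ge_0 (B t)).
  apply Rnot_le_lt. intros Hle.
  assert (A t = 0) by nra. assert (B t = 0) by nra. nra.
Qed.

Lemma ph_increasing nu W A A' B B' psi : phased nu W A A' B B' psi ->
  forall s t, s < t -> psi s < psi t.
Proof.
  intros H s t Hst. eapply deriv_pos_lt; [easy|intros; apply (ph_derive _ _ _ _ _ _ _ H)|].
  intros x _. apply Rdiv_lt_0_compat; [apply (ph_W _ _ _ _ _ _ _ H)|].
  apply (ph_modulus_pos _ _ _ _ _ _ _ H).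
Qed.

Lemma ph_continuity nu W A A' B B' psi : phased nu W A A' B B' psi -> continuity psi.
Proof. intros H t. eapply is_derive_continuity_pt, (ph_derive _ _ _ _ _ _ _ H). Qed.

Lemma ph_reaches nu W A A' B B' psi : phased nu W A A' B B' psi ->
  forall s t c, s <= t -> 0 <= c <= psi t - psi s ->
  exists u, s <= u <= t /\ psi u - psi s = c.
Proof.
  intros H s t c Hst Hc.
  destruct (IVT_gen psi s t (psi s + c) (ph_continuity _ _ _ _ _ _ _ H)) as [u [Hu1 Hu2]].
  - rewrite Rmin_left, Rmax_right by lra. lra.
  - rewrite Rmin_left, Rmax_right in Hu1 by lra. exists u. split; [easy|lra].
Qed.

Lemma ph_cross_sol nu W A A' B B' psi : phased nu W A A' B B' psi ->
  forall s, sol nu (fun t => A s * B t - B s * A t) (fun t => A s * B' t - B s * A' t).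
Proof.
  intros H s. eapply sol_ext;
    [| |apply (sol_comb nu B B' A A' (A s) (- B s)); [apply (ph_B _ _ _ _ _ _ _ H)|apply (ph_A _ _ _ _ _ _ _ H)]];
    intros; simpl; ring.
Qed.

Lemma ph_cross_pos nu W A A' B B' psi : phased nu W A A' B B' psi ->
  forall s u, 0 < psi u - psi s < PI -> 0 < A s * B u - B s * A u.
Proof.
  intros H s u Hu. rewrite (ph_sin _ _ _ _ _ _ _ H s u).
  pose proof (ph_modulus_pos _ _ _ _ _ _ _ H s). pose proof (ph_modulus_pos _ _ _ _ _ _ _ H u).
  apply Rmult_lt_0_compat; [apply Rmult_lt_0_compat; now apply sqrt_lt_R0|now apply sin_gt_0].
Qed.

(* When (A, B)(s) and (A, B)(t) are parallel, the derivative at [t] of the solution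
   vanishing at [s] is the Wronskian times the ratio of the moduli. *)
Lemma ph_cross_derivative nu W A A' B B' psi : phased nu W A A' B B' psi ->
  forall s t, A s * B t - B s * A t = 0 ->
  (A s * B' t - B s * A' t) ^ 2 * (A t ^ 2 + B t ^ 2) = W ^ 2 * (A s ^ 2 + B s ^ 2).
Proof.
  intros H s t H0. pose proof (ph_wronskian _ _ _ _ _ _ _ H t) as HW.
  assert (E1 : (A s * B' t - B s * A' t) * A t = A s * W).
  { rewrite <- HW. transitivity (A s * (A t * B' t - A' t * B t)
      + A' t * (A s * B t - B s * A t)); [ring|rewrite H0; ring]. }
  assert (E2 : (A s * B' t - B s * A' t) * B t = B s * W).
  { rewrite <- HW. transitivity (B s * (A t * B' t - A' t * B t)
      + B' t * (A s * B t - B s * A t)); [ring|rewrite H0; ring]. }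
  transitivity (((A s * B' t - B s * A' t) * A t) ^ 2 + ((A s * B' t - B s * A' t) * B t) ^ 2);
    [ring|]. rewrite E1, E2. ring.
Qed.

Lemma ph_step_upper nu W A A' B B' psi : phased nu W A A' B B' psi ->
  forall s t, s <= t -> psi t - psi s <= PI -> freq nu s * (t - s) <= PI.
Proof.
  intros H s t Hst Hp. assert (HPI := PI_RGT_0). assert (Hnu := ph_nu _ _ _ _ _ _ _ H).
  destruct (Rle_dec s 0) as [Hs|Hs]; [rewrite freq_le0 by easy; lra|].
  destruct Hst as [Hst| <-]; [|lra].
  assert (Hf : 0 < freq nu s).
  { apply Rmult_lt_0_compat; [easy|]. apply sqrt_lt_R0.
    pose proof (exp_ineq1 (2 * s) ltac:(lra)). lra. }
  apply (sturm_upper nu _ _ (freq nu s) s t (ph_cross_sol _ _ _ _ _ _ _ H s)); auto.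
  - intros u Hu. rewrite freq_sq by lra. pose proof (exp_le (2 * s) (2 * u) ltac:(lra)).
    apply Rmult_le_compat_l; [apply pow2_ge_0|lra].
  - right. ring.
  - intros u Hu. apply (ph_cross_pos _ _ _ _ _ _ _ H).
    pose proof (ph_increasing _ _ _ _ _ _ _ H s u). pose proof (ph_increasing _ _ _ _ _ _ _ H u t). lra.
Qed.

Lemma ph_step_lower nu W A A' B B' psi : phased nu W A A' B B' psi ->
  forall s t, s <= t -> psi t - psi s = PI -> PI <= freq nu t * (t - s).
Proof.
  intros H s t Hst Hp. assert (HPI := PI_RGT_0). assert (Hnu := ph_nu _ _ _ _ _ _ _ H).
  destruct Hst as [Hst| <-]; [|lra].
  assert (Hv0 : A s * B t - B s * A t = 0).
  { rewrite (ph_sin _ _ _ _ _ _ _ H), Hp, sin_PI. ring. }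
  assert (Hpos : forall u, s < u < t -> 0 < A s * B u - B s * A u).
  { intros u Hu. apply (ph_cross_pos _ _ _ _ _ _ _ H).
    pose proof (ph_increasing _ _ _ _ _ _ _ H s u). pose proof (ph_increasing _ _ _ _ _ _ _ H u t). lra. }
  assert (Hd : A s * B' t - B s * A' t < 0).
  { pose proof (ph_cross_derivative _ _ _ _ _ _ _ H s t Hv0) as E.
    pose proof (ph_modulus_pos _ _ _ _ _ _ _ H s) as Ms. assert (HW := ph_W _ _ _ _ _ _ _ H).
    (* A zero slope contradicts the relation [E]; a positive slope would make the solution negative
       just before [t]. *)
    destruct (Rtotal_order (A s * B' t - B s * A' t) 0) as [Hlt|[E0|Hgt]]; [easy| |].
    - rewrite E0 in E. exfalso. assert (0 < W ^ 2) by nra. nra.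
    - destruct (derive_pos_sign (fun u => A s * B u - B s * A u) t _
        (proj1 (ph_cross_sol _ _ _ _ _ _ _ H s) t) Hv0 Hgt) as [d [Hd [Hn _]]].
      pose proof (Rmax_l s (t - d)). pose proof (Rmax_r s (t - d)).
      assert (Rmax s (t - d) < t) by (apply Rmax_lub_lt; lra).
      specialize (Hn ((Rmax s (t - d) + t) / 2) ltac:(lra)).
      specialize (Hpos ((Rmax s (t - d) + t) / 2) ltac:(lra)). simpl in Hn. lra. }
  assert (Hm : forall m, 0 < m -> nu ^ 2 * (exp (2 * t) - 1) <= m ^ 2 -> PI <= m * (t - s)).
  { intros m Hm HQ. apply (sturm_lower nu _ _ m s t (ph_cross_sol _ _ _ _ _ _ _ H s)); auto.
    - intros u Hu. pose proof (exp_le (2 * u) (2 * t) ltac:(lra)).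
      apply Rle_trans with (2 := HQ). apply Rmult_le_compat_l; [apply pow2_ge_0|lra].
    - ring. }
  destruct (Rle_dec t 0) as [Ht|Ht].
  (* Left of the turning point every [m > 0] bounds the coefficient; half the frequency needed for a
     half-turn gives the contradiction. *)
  - exfalso. specialize (Hm (PI / (2 * (t - s))) ltac:(apply Rdiv_lt_0_compat; lra)).
    replace (PI / (2 * (t - s)) * (t - s)) with (PI / 2) in Hm by (field; lra).
    enough (PI <= PI / 2) by lra. apply Hm.
    pose proof (exp_le (2 * t) 0 ltac:(lra)) as He. rewrite exp_0 in He.
    pose proof (pow2_ge_0 nu). pose proof (pow2_ge_0 (PI / (2 * (t - s)))). nra.
  - apply Hm.
    + apply Rmult_lt_0_compat; [easy|]. apply sqrt_lt_R0.
      pose proof (exp_ineq1 (2 * t) ltac:(lra)). lra.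
    + rewrite freq_sq by lra. lra.
Qed.

Lemma ph_count_lower nu W A A' B B' psi : phased nu W A A' B B' psi ->
  forall n s t, s <= t -> INR n * PI <= psi t - psi s -> INR n * PI <= freq nu t * (t - s).
Proof.
  intros H n. assert (Hnu := ph_nu _ _ _ _ _ _ _ H). assert (HPI := PI_RGT_0).
  induction n as [|n IH]; intros s t Hst Hp.
  - simpl. pose proof (freq_nonneg nu t ltac:(lra)). nra.
  - rewrite S_INR in *. pose proof (pos_INR n).
    destruct (ph_reaches _ _ _ _ _ _ _ H s t PI Hst) as [u [Hu1 Hu2]]; [nra|].
    pose proof (ph_step_lower _ _ _ _ _ _ _ H s u ltac:(lra) Hu2).
    specialize (IH u t ltac:(lra) ltac:(lra)).
    pose proof (freq_mono nu u t ltac:(lra) ltac:(lra)). nra.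
Qed.

Lemma ph_count_upper nu W A A' B B' psi : phased nu W A A' B B' psi ->
  forall n s t, s <= t -> psi t - psi s <= INR n * PI -> freq nu s * (t - s) <= INR n * PI.
Proof.
  intros H n. assert (Hnu := ph_nu _ _ _ _ _ _ _ H). assert (HPI := PI_RGT_0).
  induction n as [|n IH]; intros s t Hst Hp.
  - simpl in *. destruct Hst as [Hst| <-]; [|lra].
    pose proof (ph_increasing _ _ _ _ _ _ _ H s t Hst). lra.
  - rewrite S_INR in *. pose proof (pos_INR n).
    destruct (Rle_dec (psi t - psi s) PI) as [Hle|Hle].
    + pose proof (ph_step_upper _ _ _ _ _ _ _ H s t Hst Hle). nra.
    + destruct (ph_reaches _ _ _ _ _ _ _ H s t PI Hst) as [u [Hu1 Hu2]]; [lra|].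
      pose proof (ph_step_upper _ _ _ _ _ _ _ H s u ltac:(lra) ltac:(lra)).
      specialize (IH u t ltac:(lra) ltac:(lra)).
      pose proof (freq_mono nu s u ltac:(lra) ltac:(lra)). nra.
Qed.

Lemma nat_bracket x : 0 <= x -> exists n, INR n <= x < INR n + 1.
Proof.
  intros Hx. destruct (nfloor_ex x Hx) as [n Hn]. exists n. exact Hn.
Qed.

(** The slack [PI] comes from rounding the phase increment to whole half-turns. *)
Lemma ph_piece nu W A A' B B' psi : phased nu W A A' B B' psi ->
  forall s t, s <= t ->
  freq nu s * (t - s) - PI <= psi t - psi s <= freq nu t * (t - s) + PI.
Proof.
  intros H s t Hst. assert (HPI := PI_RGT_0).
  assert (Hp : 0 <= psi t - psi s).
  { destruct Hst as [Hst| <-]; [|lra]. pose proof (ph_increasing _ _ _ _ _ _ _ H s t Hst). lra. }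
  destruct (nat_bracket ((psi t - psi s) / PI)) as [n Hn].
  { apply Rmult_le_pos; [easy|left; now apply Rinv_0_lt_compat]. }
  set (x := (psi t - psi s) / PI) in *.
  assert (E : psi t - psi s = x * PI) by (unfold x; field; lra).
  assert (H1 : INR n * PI <= psi t - psi s) by (rewrite E; nra).
  assert (H2 : psi t - psi s <= INR (S n) * PI) by (rewrite E, S_INR; nra).
  pose proof (ph_count_lower _ _ _ _ _ _ _ H n s t Hst H1).
  pose proof (ph_count_upper _ _ _ _ _ _ _ H (S n) s t Hst H2).
  rewrite S_INR in *. lra.
Qed.

(* An antiderivative of [freq 1] on the whole line. *)
Definition action (t : R) : R := sqrt (exp (2 * t) - 1) - atan (sqrt (exp (2 * t) - 1)).

Lemma action_derive t : t <> 0 -> is_derive action t (sqrt (exp (2 * t) - 1)).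
Proof.
  intros Ht. destruct (Rlt_dec 0 t) as [Hp|Hn].
  - pose proof (exp_ineq1 (2 * t) ltac:(lra)) as He.
    assert (Hs : 0 < sqrt (exp (2 * t) - 1)) by (apply sqrt_lt_R0; lra).
    assert (Hs2 : sqrt (exp (2 * t) - 1) ^ 2 = exp (2 * t) - 1) by (apply pow2_sqrt; lra).
    unfold action. auto_derive; [unfold Rminus in *; repeat split; lra|].
    unfold Rminus in *. set (S := sqrt (exp (2 * t) + - (1))) in *.
    replace (exp (2 * t)) with (S ^ 2 + 1) by lra. unfold Rsqr. field. split; nra.
  - assert (Hz : forall s, s < 0 -> sqrt (exp (2 * s) - 1) = 0).
    { intros s Hs. apply sqrt_neg_0. pose proof (exp_le (2 * s) 0 ltac:(lra)) as H.
      rewrite exp_0 in H. lra. }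
    rewrite Hz by lra.
    apply (is_derive_ext_loc (fun _ => 0)); [|apply (@is_derive_const R_AbsRing R_NormedModule)].
    assert (Hl : locally t (fun s => s < 0)) by (apply (open_lt 0); lra).
    apply filter_imp with (2 := Hl). intros s Hs. unfold action.
    rewrite Hz, atan_0 by easy. simpl. symmetry. apply Rminus_diag.
Qed.

Lemma action_continuity : continuity action.
Proof.
  intros t. apply continuity_pt_minus; [|apply (continuity_pt_comp (fun t => sqrt (exp (2 * t) - 1)) atan)].
  3: apply derivable_continuous_pt, derivable_pt_atan.
  all: apply continuity_pt_filterlim;
    apply (continuous_comp (fun t => exp (2 * t) - 1) sqrt); [|apply continuous_sqrt];
    rapply @ex_derive_continuous; auto_derive; easy.
Qed.

Lemma action_piece s t : s <= t ->
  freq 1 s * (t - s) <= action t - action s <= freq 1 t * (t - s).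
Proof.
  assert (Hi : forall s t, s <= t -> ~ s < 0 < t ->
    freq 1 s * (t - s) <= action t - action s <= freq 1 t * (t - s)).
  { clear. intros s t [Hst| <-] H0; [|lra].
    destruct (MVT_interior action (freq 1) s t Hst) as [c [Hc E]].
    - intros x Hx. unfold freq. rewrite Rmult_1_l. apply action_derive. lra.
    - intros x _. apply action_continuity.
    - pose proof (freq_mono 1 s c ltac:(lra) ltac:(lra)).
      pose proof (freq_mono 1 c t ltac:(lra) ltac:(lra)). nra. }
  intros Hst. destruct (classic (s < 0 < t)) as [H0|H0]; [|now apply Hi].
  pose proof (Hi s 0 ltac:(lra) ltac:(lra)) as H1. pose proof (Hi 0 t ltac:(lra) ltac:(lra)) as H2.
  rewrite (freq_le0 1 s), (freq_le0 1 0) in * by lra.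
  pose proof (freq_nonneg 1 t ltac:(lra)). nra.
Qed.

(** On each piece [nu * action] advances by an amount between [freq nu u * h] and
    [freq nu (u + h) * h], and so does the phase up to [PI]. The lengths of these ranges
    telescope. *)
Lemma ph_partition nu W A A' B B' psi : phased nu W A A' B B' psi ->
  forall N s h, 0 <= h ->
  Rabs (psi (s + INR N * h) - psi s - nu * (action (s + INR N * h) - action s))
  <= INR N * PI + h * (freq nu (s + INR N * h) - freq nu s).
Proof.
  intros H N s h Hh. assert (Hnu := ph_nu _ _ _ _ _ _ _ H).
  induction N as [|N IH].
  - simpl. rewrite Rmult_0_l, Rplus_0_r, !Rminus_diag, !Rmult_0_r, Rmult_0_l, Rminus_0_r, Rabs_R0. lra.
  - rewrite S_INR. replace (s + (INR N + 1) * h) with (s + INR N * h + h) by ring.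
    set (u := s + INR N * h) in *.
    pose proof (ph_piece _ _ _ _ _ _ _ H u (u + h) ltac:(lra)) as H1.
    pose proof (action_piece u (u + h) ltac:(lra)) as H2.
    assert (E : forall x, freq nu x = nu * freq 1 x) by (intros; unfold freq; ring).
    replace (u + h - u) with h in * by ring.
    assert (H3 : freq nu u * h <= nu * (action (u + h) - action u) <= freq nu (u + h) * h).
    { rewrite !E, !Rmult_assoc. split; apply Rmult_le_compat_l; lra. }
    apply Rabs_le_between in IH. apply Rabs_le. lra.
Qed.

(** * The zeros of the cross product *)

(* The energy [v'^2 + nu^2 (e^(2t) - 1) v^2] increases along a solution, so the modulus is
   smaller at the right end of an interval whose ends are zeros of a common solution. *)
Lemma ph_crossing nu W A A' B B' psi : phased nu W A A' B B' psi ->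
  forall s t, s < t -> A s * B t - B s * A t = 0 ->
  0 < W / (A t ^ 2 + B t ^ 2) - W / (A s ^ 2 + B s ^ 2).
Proof.
  intros H s t Hst H0. assert (HPI := PI_RGT_0).
  assert (Hnu := ph_nu _ _ _ _ _ _ _ H). assert (HW := ph_W _ _ _ _ _ _ _ H).
  pose proof (ph_modulus_pos _ _ _ _ _ _ _ H s) as Ms.
  pose proof (ph_modulus_pos _ _ _ _ _ _ _ H t) as Mt.
  set (v := fun t => A s * B t - B s * A t).
  set (v' := fun t => A s * B' t - B s * A' t).
  assert (Hsol : sol nu v v') by exact (ph_cross_sol _ _ _ _ _ _ _ H s).
  destruct Hsol as [Hv Hv'].
  set (E := fun u => v' u ^ 2 + nu ^ 2 * (exp (2 * u) - 1) * v u ^ 2).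
  assert (HE : forall u, is_derive E u (2 * nu ^ 2 * exp (2 * u) * v u ^ 2)).
  { intros u. unfold E. clearbody v v'. auto_derive.
    - repeat split; eexists; eauto.
    - derive_with (Hv u). derive_with (Hv' u). unfold Rminus. ring. }
  assert (Hinc := ph_increasing _ _ _ _ _ _ _ H).
  assert (Hd := Hinc s t Hst).
  (* Up to a quarter turn after [s] the solution is positive, so the energy increases strictly on
     this first stretch; afterwards weak monotonicity is enough. *)
  destruct (ph_reaches _ _ _ _ _ _ _ H s t (Rmin (PI / 2) (psi t - psi s))) as [u [Hu1 Hu2]].
  { lra. }
  { split; [apply Rmin_glb; lra|apply Rmin_r]. }
  pose proof (Rmin_l (PI / 2) (psi t - psi s)).
  assert (0 < Rmin (PI / 2) (psi t - psi s)) by (apply Rmin_glb_lt; lra).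
  assert (Hsu : s < u) by (destruct Hu1 as [[Hlt| <-] _]; [easy|lra]).
  assert (E1 : E s < E u).
  { apply (deriv_pos_lt E _ s u Hsu (fun x _ => HE x)). intros x Hx.
    pose proof (Hinc s x ltac:(lra)). pose proof (Hinc x u ltac:(lra)).
    assert (0 < v x) by (apply (ph_cross_pos _ _ _ _ _ _ _ H); lra).
    pose proof (exp_pos (2 * x)).
    apply Rmult_lt_0_compat; [|now apply pow_lt].
    apply Rmult_lt_0_compat; [|easy]. pose proof (pow_lt nu 2 Hnu). lra. }
  assert (E2 : E u <= E t).
  { apply (deriv_nonneg_le E _ u t ltac:(lra) (fun x _ => HE x)). intros x Hx.
    pose proof (exp_pos (2 * x)). pose proof (pow2_ge_0 nu).
    apply Rmult_le_pos; [nra|apply pow2_ge_0]. }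
  assert (Vs : v s = 0) by (unfold v; ring). assert (Vt : v t = 0) by exact H0.
  assert (Vs' : v' s = W) by (unfold v'; rewrite <- (ph_wronskian _ _ _ _ _ _ _ H s); ring).
  unfold E in E1, E2. rewrite Vs, Vs' in E1. rewrite Vt in E2.
  pose proof (ph_cross_derivative _ _ _ _ _ _ _ H s t H0) as E3. fold (v' t) in E3.
  (* Both ends are zeros of [v], so the energies there are [W ^ 2] and [v' t ^ 2]; [E3] turns the
     gain of energy into a loss of modulus. *)
  assert (E4 : W ^ 2 < v' t ^ 2) by lra.
  assert (E5 : A t ^ 2 + B t ^ 2 < A s ^ 2 + B s ^ 2).
  { assert (0 < W ^ 2) by now apply pow_lt. nra. }
  pose proof (Rinv_lt_contravar _ _ (Rmult_lt_0_compat _ _ Mt Ms) E5). unfold Rdiv. nra.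
Qed.

Lemma sin_nat_PI n : sin (INR n * PI) = 0.
Proof. apply sin_eq_0_1. exists (Z.of_nat n). now rewrite <- INR_IZR_INZ. Qed.

Lemma ph_cross_zero_iff nu W A A' B B' psi : phased nu W A A' B B' psi ->
  forall s t, s < t ->
  (A s * B t - B s * A t = 0 <-> exists n, psi t - psi s = INR (S n) * PI).
Proof.
  intros H s t Hst. assert (HPI := PI_RGT_0).
  rewrite (ph_sin _ _ _ _ _ _ _ H s t). split.
  - intros H0.
    assert (Hs : sin (psi t - psi s) = 0).
    { apply Rmult_integral in H0. destruct H0 as [H0|H0]; [|easy].
      pose proof (sqrt_lt_R0 _ (ph_modulus_pos _ _ _ _ _ _ _ H s)).
      pose proof (sqrt_lt_R0 _ (ph_modulus_pos _ _ _ _ _ _ _ H t)). nra. }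
    apply sin_eq_0_0 in Hs. destruct Hs as [k Hk].
    pose proof (ph_increasing _ _ _ _ _ _ _ H s t Hst).
    assert (Hk0 : 0 < IZR k) by nra. apply lt_IZR in Hk0.
    exists (Z.to_nat (k - 1)). rewrite Hk, S_INR, INR_IZR_INZ, Z2Nat.id, minus_IZR by lia. ring.
  - intros [n Hn]. rewrite Hn, sin_nat_PI. ring.
Qed.

(** The derivative of the increment is controlled only where the increment is a multiple of [PI]:
    there the two ends are zeros of a common solution and [ph_crossing] applies. This is all that
    [upcrossing] asks for. *)
Lemma ph_level_exceeds nu W A A' B B' psi T : phased nu W A A' B B' psi -> 0 < T ->
  forall n s t, s < t -> INR (S n) * PI <= psi (s + T) - psi s ->
  INR (S n) * PI < psi (t + T) - psi t.
Proof.
  intros H HT n s t Hst Hs.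
  cut (0 < psi (t + T) - psi t - INR (S n) * PI); [lra|].
  apply (upcrossing (fun t => psi (t + T) - psi t - INR (S n) * PI)
    (fun t => W / (A (t + T) ^ 2 + B (t + T) ^ 2) - W / (A t ^ 2 + B t ^ 2)) s t); auto; [| |lra].
  - intros x.
    pose proof (ph_derive _ _ _ _ _ _ _ H x) as D1.
    pose proof (ph_derive _ _ _ _ _ _ _ H (x + T)) as D2.
    auto_derive.
    + repeat split; eexists; eauto.
    + derive_with D1. derive_with D2. ring.
  - intros x Hx. apply (ph_crossing _ _ _ _ _ _ _ H); [lra|].
    apply (ph_cross_zero_iff _ _ _ _ _ _ _ H); [lra|]. exists n. lra.
Qed.

Lemma ph_level_reached nu W A A' B B' psi T : phased nu W A A' B B' psi -> 0 < T ->
  forall n, exists t, psi (t + T) - psi t = INR (S n) * PI.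
Proof.
  intros H HT n. assert (HPI := PI_RGT_0). assert (Hnu := ph_nu _ _ _ _ _ _ _ H).
  assert (Hn : 0 <= INR n) by apply pos_INR.
  (* With [exp (2 * t1) = 1 + a ^ 2] this gives [freq nu t1 * T = (INR (S n) + 1) * PI]; the extra
     [PI] absorbs the slack of [ph_piece]. *)
  set (a := (INR (S n) + 1) * PI / (nu * T)).
  assert (HnT : 0 < nu * T) by now apply Rmult_lt_0_compat.
  assert (Ha : 0 < a) by (unfold a; rewrite S_INR; apply Rdiv_lt_0_compat; nra).
  set (t1 := ln (1 + a ^ 2) / 2).
  assert (He : exp (2 * t1) = 1 + a ^ 2).
  { unfold t1. replace (2 * (ln (1 + a ^ 2) / 2)) with (ln (1 + a ^ 2)) by field.
    apply exp_ln. nra. }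
  assert (H1 : INR (S n) * PI <= psi (t1 + T) - psi t1).
  { pose proof (ph_piece _ _ _ _ _ _ _ H t1 (t1 + T) ltac:(lra)) as [HP _].
    replace (t1 + T - t1) with T in HP by ring. unfold freq in HP.
    rewrite He in HP. replace (1 + a ^ 2 - 1) with (a ^ 2) in HP by ring.
    rewrite sqrt_pow2 in HP by lra.
    replace (nu * a * T) with ((INR (S n) + 1) * PI) in HP by (unfold a; field; lra). lra. }
  (* The window from [- T] to 0 lies left of the turning point, where not even one half-turn is
     completed. *)
  assert (H2 : psi (- T + T) - psi (- T) <= INR (S n) * PI).
  { apply Rnot_lt_le. intros Hlt.
    pose proof (ph_count_lower _ _ _ _ _ _ _ H 1 (- T) (- T + T) ltac:(lra)) as HC.
    rewrite freq_le0, Rmult_0_l in HC by lra. rewrite S_INR in Hlt. simpl INR in HC.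
    assert (1 * PI <= 0); [|lra]. apply HC. nra. }
  destruct (IVT_gen (fun t => psi (t + T) - psi t) (- T) t1 (INR (S n) * PI)) as [t [_ Ht]].
  - intros x. pose proof (ph_derive _ _ _ _ _ _ _ H x) as D1.
    pose proof (ph_derive _ _ _ _ _ _ _ H (x + T)) as D2.
    apply ex_derive_continuity_pt. auto_derive. repeat split; eexists; eauto.
  - pose proof (Rmin_l (psi (- T + T) - psi (- T)) (psi (t1 + T) - psi t1)).
    pose proof (Rmax_r (psi (- T + T) - psi (- T)) (psi (t1 + T) - psi t1)). lra.
  - now exists t.
Qed.

Lemma ph_level_lt nu W A A' B B' psi T : phased nu W A A' B B' psi -> 0 < T ->
  forall m n s t, psi (s + T) - psi s = INR (S m) * PI -> psi (t + T) - psi t = INR (S n) * PI ->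
  (m < n)%nat <-> s < t.
Proof.
  intros H HT m n s t Hs Ht. assert (HPI := PI_RGT_0).
  assert (Hmn : s < t -> (m < n)%nat).
  { intros Hst.
    pose proof (ph_level_exceeds _ _ _ _ _ _ _ _ H HT m s t Hst ltac:(lra)) as HL.
    rewrite Ht in HL. apply Rmult_lt_reg_r in HL; [|easy]. apply INR_lt in HL. lia. }
  split; [|exact Hmn]. intros Hlt.
  destruct (Rtotal_order s t) as [Hst|[<-|Hst]]; [easy| |].
  - rewrite Hs in Ht. apply Rmult_eq_reg_r in Ht; [|lra]. apply INR_eq in Ht. lia.
  - pose proof (ph_level_exceeds _ _ _ _ _ _ _ _ H HT n t s Hst ltac:(lra)) as HL.
    rewrite Hs in HL. apply Rmult_lt_reg_r in HL; [|easy]. apply INR_lt in HL. lia.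
Qed.

(** Both directions of the enumeration count: every level gives a zero, so that the [epsilon] choice
    has a witness, and every zero is a level, which identifies the chosen one. Upward crossing
    orders the zeros like their indices. *)
Lemma kth_zero_phase nu W A A' B B' psi T f k : phased nu W A A' B B' psi -> 0 < T ->
  (forall t, f (nu * exp t) = 0 <-> A t * B (t + T) - B t * A (t + T) = 0) ->
  exists t, epsilon (inhabits 0) (is_kth_pos_zero f (S k)) = nu * exp t /\
    psi (t + T) - psi t = INR (S k) * PI.
Proof.
  intros H HT Hf. assert (Hnu := ph_nu _ _ _ _ _ _ _ H). assert (HPI := PI_RGT_0).
  pose (tz := fun i => proj1_sig (constructive_indefinite_description _
    (ph_level_reached _ _ _ _ _ _ _ _ H HT i))).
  assert (Htz : forall i, psi (tz i + T) - psi (tz i) = INR (S i) * PI).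
  { intros i. unfold tz. apply proj2_sig. }
  clearbody tz.
  assert (Hord : forall m n, (m < n)%nat <-> tz m < tz n).
  { intros m n. now apply (ph_level_lt _ _ _ _ _ _ _ _ H HT). }
  assert (Hzero : forall t, f (nu * exp t) = 0 -> exists i, t = tz i).
  { intros t Ht. apply Hf in Ht. apply (ph_cross_zero_iff _ _ _ _ _ _ _ H) in Ht; [|lra].
    destruct Ht as [i Hi]. exists i.
    destruct (Rtotal_order t (tz i)) as [Hl|[E|Hl]]; [|easy|];
      apply (ph_level_lt _ _ _ _ _ _ _ _ H HT i i) in Hl; auto; lia. }
  assert (Hzero' : forall i, f (nu * exp (tz i)) = 0).
  { intros i. apply Hf, (ph_cross_zero_iff _ _ _ _ _ _ _ H); [lra|]. now exists i. }
  assert (Hexp : forall a b, nu * exp a < nu * exp b <-> a < b).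
  { intros a b. split; intros Hab.
    - apply exp_lt_inv. now apply Rmult_lt_reg_l with nu.
    - apply Rmult_lt_compat_l; [easy|now apply exp_increasing]. }
  assert (Hlog : forall y, 0 < y -> exists t, y = nu * exp t).
  { intros y Hy. exists (ln (y / nu)). rewrite exp_ln by now apply Rdiv_lt_0_compat. field. lra. }
  set (Lz := fun i => map (fun j => nu * exp (tz j)) (seq 0 i)).
  assert (HLz : forall i, NoDup (Lz i) /\ length (Lz i) = i /\
    forall y, In y (Lz i) <-> (0 < y < nu * exp (tz i) /\ f y = 0)).
  { intros i. split; [|split].
    - apply FinFun.Injective_map_NoDup; [|apply seq_NoDup].
      intros a b Hab. destruct (Nat.lt_total a b) as [Hl|[E|Hl]]; [|easy|];
        apply Hord, Hexp in Hl; lra.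
    - unfold Lz. now rewrite length_map, length_seq.
    - intros y. unfold Lz. rewrite in_map_iff. split.
      + intros [j [<- Hj]]. apply in_seq in Hj. split; [split|apply Hzero'].
        * apply Rmult_lt_0_compat; [easy|apply exp_pos].
        * apply Hexp, Hord. lia.
      + intros [Hy Hy0]. destruct (Hlog y (proj1 Hy)) as [t ->].
        destruct (Hzero t Hy0) as [j ->]. exists j. split; [easy|].
        apply in_seq. destruct Hy as [_ Hy]. apply Hexp, Hord in Hy. lia. }
  assert (HP : is_kth_pos_zero f (S k) (epsilon (inhabits 0) (is_kth_pos_zero f (S k)))).
  { apply epsilon_spec. exists (nu * exp (tz k)).
    destruct (HLz k) as [L1 [L2 L3]].
    split; [lia|]. split; [apply Rmult_lt_0_compat; [easy|apply exp_pos]|].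
    split; [apply Hzero'|]. exists (Lz k). split; [easy|]. split; [lia|easy]. }
  destruct HP as [_ [Hz [Hz0 [L [N1 [N2 N3]]]]]].
  set (z := epsilon (inhabits 0) (is_kth_pos_zero f (S k))) in *.
  destruct (Hlog z Hz) as [t Et]. exists t. split; [easy|].
  rewrite Et in Hz0. destruct (Hzero t Hz0) as [p ->].
  destruct (HLz p) as [L1 [L2 L3]].
  (* The list certified by the choice and [Lz p] are duplicate-free with the same members, so their
     lengths [k] and [p] agree. *)
  assert (HS : forall y, In y L <-> In y (Lz p)) by (intros y; rewrite N3, L3, Et; tauto).
  assert (length L <= length (Lz p))%nat by (apply NoDup_incl_length; [easy|intros y; apply HS]).
  assert (length (Lz p) <= length L)%nat by (apply NoDup_incl_length; [easy|intros y; apply HS]).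
  replace k with p by lia. apply Htz.
Qed.

(** * Semiclassical location of the zeros *)

Lemma ph_estimate T tau eta : 0 < T -> 0 < eta -> exists nu0, forall nu W A A' B B' psi,
  phased nu W A A' B B' psi -> nu0 < nu ->
  Rabs (psi (tau + T) - psi tau - nu * (action (tau + T) - action tau)) <= eta * nu.
Proof.
  intros HT He. assert (HPI := PI_RGT_0).
  assert (HF := freq_nonneg 1 (tau + T) ltac:(lra)). set (F := freq 1 (tau + T)) in *.
  (* [N] is fixed before [nu]: the mesh [T / N] makes the variation of the frequency cost at most
     [eta / 2 * nu], and then a large [nu] makes [N * PI] at most [eta / 2 * nu]. *)
  destruct (INR_unbounded (2 * T * F / eta)) as [N0 HN0].
  set (N := S N0). assert (HN : 0 < INR N) by (apply lt_0_INR; unfold N; lia).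
  assert (HNF : 2 * T * F <= eta * INR N).
  { assert (INR N0 <= INR N) by (unfold N; rewrite S_INR; lra).
    apply Rmult_le_reg_r with (/ eta); [now apply Rinv_0_lt_compat|].
    replace (eta * INR N * / eta) with (INR N) by (field; lra). unfold Rdiv in HN0. lra. }
  exists (2 * INR N * PI / eta). intros nu W A A' B B' psi H Hnu.
  assert (Hnu0 := ph_nu _ _ _ _ _ _ _ H).
  assert (H1 : 2 * INR N * PI < eta * nu).
  { apply Rmult_lt_reg_r with (/ eta); [now apply Rinv_0_lt_compat|].
    replace (eta * nu * / eta) with nu by (field; lra). exact Hnu. }
  pose proof (ph_partition _ _ _ _ _ _ _ H N tau (T / INR N)) as HP.
  assert (HTN : 0 <= T / INR N) by (left; now apply Rdiv_lt_0_compat).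
  specialize (HP HTN). replace (INR N * (T / INR N)) with T in HP by (field; lra).
  apply Rle_trans with (1 := HP).
  assert (Ef : freq nu (tau + T) = nu * F) by (unfold F, freq; ring).
  pose proof (freq_nonneg nu tau ltac:(lra)).
  assert (H2 : T / INR N * F <= eta / 2).
  { apply Rmult_le_reg_r with (2 * INR N); [lra|].
    replace (T / INR N * F * (2 * INR N)) with (2 * T * F) by (field; lra). lra. }
  rewrite Ef. nra.
Qed.

(** A shift to the right gains more over the right end of the window than it loses over the left
    end. Strictness comes from [- T < s]: the right end lies beyond the turning point, where the
    frequency is positive. *)
Lemma action_increment_lt T s t : 0 < T -> - T < s -> s < t < s + T ->
  action (s + T) - action s < action (t + T) - action t.
Proof.
  intros HT Hs Hst.
  pose proof (action_piece (s + T) (t + T) ltac:(lra)) as [H1 _].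
  pose proof (action_piece s t ltac:(lra)) as [_ H2].
  assert (H3 : freq 1 t < freq 1 (s + T)).
  { pose proof (exp_ineq1 (2 * (s + T)) ltac:(lra)).
    destruct (Rle_dec t 0) as [Ht|Ht].
    - rewrite freq_le0 by easy. unfold freq. rewrite Rmult_1_l. apply sqrt_lt_R0. lra.
    - unfold freq. rewrite !Rmult_1_l. apply sqrt_lt_1_alt.
      pose proof (exp_increasing (2 * t) (2 * (s + T)) ltac:(lra)).
      pose proof (exp2_ge1 t ltac:(lra)). lra. }
  replace (t + T - (s + T)) with (t - s) in H1 by ring. nra.
Qed.

(** At [tau0 - d] and [tau0 + d] the phase increment lies on opposite sides of the level, with a
    margin proportional to [nu] that the estimation error cannot close. Upward crossing then traps
    [t] between the two. *)
Lemma level_location T tau0 delta : 0 < T -> - T < tau0 -> 0 < delta ->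
  exists nu0 eta, 0 < eta /\ forall nu W A A' B B' psi k t,
  phased nu W A A' B B' psi -> nu0 < nu ->
  psi (t + T) - psi t = INR (S k) * PI ->
  Rabs (INR (S k) * PI / nu - (action (tau0 + T) - action tau0)) < eta ->
  Rabs (t - tau0) < delta.
Proof.
  intros HT Ht0 Hd. assert (HPI := PI_RGT_0).
  (* Keeps [tau0 - d] above [- T] and [d] below [T], as [action_increment_lt] requires. *)
  set (d := Rmin delta (Rmin T (tau0 + T) / 2)).
  assert (Hd0 : 0 < Rmin T (tau0 + T)) by (apply Rmin_glb_lt; lra).
  assert (Hr1 := Rmin_l T (tau0 + T)). assert (Hr2 := Rmin_r T (tau0 + T)).
  assert (Hd1 : 0 < d) by (apply Rmin_glb_lt; lra).
  assert (Hd2 : d <= delta) by apply Rmin_l.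
  assert (Hd3 : d <= Rmin T (tau0 + T) / 2) by apply Rmin_r.
  pose proof (action_increment_lt T (tau0 - d) tau0 HT ltac:(lra) ltac:(lra)) as Hm.
  pose proof (action_increment_lt T tau0 (tau0 + d) HT ltac:(lra) ltac:(lra)) as Hp.
  set (Pm := action (tau0 - d + T) - action (tau0 - d)) in *.
  set (P0 := action (tau0 + T) - action tau0) in *.
  set (Pp := action (tau0 + d + T) - action (tau0 + d)) in *.
  (* One third for the phase estimate, one for the distance of [INR (S k) * PI / nu] from its limit,
     one for strictness. *)
  set (eta := Rmin (P0 - Pm) (Pp - P0) / 3).
  assert (He1 : 3 * eta <= P0 - Pm) by (unfold eta; pose proof (Rmin_l (P0 - Pm) (Pp - P0)); lra).
  assert (He2 : 3 * eta <= Pp - P0) by (unfold eta; pose proof (Rmin_r (P0 - Pm) (Pp - P0)); lra).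
  assert (He0 : 0 < eta).
  { unfold eta. assert (0 < Rmin (P0 - Pm) (Pp - P0)) by (apply Rmin_glb_lt; lra). lra. }
  destruct (ph_estimate T (tau0 - d) eta HT He0) as [nu1 H1].
  destruct (ph_estimate T (tau0 + d) eta HT He0) as [nu2 H2].
  exists (Rmax nu1 nu2), eta. split; [exact He0|].
  intros nu W A A' B B' psi k t H Hnu Hk Hlim.
  pose proof (Rmax_l nu1 nu2). pose proof (Rmax_r nu1 nu2).
  specialize (H1 _ _ _ _ _ _ _ H ltac:(lra)). specialize (H2 _ _ _ _ _ _ _ H ltac:(lra)).
  fold Pm in H1. fold Pp in H2. assert (Hnu0 := ph_nu _ _ _ _ _ _ _ H).
  apply Rabs_le_between in H1. apply Rabs_le_between in H2. apply Rabs_lt_between in Hlim.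
  set (x := INR (S k) * PI / nu) in *.
  assert (Ex : INR (S k) * PI = nu * x) by (unfold x; field; lra).
  assert (Hlo : psi (tau0 - d + T) - psi (tau0 - d) < INR (S k) * PI) by (rewrite Ex; nra).
  assert (Hhi : INR (S k) * PI < psi (tau0 + d + T) - psi (tau0 + d)) by (rewrite Ex; nra).
  assert (tau0 - d < t).
  { apply Rnot_le_lt. intros [Hlt|E]; [|rewrite E in Hk; lra].
    pose proof (ph_level_exceeds _ _ _ _ _ _ _ _ H HT k t (tau0 - d) Hlt ltac:(lra)). lra. }
  assert (t < tau0 + d).
  { apply Rnot_le_lt. intros [Hlt|E]; [|rewrite <- E in Hk; lra].
    pose proof (ph_level_exceeds _ _ _ _ _ _ _ _ H HT k (tau0 + d) t Hlt ltac:(lra)). lra. }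
  apply Rabs_def1; lra.
Qed.

(** * Localisation at the turning point *)

(** [v * v'] vanishes at [tau] and has derivative [v' ^ 2 + nu ^ 2 * (1 - exp (2 * u)) * v ^ 2 >=
    0], so [v ^ 2] increases. From [t] to [t + h] this derivative is at least
    [nu ^ 2 * kap * v t ^ 2]; two integrations give the factor [h ^ 2]. The margin [t <= - 2 * h]
    keeps the stretch where [1 - exp (2 * u) >= kap]. *)
Lemma sol_left_growth nu v v' tau t h : sol nu v v' -> v tau = 0 -> tau <= t -> 0 < h ->
  t <= - 2 * h ->
  (1 + nu ^ 2 * (1 - exp (- 2 * h)) * h ^ 2) * v t ^ 2 <= v (t + h) ^ 2.
Proof.
  intros [Hv Hv'] H0 Ht Hh Hth.
  set (kap := 1 - exp (- 2 * h)).
  assert (Hkap : 0 < kap).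
  { unfold kap. pose proof (exp_increasing (- 2 * h) 0 ltac:(lra)) as He. rewrite exp_0 in He. lra. }
  assert (Hn := pow2_ge_0 nu).
  assert (Hq : forall u, u <= - h -> kap <= 1 - exp (2 * u)).
  { intros u Hu. unfold kap. pose proof (exp_le (2 * u) (- 2 * h) ltac:(lra)). lra. }
  assert (Hd : forall u, is_derive (fun u => v u * v' u) u
     (v' u ^ 2 + nu ^ 2 * (1 - exp (2 * u)) * v u ^ 2)).
  { intros u. auto_derive; [repeat split; eexists; eauto|].
    derive_with (Hv u). derive_with (Hv' u). ring. }
  assert (Hz : forall u, is_derive (fun u => v u ^ 2) u (2 * (v u * v' u))).
  { intros u. auto_derive; [repeat split; eexists; eauto|]. derive_with (Hv u). ring. }
  assert (Hvv : forall u, tau <= u <= - h -> 0 <= v u * v' u).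
  { intros u Hu. replace 0 with (v tau * v' tau) by (rewrite H0; ring).
    apply (deriv_nonneg_le (fun u => v u * v' u) _ tau u ltac:(lra) (fun x _ => Hd x)).
    intros x Hx. specialize (Hq x ltac:(lra)). pose proof (pow2_ge_0 (v' x)).
    pose proof (pow2_ge_0 (v x)).
    assert (0 <= nu ^ 2 * (1 - exp (2 * x))) by (apply Rmult_le_pos; lra). nra. }
  assert (Hmon : forall u, t <= u <= - h -> v t ^ 2 <= v u ^ 2).
  { intros u Hu.
    apply (deriv_nonneg_le (fun u => v u ^ 2) _ t u ltac:(lra) (fun x _ => Hz x)).
    intros x Hx. specialize (Hvv x ltac:(lra)). lra. }
  set (b := nu ^ 2 * kap * v t ^ 2).
  assert (Hlin : forall u, t <= u <= t + h -> b * (u - t) <= v u * v' u).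
  { intros u Hu.
    assert (HL : v t * v' t - b * (t - t) <= v u * v' u - b * (u - t)).
    { apply (deriv_nonneg_le (fun u => v u * v' u - b * (u - t))
        (fun u => (v' u ^ 2 + nu ^ 2 * (1 - exp (2 * u)) * v u ^ 2) - b)); [lra| |].
      - intros x _. auto_derive; [repeat split; eexists; eauto|].
        derive_with (Hv x). derive_with (Hv' x). ring.
      - intros x Hx. specialize (Hq x ltac:(lra)). specialize (Hmon x ltac:(lra)).
        pose proof (pow2_ge_0 (v' x)). pose proof (pow2_ge_0 (v t)).
        assert (nu ^ 2 * kap * v t ^ 2 <= nu ^ 2 * (1 - exp (2 * x)) * v x ^ 2).
        { apply Rmult_le_compat; [apply Rmult_le_pos; lra|easy| |easy].
          apply Rmult_le_compat_l; lra. }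
        unfold b. lra. }
    specialize (Hvv t ltac:(lra)). lra. }
  assert (HQ : v t ^ 2 - b * (t - t) ^ 2 <= v (t + h) ^ 2 - b * (t + h - t) ^ 2).
  { apply (deriv_nonneg_le (fun u => v u ^ 2 - b * (u - t) ^ 2)
      (fun u => 2 * (v u * v' u) - 2 * b * (u - t))); [lra| |].
    - intros x _. auto_derive; [repeat split; eexists; eauto|]. derive_with (Hv x). ring.
    - intros x Hx. specialize (Hlin x ltac:(lra)). lra. }
  replace (t + h - t) with h in HQ by ring. rewrite Rminus_diag in HQ. unfold b in HQ. lra.
Qed.

Lemma sol_zero_exists nu v v' m s t : sol nu v v' -> 0 < m -> s < t ->
  (forall u, s <= u <= t -> m ^ 2 <= nu ^ 2 * (exp (2 * u) - 1)) -> PI < m * (t - s) ->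
  exists u, s <= u <= t /\ v u = 0.
Proof.
  intros Hsol Hm Hst HQ Hlt. apply NNPP. intros Hn.
  assert (Hnz : forall u, s <= u <= t -> v u <> 0) by (intros u Hu E; apply Hn; now exists u).
  assert (Hc : forall w w', sol nu w w' -> (forall u, s <= u <= t -> w u <> 0) -> ~ 0 < w s).
  { intros w w' Hw Hw0 Hp.
    assert (Hpos : forall u, s <= u <= t -> 0 < w u).
    { intros u Hu. apply Rnot_le_lt. intros Hle.
      destruct (first_zero w s u) as [c [Hc1 [Hc2 _]]]; try easy; try lra.
      - intros x _. eapply is_derive_continuity_pt, (proj1 Hw).
      - apply (Hw0 c); [lra|easy]. }
    pose proof (sturm_upper nu w w' m s t Hw Hm Hst HQ ltac:(lra)
      (fun u Hu => Hpos u ltac:(lra))). lra. }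
  pose proof (Hc v v' Hsol Hnz) as H1.
  assert (Hsol' : sol nu (fun u => - v u) (fun u => - v' u)).
  { eapply sol_ext; [| |apply (sol_comb nu v v' v v' (-1) 0 Hsol Hsol)]; intros; simpl; ring. }
  pose proof (Hc _ _ Hsol' (fun u Hu E => Hnz u Hu ltac:(lra))) as H2.
  pose proof (Hnz s ltac:(lra)). lra.
Qed.

Lemma sol_critical_point nu v v' d : sol nu v v' -> 0 < d -> 0 < nu ->
  3 * PI < freq nu d * d -> exists s, d <= s <= 2 * d /\ v' s = 0.
Proof.
  intros Hsol Hd Hnu Hf. assert (HPI := PI_RGT_0).
  assert (Hf0 : 0 < freq nu d) by nra.
  assert (HQ : forall u, d <= u -> freq nu d ^ 2 <= nu ^ 2 * (exp (2 * u) - 1)).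
  { intros u Hu. rewrite freq_sq by lra. pose proof (exp_le (2 * d) (2 * u) ltac:(lra)).
    apply Rmult_le_compat_l; [apply pow2_ge_0|lra]. }
  (* Two disjoint stretches of length [2 * d / 5], each longer than a half-turn since
     [3 * (2 / 5) > 1], contain one zero each; the mean value theorem between them gives the
     critical point. *)
  destruct (sol_zero_exists nu v v' (freq nu d) d (d + d * (2 / 5)) Hsol Hf0) as [u1 [Hu1 E1]].
  { lra. } { intros; apply HQ; lra. } { nra. }
  destruct (sol_zero_exists nu v v' (freq nu d) (d + d * (3 / 5)) (2 * d) Hsol Hf0) as [u2 [Hu2 E2]].
  { lra. } { intros; apply HQ; lra. } { nra. }
  destruct (MVT_interior v v' u1 u2) as [c [Hc E]].
  - lra.
  - intros x _. apply (proj1 Hsol).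
  - intros x _. eapply is_derive_continuity_pt, (proj1 Hsol).
  - exists c. split; [lra|]. rewrite E1, E2 in E. nra.
Qed.

Lemma amgm_div (a x y : R) : 0 < a -> 2 * Rabs (x * y) <= x ^ 2 / a + a * y ^ 2.
Proof.
  intros Ha.
  assert (H1 : 0 <= (x - a * y) ^ 2 / a)
    by (apply Rmult_le_pos; [apply pow2_ge_0|left; now apply Rinv_0_lt_compat]).
  assert (H2 : 0 <= (x + a * y) ^ 2 / a)
    by (apply Rmult_le_pos; [apply pow2_ge_0|left; now apply Rinv_0_lt_compat]).
  replace ((x - a * y) ^ 2 / a) with (x ^ 2 / a + a * y ^ 2 - 2 * (x * y)) in H1 by (field; lra).
  replace ((x + a * y) ^ 2 / a) with (x ^ 2 / a + a * y ^ 2 + 2 * (x * y)) in H2 by (field; lra).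
  split_Rabs; lra.
Qed.

(* With [S = nu * sg] and [I = v'^2 / S + S v^2] the adiabatic invariant, the correction
   [c v v'], [c = e^(2t) / (nu sg^3)], removes the oscillating part of [I']. *)
Lemma sol_right_bound d L : 0 < d -> exists C, 0 < C /\ forall nu v v' s t,
  sol nu v v' -> C < nu -> d <= s -> s <= t -> t <= L -> v' s = 0 ->
  sqrt (exp (2 * t) - 1) * v t ^ 2 <= 2 * exp L * (sqrt (exp (2 * s) - 1) * v s ^ 2).
Proof.
  intros Hd. set (sg := fun u => sqrt (exp (2 * u) - 1)).
  assert (Hsg : forall u, d <= u -> 0 < sg d <= sg u).
  { intros u Hu. unfold sg. split.
    - apply sqrt_lt_R0. pose proof (exp_ineq1 (2 * d) ltac:(lra)). lra.
    - apply sqrt_le_1_alt. pose proof (exp_le (2 * d) (2 * u) ltac:(lra)). lra. }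
  assert (Hsd : 0 < sg d) by (apply (Hsg d); lra).
  assert (Hi : 0 < / sg d) by now apply Rinv_0_lt_compat.
  set (E := exp (2 * L)). assert (HE : 0 < E) by apply exp_pos.
  (* For [d <= u <= L], [C / nu] bounds the coefficients of [v' * v] in the correction of [J] and in
     [dJ]. With [nu > C] both terms are at most [I / 2], by the arithmetic-geometric inequality
     [HI]. *)
  set (C := 2 * E * (/ sg d) ^ 3 + 3 * E ^ 2 * (/ sg d) ^ 5).
  assert (Hi3 : 0 < (/ sg d) ^ 3) by now apply pow_lt.
  assert (Hi5 : 0 < (/ sg d) ^ 5) by now apply pow_lt.
  assert (HE2 : 0 < E ^ 2) by now apply pow_lt.
  assert (HC : 0 < C) by (unfold C; nra).
  exists C. split; [exact HC|].
  intros nu v v' s t [Hv Hv'] Hnu Hs Hst HtL Hcrit.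
  assert (Hnu0 : 0 < nu) by lra.
  set (I := fun u => v' u ^ 2 / (nu * sg u) + nu * sg u * v u ^ 2).
  set (J := fun u => I u + exp (2 * u) / (nu * sg u ^ 3) * (v' u * v u)).
  set (dJ := fun u => (2 * exp (2 * u) * (/ sg u) ^ 3 - 3 * exp (2 * u) ^ 2 * (/ sg u) ^ 5) / nu
     * (v' u * v u)).
  assert (Hinv : forall u, d <= u -> 0 < / sg u <= / sg d).
  { intros u Hu. specialize (Hsg u Hu). split; [apply Rinv_0_lt_compat; lra|].
    apply Rinv_le_contravar; lra. }
  assert (HJ : forall u, d <= u -> is_derive J u (dJ u)).
  { intros u Hu. pose proof (Hsg u Hu) as [_ Hsu].
    assert (Hsu0 : 0 < sg u) by lra. clear Hsu.
    assert (Hs2 : sg u ^ 2 = exp (2 * u) - 1).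
    { unfold sg. apply pow2_sqrt. apply exp2_ge1. lra. }
    pose proof (exp_ineq1 (2 * u) ltac:(lra)) as He.
    unfold J, I, dJ, sg in *. auto_derive.
    - unfold Rminus in *. set (S := sqrt (exp (2 * u) + - (1))) in *.
      repeat split; try (eexists; eauto; fail); try lra;
        repeat (apply Rmult_integral_contrapositive_currified); lra.
    - derive_with (Hv u). derive_with (Hv' u).
      unfold Rminus in *. set (S := sqrt (exp (2 * u) + - (1))) in *.
      replace (exp (2 * u)) with (S ^ 2 + 1) by lra. field. lra. }
  assert (HI : forall u, d <= u -> 2 * Rabs (v' u * v u) <= I u).
  { intros u Hu. apply amgm_div. pose proof (Hsg u Hu). apply Rmult_lt_0_compat; lra. }
  assert (HnuC : C / nu <= 1).
  { apply Rmult_le_reg_r with nu; [easy|]. unfold Rdiv.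
    rewrite Rmult_assoc, Rinv_l by lra. lra. }
  assert (Hexp : forall u, u <= L -> 0 < exp (2 * u) <= E).
  { intros u Hu. split; [apply exp_pos|]. apply exp_le. lra. }
  assert (Hbnd : forall u, d <= u <= L -> 0 <= exp (2 * u) * (/ sg u) ^ 3 <= E * (/ sg d) ^ 3 /\
     0 <= exp (2 * u) ^ 2 * (/ sg u) ^ 5 <= E ^ 2 * (/ sg d) ^ 5).
  { intros u Hu. pose proof (Hinv u ltac:(lra)) as [G1 G2]. pose proof (Hexp u ltac:(lra)) as [G3 G4].
    assert (0 < (/ sg u) ^ 3) by now apply pow_lt. assert (0 < (/ sg u) ^ 5) by now apply pow_lt.
    assert (0 < exp (2 * u) ^ 2) by now apply pow_lt.
    split; split; try (apply Rmult_le_pos; lra);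
      apply Rmult_le_compat; try lra; apply pow_incr; lra. }
  assert (Hsmall : forall x u, d <= u -> Rabs x <= C -> Rabs (x / nu * (v' u * v u)) <= I u / 2).
  { intros x u Hu Hx. rewrite Rabs_mult. specialize (HI u Hu).
    assert (Rabs (x / nu) <= 1).
    { unfold Rdiv. rewrite Rabs_mult, (Rabs_pos_eq (/ nu)) by (left; now apply Rinv_0_lt_compat).
      apply Rle_trans with (C / nu); [|easy]. apply Rmult_le_compat_r; [|easy].
      left; now apply Rinv_0_lt_compat. }
    pose proof (Rabs_pos (v' u * v u)). pose proof (Rabs_pos (x / nu)). nra. }
  assert (HJI : forall u, d <= u <= L -> I u / 2 <= J u).
  { intros u Hu. pose proof (Hbnd u Hu) as [B1 B2]. pose proof (Hinv u ltac:(lra)).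
    pose proof (Hsmall (exp (2 * u) * (/ sg u) ^ 3) u ltac:(lra)) as G.
    assert (0 < E * (/ sg d) ^ 3) by nra. assert (0 < E ^ 2 * (/ sg d) ^ 5) by nra.
    specialize (G ltac:(rewrite Rabs_pos_eq by lra; unfold C; lra)).
    apply Rabs_le_between in G. unfold J. pose proof (Hsg u ltac:(lra)).
    replace (exp (2 * u) / (nu * sg u ^ 3)) with (exp (2 * u) * (/ sg u) ^ 3 / nu)
      by (field; lra). lra. }
  assert (HdJ : forall u, d <= u <= L -> dJ u <= J u).
  { intros u Hu. pose proof (Hbnd u Hu) as [B1 B2]. specialize (HJI u Hu).
    pose proof (Hsmall (2 * exp (2 * u) * (/ sg u) ^ 3 - 3 * exp (2 * u) ^ 2 * (/ sg u) ^ 5) u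
      ltac:(lra)) as G.
    specialize (G ltac:(apply Rabs_le; unfold C; split; lra)).
    apply Rabs_le_between in G. unfold dJ. lra. }
  (* By [dJ <= J] the product [exp (- u) * J u] does not increase. This is the source of the factor
     [exp L]; the factor 2 comes from [I / 2 <= J]. *)
  assert (Hmon : - (exp (- s) * J s) <= - (exp (- t) * J t)).
  { apply (deriv_nonneg_le (fun u => - (exp (- u) * J u)) (fun u => exp (- u) * (J u - dJ u)));
      [easy| |].
    - intros u Hu. pose proof (HJ u ltac:(lra)) as HJu. clearbody J dJ. auto_derive.
      + repeat split; eexists; eauto.
      + derive_with HJu. ring.
    - intros u Hu. specialize (HdJ u ltac:(lra)). pose proof (exp_pos (- u)).
      apply Rmult_le_pos; lra. }
  assert (HJs : J s = nu * (sg s * v s ^ 2)).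
  { unfold J, I. rewrite Hcrit. pose proof (Hsg s Hs). field. split; lra. }
  assert (HIt : nu * (sg t * v t ^ 2) <= I t).
  { unfold I. pose proof (Hsg t ltac:(lra)).
    assert (0 < / (nu * sg t)) by (apply Rinv_0_lt_compat, Rmult_lt_0_compat; lra).
    pose proof (pow2_ge_0 (v' t)). unfold Rdiv.
    assert (0 <= v' t ^ 2 * / (nu * sg t)) by (apply Rmult_le_pos; lra). lra. }
  specialize (HJI t ltac:(lra)).
  assert (HJt : J t <= exp L * J s).
  { assert (E1 : exp t * exp (- t) = 1) by (rewrite <- exp_plus, Rplus_opp_r; apply exp_0).
    assert (E2 : J t <= exp t * exp (- s) * J s).
    { replace (J t) with (exp t * (exp (- t) * J t)) by (rewrite <- Rmult_assoc, E1; ring).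
      rewrite Rmult_assoc. apply Rmult_le_compat_l; [left; apply exp_pos|lra]. }
    apply Rle_trans with (1 := E2). apply Rmult_le_compat_r.
    - rewrite HJs. pose proof (Hsg s Hs). pose proof (pow2_ge_0 (v s)).
      apply Rmult_le_pos; [lra|]. apply Rmult_le_pos; lra.
    - rewrite <- exp_plus. apply exp_le. lra. }
  rewrite HJs in HJt.
  apply Rmult_le_reg_l with nu; [easy|]. fold (sg t) (sg s). lra.
Qed.

Lemma sqrt_ratio_small (k : R) : 0 < k -> exists d, 0 < d /\ sqrt (exp (2 * (2 * d)) - 1) <= k.
Proof.
  intros Hk. exists (ln (1 + k ^ 2) / 4).
  assert (0 < k ^ 2) by now apply pow_lt. split.
  - assert (0 < ln (1 + k ^ 2)); [|lra]. rewrite <- ln_1. apply ln_increasing; lra.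
  - replace (2 * (2 * (ln (1 + k ^ 2) / 4))) with (ln (1 + k ^ 2)) by field.
    rewrite exp_ln by lra. replace (1 + k ^ 2 - 1) with (k ^ 2) by ring.
    rewrite sqrt_pow2; lra.
Qed.

(** The larger value is found between [t] and the turning point: at [t + h] on the left, at a
    critical point on the right. The threshold depends on [T], [delta] and [eta] only, so [tau] may
    vary with [nu]. *)
Lemma sol_localised T delta eta : 0 < T -> 0 < delta -> 0 < eta ->
  exists nu0, forall nu v v' tau t, sol nu v v' -> nu0 < nu -> v tau = 0 -> - T < tau < 0 ->
  tau < t < tau + T -> delta <= Rabs t ->
  exists t0, tau < t0 < tau + T /\ Rabs (v t) <= eta * Rabs (v t0).
Proof.
  intros HT Hd He. assert (HPI := PI_RGT_0).
  assert (Hsq : forall x y, x ^ 2 <= eta ^ 2 * y ^ 2 -> Rabs x <= eta * Rabs y).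
  { intros x y H. rewrite <- (Rabs_pos_eq eta) by lra. rewrite <- Rabs_mult.
    apply Rsqr_le_abs_0. unfold Rsqr. lra. }
  assert (Hsd : 0 < sqrt (exp (2 * delta) - 1)).
  { apply sqrt_lt_R0. pose proof (exp_ineq1 (2 * delta) ltac:(lra)). lra. }
  set (sd := sqrt (exp (2 * delta) - 1)) in *.
  assert (HeT : 0 < exp T) by apply exp_pos.
  assert (He2 : 0 < eta ^ 2) by now apply pow_lt.
  (* Solves [2 * exp T * k = eta ^ 2 * sd], where [2 * exp T] is the constant of
     [sol_right_bound]. *)
  set (k := eta ^ 2 * sd / (2 * exp T)).
  assert (Hk : 0 < k) by (apply Rdiv_lt_0_compat; nra).
  destruct (sqrt_ratio_small k Hk) as [d0 [Hd0 Hd0']].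
  (* [2 * d <= delta] places the critical point before [t]; [d <= d0] makes the square root there at
     most [k]. *)
  set (d := Rmin d0 (delta / 2)).
  assert (Hdp : 0 < d) by (apply Rmin_glb_lt; lra).
  assert (Hdd0 : d <= d0) by apply Rmin_l. assert (Hdd : d <= delta / 2) by apply Rmin_r.
  destruct (sol_right_bound d T Hdp) as [C [HC HCb]].
  assert (Hf1 : 0 < freq 1 d).
  { unfold freq. rewrite Rmult_1_l. apply sqrt_lt_R0.
    pose proof (exp_ineq1 (2 * d) ltac:(lra)). lra. }
  set (h := delta / 2).
  set (kap := (1 - exp (- 2 * h)) * h ^ 2).
  assert (Hkap : 0 < kap).
  { unfold kap. apply Rmult_lt_0_compat; [|apply pow_lt; unfold h; lra].
    pose proof (exp_increasing (- 2 * h) 0 ltac:(unfold h; lra)) as Hx. rewrite exp_0 in Hx. lra. }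
  (* [n1] provides the critical point and [n2] makes [eta ^ 2 * (nu ^ 2 * kap) >= 1]; the summand 1
     in the threshold ensures [nu <= nu ^ 2]. *)
  set (n1 := 3 * PI / (freq 1 d * d)). set (n2 := / (eta ^ 2 * kap)).
  assert (Hek : 0 < eta ^ 2 * kap) by now apply Rmult_lt_0_compat.
  assert (Hfd : 0 < freq 1 d * d) by now apply Rmult_lt_0_compat.
  exists (1 + C + n1 + n2).
  assert (Hn1 : 0 < n1) by (apply Rdiv_lt_0_compat; lra).
  assert (Hn2 : 0 < n2) by now apply Rinv_0_lt_compat.
  intros nu v v' tau t Hsol Hnu Hv0 Htau Ht Hdel.
  destruct (Rle_dec t 0) as [Hneg|Hpos].
  - rewrite Rabs_left1 in Hdel by easy. exists (t + h). split; [unfold h; lra|]. apply Hsq.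
    pose proof (sol_left_growth nu v v' tau t h Hsol Hv0 ltac:(lra) ltac:(unfold h; lra)
      ltac:(unfold h; lra)) as HL.
    assert (G : 1 <= eta ^ 2 * (nu ^ 2 * kap)).
    { assert (n2 * (eta ^ 2 * kap) = 1) by (unfold n2; field; lra).
      assert (n2 <= nu ^ 2) by nra. nra. }
    unfold kap in G. pose proof (pow2_ge_0 (v t)).
    apply Rle_trans with (eta ^ 2 * ((1 + nu ^ 2 * (1 - exp (-2 * h)) * h ^ 2) * v t ^ 2)).
    + nra.
    + apply Rmult_le_compat_l; lra.
  - rewrite Rabs_pos_eq in Hdel by lra.
    destruct (sol_critical_point nu v v' d Hsol Hdp ltac:(lra)) as [s [Hs Hs']].
    { assert (Ef : freq nu d = nu * freq 1 d) by (unfold freq; ring). rewrite Ef.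
      assert (n1 * (freq 1 d * d) = 3 * PI) by (unfold n1; field; split; lra). nra. }
    assert (Hst : s <= t) by lra.
    exists s. split; [lra|]. apply Hsq.
    pose proof (HCb nu v v' s t Hsol ltac:(lra) ltac:(lra) Hst ltac:(lra) Hs') as HR.
    assert (G1 : sd <= sqrt (exp (2 * t) - 1)).
    { apply sqrt_le_1_alt. pose proof (exp_le (2 * delta) (2 * t) ltac:(lra)). lra. }
    assert (G2 : sqrt (exp (2 * s) - 1) <= k).
    { apply Rle_trans with (2 := Hd0'). apply sqrt_le_1_alt.
      pose proof (exp_le (2 * s) (2 * (2 * d0)) ltac:(lra)). lra. }
    pose proof (pow2_ge_0 (v t)). pose proof (pow2_ge_0 (v s)).
    apply Rmult_le_reg_l with sd; [easy|].
    apply Rle_trans with (sqrt (exp (2 * t) - 1) * v t ^ 2); [apply Rmult_le_compat_r; lra|].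
    apply Rle_trans with (1 := HR).
    apply Rle_trans with (2 * exp T * (k * v s ^ 2)).
    + apply Rmult_le_compat_l; [lra|]. apply Rmult_le_compat_r; lra.
    + right. unfold k. field. lra.
Qed.

(** * First integral of the equation for [g_R] *)

Lemma exp_2ln x : 0 < x -> exp (2 * ln x) = x ^ 2.
Proof.
  intros Hx. replace (2 * ln x) with (ln x + ln x) by ring. rewrite exp_plus, exp_ln by easy. ring.
Qed.

Lemma sqrt_one_minus_sq w x : 0 < w -> 0 < x ->
  sqrt (1 - (w / x) ^ 2) = w / x * sqrt ((x / w) ^ 2 - 1).
Proof.
  intros Hw Hx. assert (Hq : 0 < w / x) by now apply Rdiv_lt_0_compat.
  rewrite <- (sqrt_pow2 (w / x)) at 2 by lra.
  rewrite <- sqrt_mult_alt by apply pow2_ge_0. f_equal. field. lra.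
Qed.

(** Also true for [x <= w], where [acos] and [sqrt] both return 0. *)
Lemma acos_eq_atan w x : 0 < w -> 0 < x -> acos (w / x) = atan (sqrt ((x / w) ^ 2 - 1)).
Proof.
  intros Hw Hx. assert (Hq : 0 < w / x) by now apply Rdiv_lt_0_compat.
  rewrite acos_atan by easy. f_equal.
  replace ((w / x)²) with ((w / x) ^ 2) by (unfold Rsqr; ring).
  rewrite sqrt_one_minus_sq by easy. field. lra.
Qed.

(** [S1] and [SR] are the square roots of the action at the two ends of the window. The indicator
    disappears because [S1] is already 0 wherever it vanishes. *)
Lemma gR_rhs_eq Rr w y : 1 < Rr -> 0 < w -> 0 < y -> w < Rr * y ->
  let S1 := sqrt (exp (2 * ln (y / w)) - 1) in
  let SR := sqrt (exp (2 * (ln (y / w) + ln Rr)) - 1) in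
  S1 < SR /\ gR_rhs Rr w y = (atan SR - atan S1) / (w / y * (SR - S1)).
Proof.
  intros HR Hw Hy HRy S1 SR.
  assert (Hyw : 0 < y / w) by now apply Rdiv_lt_0_compat.
  assert (HRyp : 0 < Rr * y) by nra.
  assert (ES1 : S1 = sqrt ((y / w) ^ 2 - 1)) by (unfold S1; rewrite exp_2ln; easy).
  assert (ESR : SR = sqrt ((Rr * y / w) ^ 2 - 1)).
  { unfold SR. rewrite <- ln_mult by lra. rewrite exp_2ln by nra. f_equal. field. lra. }
  assert (H1 : 1 < Rr * y / w).
  { apply Rmult_lt_reg_r with w; [easy|]. unfold Rdiv. rewrite Rmult_assoc, Rinv_l by lra. lra. }
  assert (H2 : y / w < Rr * y / w).
  { unfold Rdiv. apply Rmult_lt_compat_r; [now apply Rinv_0_lt_compat|nra]. }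
  assert (HS : S1 < SR).
  { rewrite ES1, ESR. destruct (Rle_dec 1 (y / w)) as [Hle|Hle].
    - apply sqrt_lt_1_alt. nra.
    - rewrite (sqrt_neg_0 ((y / w) ^ 2 - 1)) by nra. apply sqrt_lt_R0. nra. }
  split; [exact HS|]. unfold gR_rhs.
  rewrite (acos_eq_atan w (Rr * y)), (sqrt_one_minus_sq w (Rr * y)) by easy.
  rewrite (acos_eq_atan w y), (sqrt_one_minus_sq w y) by easy.
  rewrite <- ES1, <- ESR.
  assert (Hind : atan S1 * ind_le w y = atan S1 /\ w / y * S1 * ind_le w y = w / y * S1).
  { unfold ind_le. destruct (Rle_dec (Rabs w) (Rabs y)) as [Hle|Hle]; [split; ring|].
    rewrite !Rabs_pos_eq in Hle by lra.
    assert (E : S1 = 0).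
    { rewrite ES1. apply sqrt_neg_0.
      assert (y / w < 1); [|nra].
      apply Rmult_lt_reg_r with w; [easy|]. unfold Rdiv. rewrite Rmult_assoc, Rinv_l by lra. lra. }
    rewrite E, atan_0. split; ring. }
  destruct Hind as [-> ->]. f_equal. field. lra.
Qed.

(** For [t >= 0] the action is [exp t] up to a bounded amount: the square root costs at most 1 and
    the arctangent less than 2, whence [3 * w]. This controls [Theta] as [w] tends to 0. *)
Lemma action_ln_bounds x w : 0 < w -> w <= x -> x - 3 * w <= w * action (ln (x / w)) <= x.
Proof.
  intros Hw Hx. unfold action.
  assert (H1 : 1 <= x / w).
  { apply Rmult_le_reg_r with w; [easy|]. unfold Rdiv. rewrite Rmult_assoc, Rinv_l by lra. lra. }
  rewrite exp_2ln by lra.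
  set (S := sqrt ((x / w) ^ 2 - 1)).
  assert (HS0 : 0 <= S) by apply sqrt_pos.
  assert (HS2 : S ^ 2 = (x / w) ^ 2 - 1) by (apply pow2_sqrt; nra).
  assert (HSu : S <= x / w) by nra. assert (HSl : x / w - 1 <= S) by nra.
  assert (Ha : 0 <= atan S < 2).
  { pose proof (atan_bound S). pose proof PI_4. split; [|lra].
    destruct HS0 as [HS0|<-]; [|rewrite atan_0; lra].
    rewrite <- atan_0. left. now apply atan_increasing. }
  assert (Ex : w * (x / w) = x) by (field; lra).
  split.
  - replace (x - 3 * w) with (w * (x / w - 3)) by (rewrite Rmult_minus_distr_l, Ex; ring).
    apply Rmult_le_compat_l; lra.
  - rewrite <- Ex. apply Rmult_le_compat_l; lra.
Qed.

Lemma action_increment_le T s t : 0 < T -> s <= t ->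
  action (s + T) - action s <= action (t + T) - action t.
Proof.
  intros HT Hst.
  destruct (Rle_dec t (s + T)) as [Hle|Hle].
  - pose proof (action_piece (s + T) (t + T) ltac:(lra)) as [H1 _].
    pose proof (action_piece s t ltac:(lra)) as [_ H2].
    pose proof (freq_mono 1 t (s + T) ltac:(lra) ltac:(lra)).
    replace (t + T - (s + T)) with (t - s) in H1 by ring. nra.
  - pose proof (action_piece s (s + T) ltac:(lra)) as [_ H1].
    pose proof (action_piece t (t + T) ltac:(lra)) as [H2 _].
    pose proof (freq_mono 1 (s + T) t ltac:(lra) ltac:(lra)).
    replace (s + T - s) with T in H1 by ring. replace (t + T - t) with T in H2 by ring. nra.
Qed.

Lemma action_le0 t : t <= 0 -> action t = 0.
Proof.
  intros Ht. unfold action. pose proof (freq_le0 1 t Ht) as E. unfold freq in E.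
  rewrite Rmult_1_l in E. rewrite E, atan_0. ring.
Qed.

(** With [nu / k] close to [w] and the phase increment close to [nu] times the action increment, the
    condition for the k-th zero becomes [Theta = PI]. *)
Definition Theta (Rr : R) (g : R -> R) (w : R) : R :=
  w * (action (ln (g w / w) + ln Rr) - action (ln (g w / w))).

Lemma Theta_continuity Rr g w : continuity_pt g w -> 0 < w -> 0 < g w ->
  continuity_pt (Theta Rr g) w.
Proof.
  intros Hg Hw Hgw.
  assert (Hl : continuity_pt (fun w => ln (g w / w)) w).
  { apply (continuity_pt_comp (fun w => g w / w) ln).
    - apply continuity_pt_div; [easy|apply derivable_continuous_pt, derivable_pt_id|lra].
    - apply ex_derive_continuity_pt. auto_derive. now apply Rdiv_lt_0_compat. }
  apply continuity_pt_mult; [apply derivable_continuous_pt, derivable_pt_id|].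
  apply continuity_pt_minus.
  - apply (continuity_pt_comp (fun w => ln (g w / w) + ln Rr) action); [|apply action_continuity].
    apply continuity_pt_plus; [easy|]. apply continuity_pt_const. now intros ? ?.
  - apply (continuity_pt_comp (fun w => ln (g w / w)) action); [easy|apply action_continuity].
Qed.

(** The derivative is [(SR - S1) - (atan SR - atan S1) + w * (g' / g - / w) * (SR - S1)]; the terms
    [SR - S1] cancel and the equation for [g] removes the rest. At [g w = w] the argument of
    [action] is 0, where [action_derive] is silent. *)
Lemma Theta_derive Rr g w : 1 < Rr -> derivable_pt_lim g w (gR_rhs Rr w (g w)) ->
  0 < w -> 0 < g w -> w < Rr * g w -> g w <> w -> is_derive (Theta Rr g) w 0.
Proof.
  intros HR Hg Hw Hgw HRg Hne. apply is_derive_Reals in Hg.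
  assert (Hq : 0 < g w / w) by now apply Rdiv_lt_0_compat.
  set (l := fun w => ln (g w / w)).
  destruct (gR_rhs_eq Rr w (g w) HR Hw Hgw HRg) as [HS HE].
  set (S1 := sqrt (exp (2 * ln (g w / w)) - 1)) in *.
  set (SR := sqrt (exp (2 * (ln (g w / w) + ln Rr)) - 1)) in *.
  assert (Hl : is_derive l w (gR_rhs Rr w (g w) / g w - / w)).
  { unfold l. set (dg := gR_rhs Rr w (g w)) in *. clearbody dg. auto_derive.
    - repeat split; [eexists; eauto|lra|exact Hq].
    - derive_with Hg. field. split; lra. }
  assert (Hn1 : l w <> 0).
  { intros E. apply Hne. unfold l in E. rewrite <- ln_1 in E. apply ln_inv in E; [|easy|lra].
    apply Rmult_eq_reg_r with (/ w); [|apply Rinv_neq_0_compat; lra]. rewrite Rinv_r by lra. exact E. }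
  assert (Hn2 : l w + ln Rr <> 0).
  { unfold l. rewrite <- ln_mult by lra. intros E. rewrite <- ln_1 in E.
    apply ln_inv in E; [|nra|lra].
    assert (E2 : g w * Rr = w).
    { apply Rmult_eq_reg_r with (/ w); [|apply Rinv_neq_0_compat; lra]. rewrite Rinv_r by lra.
      rewrite <- E. field. lra. }
    lra. }
  pose proof (action_derive _ Hn1) as D1. pose proof (action_derive _ Hn2) as D2.
  fold S1 in D1. fold SR in D2. unfold Theta. fold (l w) in S1, SR.
  change (is_derive (fun w => w * (action (l w + ln Rr) - action (l w))) w 0).
  set (dl := gR_rhs Rr w (g w) / g w - / w) in *.
  assert (C1 : is_derive (fun w => action (l w)) w (dl * S1)).
  { apply (is_derive_comp action l w S1 dl); [exact D1|exact Hl]. }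
  assert (C2 : is_derive (fun w => action (l w + ln Rr)) w (dl * SR)).
  { apply (is_derive_comp action (fun w => l w + ln Rr) w SR dl); [exact D2|].
    evar_last; [rapply @is_derive_plus; [exact Hl|apply (@is_derive_const R_AbsRing R_NormedModule)]|].
    apply Rplus_0_r. }
  assert (E1 : action (l w) = S1 - atan S1) by reflexivity.
  assert (E2 : action (l w + ln Rr) = SR - atan SR) by reflexivity.
  evar_last.
  { rapply (is_derive_mult (fun w : R => w) (fun w => action (l w + ln Rr) - action (l w)) w 1
      (dl * SR - dl * S1)).
    - apply (@is_derive_id R_AbsRing).
    - apply (@is_derive_minus R_AbsRing R_NormedModule); [exact C2|exact C1].
    - intros; apply Rmult_comm. }
  unfold plus, mult; simpl. rewrite E1, E2. unfold dl. rewrite HE. field. repeat split; lra.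
Qed.

Lemma gR_right_continuous Rr g : is_gR Rr g -> forall e, 0 < e ->
  exists d, 0 < d /\ forall h, 0 < h < d -> Rabs (g h - g 0) < e.
Proof.
  intros [_ [Hr _]] e He. destruct (Hr 1 Rlt_0_1) as [d [Hd H]].
  set (l := gR_rhs Rr 0 (g 0)) in *.
  assert (Hl : 0 < Rabs l + 1) by (pose proof (Rabs_pos l); lra).
  exists (Rmin d (e / (Rabs l + 1))). split; [apply Rmin_glb_lt; [easy|now apply Rdiv_lt_0_compat]|].
  intros h Hh. pose proof (Rmin_l d (e / (Rabs l + 1))). pose proof (Rmin_r d (e / (Rabs l + 1))).
  specialize (H h ltac:(lra)).
  assert (Hq : Rabs ((g h - g 0) / h) < Rabs l + 1) by (split_Rabs; lra).
  replace (g h - g 0) with ((g h - g 0) / h * h) by (field; lra).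
  rewrite Rabs_mult, (Rabs_pos_eq h) by lra.
  apply Rlt_le_trans with ((Rabs l + 1) * h); [apply Rmult_lt_compat_r; lra|].
  apply Rle_trans with ((Rabs l + 1) * (e / (Rabs l + 1))); [apply Rmult_le_compat_l; lra|].
  right. field. lra.
Qed.

Lemma gR_continuity Rr g w : is_gR Rr g -> 0 < w -> continuity_pt g w.
Proof.
  intros [_ [_ H]] Hw. eapply is_derive_continuity_pt, is_derive_Reals, H, Hw.
Qed.

Lemma Theta_const Rr g s a b : 1 < Rr -> is_gR Rr g ->
  (forall v, 0 < v -> g v = v -> v = s) -> 0 < a <= b -> 0 < g b ->
  (forall x, a <= x < b -> x < Rr * g x) -> Theta Rr g a = Theta Rr g b.
Proof.
  intros HR Hg Hu Hab Hgb HRg.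
  assert (Hpos : forall x, a <= x <= b -> 0 < g x).
  { intros x Hx. destruct (proj2 Hx) as [Hlt| ->]; [|easy].
    specialize (HRg x ltac:(lra)). nra. }
  assert (Hc : forall x, a <= x <= b -> continuity_pt (Theta Rr g) x).
  { intros x Hx. apply Theta_continuity; [eapply gR_continuity; [exact Hg|lra]|lra|now apply Hpos]. }
  assert (Hd : forall x, a < x < b -> x <> s -> is_derive (Theta Rr g) x 0).
  { intros x Hx Hxs. apply Theta_derive; auto; [apply Hg; lra|lra|apply Hpos; lra|apply HRg; lra|].
    intros E. apply Hxs, Hu; [lra|easy]. }
  (* At [s] no derivative is available; continuity joins the two halves. *)
  destruct (classic (a < s < b)) as [Hs|Hs].
  - transitivity (Theta Rr g s).
    + apply deriv_zero_const; [lra|intros; apply Hd; lra|intros; apply Hc; lra].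
    + apply deriv_zero_const; [lra|intros; apply Hd; lra|intros; apply Hc; lra].
  - apply deriv_zero_const; [lra|intros; apply Hd; lra|intros; apply Hc; lra].
Qed.

(** The initial value enters here: [Theta] at a small [h] is [(Rr - 1) * g h] up to [3 * h], and
    [(Rr - 1) * g 0 = PI]. *)
Lemma gR_start Rr g e : 1 < Rr -> is_gR Rr g -> 0 < e ->
  exists d, 0 < d /\ forall h, 0 < h < d -> h < g h /\ Rabs (Theta Rr g h - PI) < e.
Proof.
  intros HR Hg He. assert (HPI := PI_RGT_0).
  assert (Hg0 : g 0 = PI / (Rr - 1)) by apply Hg.
  assert (Hg0p : 0 < g 0) by (rewrite Hg0; apply Rdiv_lt_0_compat; lra).
  set (e1 := Rmin (g 0 / 2) (e / 2 / (Rr - 1))).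
  assert (He1 : 0 < e1).
  { apply Rmin_glb_lt; [lra|]. apply Rdiv_lt_0_compat; lra. }
  assert (Ha : e1 <= g 0 / 2) by apply Rmin_l.
  assert (Hb : (Rr - 1) * e1 <= e / 2).
  { apply Rle_trans with ((Rr - 1) * (e / 2 / (Rr - 1))).
    - apply Rmult_le_compat_l; [lra|apply Rmin_r].
    - right. field. lra. }
  destruct (gR_right_continuous Rr g Hg e1 He1) as [d [Hd H]].
  exists (Rmin d (Rmin (g 0 / 2) (e / 6))). split.
  { repeat apply Rmin_glb_lt; lra. }
  intros h Hh. pose proof (Rmin_l d (Rmin (g 0 / 2) (e / 6))).
  pose proof (Rmin_r d (Rmin (g 0 / 2) (e / 6))).
  pose proof (Rmin_l (g 0 / 2) (e / 6)). pose proof (Rmin_r (g 0 / 2) (e / 6)).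
  specialize (H h ltac:(lra)). apply Rabs_lt_between in H.
  assert (Hgh : h < g h) by lra. split; [easy|].
  pose proof (action_ln_bounds (g h) h ltac:(lra) ltac:(lra)) as B1.
  pose proof (action_ln_bounds (Rr * g h) h ltac:(lra) ltac:(nra)) as B2.
  assert (E : ln (Rr * g h / h) = ln (g h / h) + ln Rr).
  { rewrite <- ln_mult; [|apply Rdiv_lt_0_compat; lra|lra]. f_equal. field. lra. }
  rewrite E in B2. unfold Theta.
  assert (EP : PI = (Rr - 1) * g 0) by (rewrite Hg0; field; lra).
  rewrite EP. apply Rabs_def1; nra.
Qed.

Lemma Theta_eq_PI Rr g s b : 1 < Rr -> is_gR Rr g ->
  (forall v, 0 < v -> g v = v -> v = s) -> 0 < b -> 0 < g b ->
  (forall x, 0 < x < b -> x < Rr * g x) -> Theta Rr g b = PI.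
Proof.
  intros HR Hg Hu Hb Hgb HRg. apply cond_eq. intros e He.
  destruct (gR_start Rr g e HR Hg He) as [d [Hd H]].
  set (a := Rmin (d / 2) b).
  assert (Ha : 0 < a) by (apply Rmin_glb_lt; lra).
  assert (Ha1 : a <= d / 2) by apply Rmin_l. assert (Ha2 : a <= b) by apply Rmin_r.
  rewrite <- (Theta_const Rr g s a b); auto; [apply H; lra|].
  intros x Hx. apply HRg. lra.
Qed.

(** At a first point with [Rr * g w = w] both arguments of [action] are nonpositive, so [Theta] is 0
    there. But the region has not been left before that point, so [Theta] still equals [PI]. *)
Lemma gR_region Rr g s : 1 < Rr -> is_gR Rr g ->
  (forall v, 0 < v -> g v = v -> v = s) -> forall w, 0 < w -> w < Rr * g w.
Proof.
  intros HR Hg Hu w Hw. apply Rnot_le_lt. intros Hle.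
  destruct (gR_start Rr g 1 HR Hg Rlt_0_1) as [d [Hd H]].
  assert (Hstart : forall h, 0 < h < d -> 0 < Rr * g h - h).
  { intros h Hh. destruct (H h Hh) as [Hgh _]. nra. }
  assert (Hdw : d <= w).
  { apply Rnot_lt_le. intros Hlt. specialize (Hstart w ltac:(lra)). lra. }
  destruct (first_zero (fun x => Rr * g x - x) (d / 2) w) as [c [Hc1 [Hc2 Hc3]]].
  - lra.
  - intros x Hx. apply continuity_pt_minus; [|apply derivable_continuous_pt, derivable_pt_id].
    apply continuity_pt_scal. eapply gR_continuity; [exact Hg|lra].
  - apply Hstart. lra.
  - lra.
  - assert (Hgc : g c = c / Rr) by (apply Rmult_eq_reg_l with Rr; [|lra]; field_simplify; lra).
    assert (Hgc0 : 0 < g c) by (rewrite Hgc; apply Rdiv_lt_0_compat; lra).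
    assert (E : Theta Rr g c = PI).
    { apply (Theta_eq_PI Rr g s); auto; [lra|]. intros x Hx.
      destruct (Rlt_dec x d) as [Hxd|Hxd].
      - specialize (Hstart x ltac:(lra)). lra.
      - specialize (Hc3 x ltac:(lra)). simpl in Hc3. lra. }
    unfold Theta in E. rewrite !action_le0 in E; [pose proof PI_RGT_0; lra| |].
    + rewrite Hgc. replace (c / Rr / c) with (/ Rr) by (field; lra).
      rewrite ln_Rinv by lra. pose proof (ln_increasing 1 Rr ltac:(lra) ltac:(lra)).
      rewrite ln_1 in *. lra.
    + rewrite Hgc. replace (c / Rr / c) with (/ Rr) by (field; lra).
      rewrite ln_Rinv by lra. lra.
Qed.

Lemma gR_turning_point Rr g s w : 1 < Rr -> is_gR Rr g -> 0 < s -> g s = s ->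
  (forall v, 0 < v -> g v = v -> v = s) -> s < w ->
  0 < g w < w /\ w < Rr * g w /\
  action (ln (g w / w) + ln Rr) - action (ln (g w / w)) = PI / w.
Proof.
  intros HR Hg Hs Hgs Hu Hsw.
  assert (HRg := gR_region Rr g s HR Hg Hu).
  assert (Hpos : forall v, 0 < v -> 0 < g v) by (intros v Hv; specialize (HRg v Hv); nra).
  assert (HTh : forall v, 0 < v -> Theta Rr g v = PI).
  { intros v Hv. apply (Theta_eq_PI Rr g s); auto. intros x Hx. apply HRg. lra. }
  assert (HlnR : 0 < ln Rr) by (rewrite <- ln_1; apply ln_increasing; lra).
  pose proof (HTh w ltac:(lra)) as Ew. pose proof (HTh s Hs) as Es. unfold Theta in Ew, Es.
  assert (Hgw := Hpos w ltac:(lra)).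
  split; [|split; [apply HRg; lra|rewrite <- Ew; field; lra]].
  split; [easy|].
  destruct (Rtotal_order (g w) w) as [Hlt|[E|Hgt]]; [easy| |].
  - apply Hu in E; lra.
  (* If [g w > w], the window would start right of the turning point, where action increments are at
     least the one starting at 0; then [Theta] at [w] would exceed its value at [s]. *)
  - exfalso. rewrite Hgs in Es. replace (s / s) with 1 in Es by (field; lra). rewrite ln_1 in Es.
    assert (Hl : 0 <= ln (g w / w)).
    { rewrite <- ln_1. left. apply ln_increasing; [lra|].
      apply Rmult_lt_reg_r with w; [lra|]. unfold Rdiv. rewrite Rmult_assoc, Rinv_l by lra. lra. }
    pose proof (action_increment_le (ln Rr) 0 (ln (g w / w)) HlnR Hl) as Hle.
    assert (HPI := PI_RGT_0).
    set (p0 := action (0 + ln Rr) - action 0) in *.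
    set (p1 := action (ln (g w / w) + ln Rr) - action (ln (g w / w))) in *.
    clearbody p0 p1. assert (0 < p0) by nra. nra.
Qed.

(** * Linear independence of [J] and [Y] *)

Lemma Tint_bound al nu x : Rabs (Tint al nu x) <= PI.
Proof.
  unfold Tint. replace PI with ((PI - 0) * 1) at 2 by ring. apply abs_RInt_le_const.
  - pose proof PI_RGT_0; lra.
  - apply ex_RInt_cont, tkern_continuous.
  - intros t _. unfold tkern. apply Rabs_le.
    match goal with |- context [sin ?a] => pose proof (SIN_bound a) end. lra.
Qed.

Lemma Kint_ge mu x b : 0 < x -> 0 <= b -> RInt (kern mu x) 0 b <= Kint mu x.
Proof.
  intros Hx Hb.
  cut (Rbar_le (RInt (kern mu x) 0 b) (Kint mu x)); [easy|].
  refine (is_lim_le_loc (fun _ => RInt (kern mu x) 0 b) _ p_infty _ _ _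
    (is_lim_const _ _) (Kint_correct mu x Hx)).
  exists b. intros c Hc.
  rewrite <- (RInt_Chasles (kern mu x) 0 b c) by (apply ex_RInt_cont, kern_continuous).
  assert (0 <= RInt (kern mu x) b c).
  { apply RInt_ge_0; [lra|apply ex_RInt_cont, kern_continuous|]. intros; left; apply exp_pos. }
  unfold plus; simpl. lra.
Qed.

(** For small [x] the kernel stays above [exp (- 1) >= / 3] on a long interval: [x = / (1 + sinh b)]
    ensures this up to [b]. *)
Lemma Kint_unbounded mu M : 0 <= mu -> 0 <= M -> exists x, 0 < x /\ M <= Kint mu x.
Proof.
  intros Hmu HM. set (b := 3 * M).
  assert (Hs := sinh_nonneg b ltac:(unfold b; lra)).
  exists (/ (1 + sinh b)). assert (Hx : 0 < / (1 + sinh b)) by (apply Rinv_0_lt_compat; lra).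
  split; [easy|].
  apply Rle_trans with (2 := Kint_ge mu _ b Hx ltac:(unfold b; lra)).
  set (x := / (1 + sinh b)) in *.
  assert (HI : is_RInt (fun _ => / 3) 0 b (b * / 3)).
  { pose proof (@is_RInt_const R_NormedModule 0 b (/ 3)) as H. rewrite Rminus_0_r in H. exact H. }
  apply Rle_trans with (RInt (fun _ => / 3) 0 b).
  { rewrite (is_RInt_unique _ _ _ _ HI). unfold b. lra. }
  apply RInt_le; [unfold b; lra|eexists; exact HI|apply ex_RInt_cont, kern_continuous|].
  intros t Ht. unfold kern.
  assert (Hst : sinh t <= sinh b).
  { unfold sinh. pose proof (exp_le t b ltac:(lra)). pose proof (exp_le (- b) (- t) ltac:(lra)). lra. }
  assert (Hxs : x * sinh t <= 1).
  { assert (x * (1 + sinh b) = 1) by (unfold x; field; lra). nra. }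
  apply Rle_trans with (exp (- (1))).
  - rewrite exp_Ropp. apply Rinv_le_contravar; [apply exp_pos|apply exp_le_3].
  - apply exp_le. nra.
Qed.

Lemma Kint_neg_bounded nu x : 0 < nu -> 0 < x -> 0 <= Kint (- nu) x <= / nu.
Proof.
  intros Hnu Hx. split.
  - pose proof (Kint_ge (- nu) x 0 Hx ltac:(lra)) as H. rewrite RInt_point in H. exact H.
  - cut (Rbar_le (Kint (- nu) x) (/ nu)); [easy|].
    refine (is_lim_le_loc _ (fun _ => / nu) p_infty _ _ _ (Kint_correct (- nu) x Hx)
      (is_lim_const _ _)).
    exists 0. intros b Hb.
    assert (HI : is_RInt (fun t => exp (- nu * t)) 0 b
      (- / nu * exp (- nu * b) - - / nu * exp (- nu * 0))).
    { apply (is_RInt_deriv (fun t => - / nu * exp (- nu * t))).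
      - intros t. auto_derive; [easy|]. field. lra.
      - intros t. rapply @ex_derive_continuous. auto_derive. easy. }
    apply Rle_trans with (RInt (fun t => exp (- nu * t)) 0 b).
    + apply RInt_le; [lra|apply ex_RInt_cont, kern_continuous|eexists; exact HI|].
      intros t Ht. unfold kern. apply exp_le. pose proof (sinh_nonneg t ltac:(lra)). nra.
    + rewrite (is_RInt_unique _ _ _ _ HI). rewrite Rmult_0_r, exp_0.
      pose proof (exp_pos (- nu * b)). assert (0 < / nu) by now apply Rinv_0_lt_compat. nra.
Qed.

(** Zero derivative makes the two neighbouring orders equal, the recurrence makes them opposite.
    This moves the order down to one whose behaviour near [x = 0] is known. *)
Lemma bessel_family_zero_shift f nu : bessel_family f -> (forall x, 0 < x -> f nu x = 0) ->
  forall n x, 0 < x -> f (nu - INR n) x = 0.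
Proof.
  intros [Hd Hr] H0 n. induction n as [|n IH]; intros x Hx.
  - simpl. rewrite Rminus_0_r. now apply H0.
  - set (mu := nu - INR n) in *.
    replace (nu - INR (S n)) with (mu - 1) by (rewrite S_INR; unfold mu; ring).
    assert (E : (f (mu - 1) x - f (mu + 1) x) / 2 = 0).
    { rewrite <- (is_derive_unique _ _ _ (Hd mu x Hx)). apply is_derive_unique.
      apply (is_derive_ext_loc (fun _ => 0)); [|apply (@is_derive_const R_AbsRing R_NormedModule)].
      apply filter_imp with (2 := locally_pos x Hx). intros y Hy. now rewrite IH. }
    specialize (Hr mu x Hx). rewrite (IH x Hx), Rmult_0_r in Hr.
    apply Rmult_integral in Hr. destruct Hr; lra.
Qed.

(** For integral [nu] the shift ends at order 0, where only [Tint] is left, with value [PI] at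
    [x = 0]. Otherwise it ends at a negative order [- mu], where the term with [Kint mu] is
    unbounded near 0 while [Tint] is bounded. *)
Lemma BesselJ_not_zero nu : 0 < nu -> ~ forall x, 0 < x -> BesselJ nu x = 0.
Proof.
  intros Hnu H0. assert (HPI := PI_RGT_0).
  pose proof (bessel_family_zero_shift BesselJ nu bessel_family_J H0) as Hz.
  destruct (Req_dec (sin (nu * PI)) 0) as [Hs|Hs].
  - apply sin_eq_0_0 in Hs. destruct Hs as [k Hk]. apply Rmult_eq_reg_r in Hk; [|lra].
    assert (Hk0 : (0 < k)%Z) by (apply lt_IZR; lra).
    assert (HJ0 : forall x, 0 < x -> Tint (PI / 2) 0 x = 0).
    { intros x Hx. specialize (Hz (Z.to_nat k) x Hx).
      rewrite INR_IZR_INZ, Z2Nat.id, <- Hk, Rminus_diag, BesselJ_eq, Rmult_0_l, sin_0 in Hz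
        by (easy || lia).
      apply Rmult_eq_reg_l with (/ PI); [lra|]. apply Rinv_neq_0_compat. lra. }
    assert (HT0 : Tint (PI / 2) 0 0 = PI).
    { unfold Tint. transitivity (RInt (fun _ => 1) 0 PI).
      - apply RInt_ext. intros t _. unfold tkern. rewrite <- cos_sin.
        replace (0 * sin t - 0 * t) with 0 by ring. apply cos_0.
      - rewrite RInt_const. unfold scal; simpl. unfold mult; simpl. ring. }
    assert (HC : continuity_pt (Tint (PI / 2) 0) 0)
      by (eapply is_derive_continuity_pt, Tint_derive).
    destruct (continuity_pt_pos _ _ HC ltac:(lra)) as [d [Hd Hpos]].
    specialize (Hpos (d / 2) ltac:(apply Rabs_def1; lra)). rewrite HJ0 in Hpos; lra.
  - destruct (INR_unbounded nu) as [n Hn].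
    set (mu := INR n - nu). assert (Hmu : 0 < mu) by (unfold mu; lra).
    assert (Hsm : sin (- mu * PI) <> 0).
    { replace (- mu * PI) with (nu * PI - INR n * PI) by (unfold mu; ring).
      rewrite sin_minus, sin_nat_PI.
      assert (Hcn : cos (INR n * PI) <> 0).
      { pose proof (sin2_cos2 (INR n * PI)) as E. rewrite sin_nat_PI in E. unfold Rsqr in E.
        intros E0. rewrite E0 in E. lra. }
      rewrite Rmult_0_r, Rminus_0_r. now apply Rmult_integral_contrapositive_currified. }
    assert (Hab : 0 < Rabs (sin (- mu * PI))) by now apply Rabs_pos_lt.
    destruct (Kint_unbounded mu ((PI + 1) / Rabs (sin (- mu * PI)))) as [x [Hx HK]].
    + lra.
    + left. apply Rdiv_lt_0_compat; lra.
    + specialize (Hz n x Hx). replace (nu - INR n) with (- mu) in Hz by (unfold mu; ring).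
      rewrite BesselJ_eq, Ropp_involutive in Hz by easy.
      assert (E : Tint (PI / 2) (- mu) x = sin (- mu * PI) * Kint mu x).
      { apply Rmult_eq_reg_l with (/ PI); [|apply Rinv_neq_0_compat; lra].
        unfold Rdiv in Hz |- *. lra. }
      pose proof (Tint_bound (PI / 2) (- mu) x) as HB. rewrite E, Rabs_mult in HB.
      pose proof (Rle_abs (Kint mu x)).
      assert (PI + 1 <= Rabs (sin (- mu * PI)) * Kint mu x).
      { apply Rle_trans with (Rabs (sin (- mu * PI)) * ((PI + 1) / Rabs (sin (- mu * PI)))).
        - right. field. lra.
        - apply Rmult_le_compat_l; lra. }
      nra.
Qed.

(** [Kint nu] takes arbitrarily large values, while all other terms of [J] and [Y] are bounded for
    fixed [nu > 0]. *)
Lemma BesselY_not_multiple nu c : 0 < nu -> ~ forall x, 0 < x -> BesselY nu x = c * BesselJ nu x.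
Proof.
  intros Hnu H. assert (HPI := PI_RGT_0).
  assert (Hin : 0 < / nu) by now apply Rinv_0_lt_compat.
  set (Cb := PI + / nu + Rabs c * (PI + / nu)).
  assert (HC : 0 <= Cb) by (unfold Cb; pose proof (Rabs_pos c); nra).
  destruct (Kint_unbounded nu (Cb + 1)) as [x [Hx HK]]; [lra|lra|].
  specialize (H x Hx). rewrite BesselY_eq, BesselJ_eq in H by easy.
  pose proof (Kint_neg_bounded nu x Hnu Hx) as HKn.
  pose proof (Tint_bound 0 nu x) as T1. pose proof (Tint_bound (PI / 2) nu x) as T2.
  pose proof (SIN_bound (nu * PI)) as S1. pose proof (COS_bound (nu * PI)) as C1.
  set (tj := Tint (PI / 2) nu x) in *. set (ty := Tint 0 nu x) in *.
  set (kn := Kint (- nu) x) in *. set (kp := Kint nu x) in *.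
  set (sn := sin (nu * PI)) in *. set (cn := cos (nu * PI)) in *.
  assert (E : kp = ty - cn * kn - c * (tj - sn * kn)).
  { apply Rmult_eq_reg_l with (/ PI); [|apply Rinv_neq_0_compat; lra]. unfold Rdiv in H. lra. }
  assert (G1 : Rabs (cn * kn) <= / nu).
  { rewrite Rabs_mult, (Rabs_pos_eq kn) by lra.
    assert (Rabs cn <= 1) by (apply Rabs_le; lra). pose proof (Rabs_pos cn). nra. }
  assert (G2 : Rabs (sn * kn) <= / nu).
  { rewrite Rabs_mult, (Rabs_pos_eq kn) by lra.
    assert (Rabs sn <= 1) by (apply Rabs_le; lra). pose proof (Rabs_pos sn). nra. }
  assert (G3 : Rabs (c * (tj - sn * kn)) <= Rabs c * (PI + / nu)).
  { rewrite Rabs_mult. apply Rmult_le_compat_l; [apply Rabs_pos|].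
    apply Rabs_le_between in T2. apply Rabs_le_between in G2. apply Rabs_le. lra. }
  apply Rabs_le_between in T1. apply Rabs_le_between in G1. apply Rabs_le_between in G3.
  unfold Cb in HK. lra.
Qed.

(** If the Wronskian were 0, the Cauchy data of [J] and [Y] at [t = 0] would be dependent, and by
    uniqueness so would the functions. A negative Wronskian is repaired by passing to [- Y], hence
    the absolute values. *)
Lemma bessel_phase nu : 0 < nu -> exists W A A' B B' psi, phased nu W A A' B B' psi /\
  forall s t, Rabs (A s * B t - B s * A t)
    = Rabs (BesselJ nu (nu * exp s) * BesselY nu (nu * exp t)
            - BesselY nu (nu * exp s) * BesselJ nu (nu * exp t)).
Proof.
  intros Hnu.
  pose proof (bessel_family_sol BesselJ nu bessel_family_J Hnu) as HA.
  pose proof (bessel_family_sol BesselY nu bessel_family_Y Hnu) as HB.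
  set (A := fun t => BesselJ nu (nu * exp t)) in *.
  set (B := fun t => BesselY nu (nu * exp t)) in *.
  match type of HA with sol _ _ ?f => set (A' := f) in * end.
  match type of HB with sol _ _ ?f => set (B' := f) in * end.
  assert (Hlog : forall y, 0 < y -> exists t, y = nu * exp t).
  { intros y Hy. exists (ln (y / nu)). rewrite exp_ln by now apply Rdiv_lt_0_compat. field. lra. }
  set (W := A 0 * B' 0 - A' 0 * B 0).
  assert (HW : forall t, A t * B' t - A' t * B t = W)
    by (intros t; apply (wronskian_const nu A A' B B' HA HB)).
  assert (HW0 : W <> 0).
  { intros E. unfold W in E.
    destruct (classic (A 0 = 0 /\ A' 0 = 0)) as [[E1 E2]|Hne].
    - apply (BesselJ_not_zero nu Hnu). intros x Hx. destruct (Hlog x Hx) as [t ->].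
      exact (sol_unique_zero nu A A' 0 HA E1 E2 t).
    - assert (Hc : exists c, B 0 = c * A 0 /\ B' 0 = c * A' 0).
      { destruct (Req_dec (A 0) 0) as [E1|E1].
        - assert (E2 : A' 0 <> 0) by tauto. exists (B' 0 / A' 0). rewrite E1 in E |- *.
          split; [|field; easy].
          assert (B 0 = 0); [|lra]. apply Rmult_eq_reg_l with (A' 0); lra.
        - exists (B 0 / A 0). split; [field; easy|].
          apply Rmult_eq_reg_l with (A 0); [|easy].
          transitivity (A' 0 * B 0); [lra|]. field. easy. }
      destruct Hc as [c [Hc1 Hc2]]. apply (BesselY_not_multiple nu c Hnu).
      intros x Hx. destruct (Hlog x Hx) as [t ->]. fold (A t) (B t).
      pose proof (sol_unique_zero nu _ _ 0 (sol_comb nu B B' A A' 1 (- c) HB HA)) as HU.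
      simpl in HU. specialize (HU ltac:(rewrite Hc1; ring) ltac:(rewrite Hc2; ring) t). lra. }
  destruct (Rlt_dec 0 W) as [HWp|HWn].
  - destruct (phase_exists nu A A' B B' W HA HB HW0 HW) as [psi [H1 H2]].
    exists W, A, A', B, B', psi. split; [now split|easy].
  - assert (HB2 : sol nu (fun t => - B t) (fun t => - B' t)).
    { eapply sol_ext; [| |apply (sol_comb nu B B' B B' (-1) 0 HB HB)]; intros; simpl; ring. }
    assert (HW2 : forall t, A t * - B' t - A' t * - B t = - W) by (intros t; rewrite <- (HW t); ring).
    destruct (phase_exists nu A A' (fun t => - B t) (fun t => - B' t) (- W) HA HB2 ltac:(lra) HW2)
      as [psi [H1 H2]].
    exists (- W), A, A', (fun t => - B t), (fun t => - B' t), psi. split; [split; auto; lra|].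
    intros s t. rewrite <- (Rabs_Ropp (_ - _)). f_equal. unfold A, B. ring.
Qed.

Definition radial (nu a r : R) : R :=
  BesselJ nu a * BesselY nu (a * r) - BesselY nu a * BesselJ nu (a * r).

(** The bound [M] belongs to the conclusion because [sup_norm] is known to be a supremum only for
    bounded functions. *)
Lemma radial_localised Rr tau0 delta eta : 1 < Rr -> - ln Rr < tau0 < 0 -> 0 < delta -> 0 < eta ->
  exists nu0 e, 0 < e /\ forall nu k, nu0 < nu -> 0 < nu ->
  Rabs (INR (S k) * PI / nu - (action (tau0 + ln Rr) - action tau0)) < e ->
  (exists M, forall r, 1 < r < Rr -> Rabs (radial nu (a_zero nu Rr (S k)) r) <= M) /\
  forall r, 1 < r < Rr -> delta <= Rabs (ln r + tau0) ->
  exists r0, 1 < r0 < Rr /\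
    Rabs (radial nu (a_zero nu Rr (S k)) r) <= eta * Rabs (radial nu (a_zero nu Rr (S k)) r0).
Proof.
  intros HR Ht0 Hd He. set (T := ln Rr) in *.
  assert (HT : 0 < T) by lra.
  assert (EeT : exp T = Rr) by (apply exp_ln; lra).
  (* Keeps [tau] between [- T] and 0 and costs at most half of [delta] when [tau0] is replaced by
     [tau]. *)
  set (d2 := Rmin (delta / 2) (Rmin (- tau0) (tau0 + T))).
  assert (Hd2 : 0 < d2) by (repeat apply Rmin_glb_lt; lra).
  assert (Hd2a : d2 <= delta / 2) by apply Rmin_l.
  assert (Hd2b : d2 <= Rmin (- tau0) (tau0 + T)) by apply Rmin_r.
  pose proof (Rmin_l (- tau0) (tau0 + T)). pose proof (Rmin_r (- tau0) (tau0 + T)).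
  destruct (level_location T tau0 d2 HT ltac:(lra) Hd2) as [nu1 [e [He0 Hloc]]].
  destruct (sol_localised T (delta / 2) eta HT ltac:(lra) He) as [nu2 Hsl].
  exists (Rmax nu1 nu2), e. split; [exact He0|].
  intros nu k Hnu Hnu0 Hlim. pose proof (Rmax_l nu1 nu2). pose proof (Rmax_r nu1 nu2).
  destruct (bessel_phase nu Hnu0) as [W [A [A' [B [B' [psi [Hph HAB]]]]]]].
  destruct (kth_zero_phase nu W A A' B B' psi T (fcross nu Rr) k Hph HT) as [tau [Ea Hlev]].
  { intros t. unfold fcross. rewrite (Rmult_comm Rr (nu * exp t)).
    replace (nu * exp t * Rr) with (nu * exp (t + T)) by (rewrite exp_plus, EeT; ring).
    specialize (HAB t (t + T)). split; intros E; rewrite E, Rabs_R0 in HAB.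
    - now apply Rabs_eq_0.
    - symmetry in HAB. now apply Rabs_eq_0. }
  fold (a_zero nu Rr (S k)) in Ea. set (a := a_zero nu Rr (S k)) in *.
  specialize (Hloc _ _ _ _ _ _ _ _ _ Hph ltac:(lra) Hlev Hlim).
  apply Rabs_lt_between in Hloc.
  set (v := fun t => A tau * B t - B tau * A t).
  assert (Hrad : forall r, 0 < r -> Rabs (radial nu a r) = Rabs (v (tau + ln r))).
  { intros r Hr. unfold v. rewrite HAB. unfold radial. rewrite Ea.
    rewrite exp_plus, exp_ln, Rmult_assoc by easy. easy. }
  assert (Hsol := ph_cross_sol _ _ _ _ _ _ _ Hph tau).
  assert (Hln : forall r, 1 < r < Rr -> 0 < ln r < T).
  { intros r Hr. split; [rewrite <- ln_1|]; apply ln_increasing; lra. }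
  split.
  - destruct (continuity_ab_maj (fun t => Rabs (v t)) tau (tau + T)) as [m [Hm _]].
    + lra.
    + intros t _. apply (continuity_pt_comp v Rabs); [|apply Rcontinuity_abs].
      eapply is_derive_continuity_pt, (proj1 Hsol).
    + exists (Rabs (v m)). intros r Hr. rewrite Hrad by lra. apply Hm.
      specialize (Hln r Hr). lra.
  - intros r Hr Hdr. pose proof (Hln r Hr).
    destruct (Hsl nu v _ tau (tau + ln r) Hsol) as [t0 [Ht0a Ht0b]].
    + lra.
    + unfold v. ring.
    + lra.
    + lra.
    + split_Rabs; lra.
    + exists (exp (t0 - tau)).
      assert (1 < exp (t0 - tau) < Rr).
      { rewrite <- exp_0 at 1. rewrite <- EeT at 1. split; apply exp_increasing; lra. }
      split; [easy|]. rewrite !Hrad by lra. rewrite ln_exp.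
      replace (tau + (t0 - tau)) with t0 by ring. exact Ht0b.
Qed.

(** * From radial profiles to eigenfunctions *)

Definition sum_sq (x : nat -> R) (s : list nat) : R :=
  fold_right Rplus 0 (map (fun i => x i ^ 2) s).

Lemma sum_sq_ge x s : 0 <= sum_sq x s /\ forall i, In i s -> x i ^ 2 <= sum_sq x s.
Proof.
  unfold sum_sq. induction s as [|j s [IH1 IH2]]; cbn [map fold_right]; [split; [lra|easy]|].
  pose proof (pow2_ge_0 (x j)) as Hj. split; [lra|].
  intros i [->|Hi]; [lra|]. specialize (IH2 i Hi). lra.
Qed.

Lemma norm_d_scal d c x : 0 <= c -> norm_d d (fun i => c * x i) = c * norm_d d x.
Proof.
  intros Hc. unfold norm_d.
  assert (E : forall s, sum_sq (fun i => c * x i) s = c ^ 2 * sum_sq x s).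
  { intros s. unfold sum_sq. induction s as [|j s IH]; cbn [map fold_right]; [ring|].
    rewrite IH. ring. }
  fold (sum_sq (fun i => c * x i) (seq 0 d)) (sum_sq x (seq 0 d)). rewrite E.
  rewrite sqrt_mult_alt, sqrt_pow2 by (easy || apply pow2_ge_0). easy.
Qed.

Lemma on_sphere_coord d xi i : on_sphere d xi -> Rabs (xi i) <= 1.
Proof.
  intros [Hin Hn].
  destruct (Nat.lt_ge_cases i d) as [Hi|Hi]; [|rewrite Hin, Rabs_R0 by easy; lra].
  destruct (sum_sq_ge xi (seq 0 d)) as [H1 H2].
  specialize (H2 i ltac:(apply in_seq; lia)).
  assert (E : sum_sq xi (seq 0 d) = 1).
  { rewrite <- (pow2_sqrt (sum_sq xi (seq 0 d))) by easy.
    change (sqrt (sum_sq xi (seq 0 d))) with (norm_d d xi). rewrite Hn. ring. }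
  rewrite <- (Rabs_pos_eq 1) by lra. apply Rsqr_le_abs_0. unfold Rsqr. lra.
Qed.

Lemma mpoly_eval_bounded d P : exists M, forall x, (forall i, Rabs (x i) <= 1) ->
  Rabs (mpoly_eval d P x) <= M.
Proof.
  assert (Hm : forall m x, (forall i, Rabs (x i) <= 1) -> Rabs (mono_eval d m x) <= Rabs (fst m)).
  { intros m x Hx. unfold mono_eval. rewrite Rabs_mult.
    rewrite <- (Rmult_1_r (Rabs (fst m))) at 2.
    apply Rmult_le_compat_l; [apply Rabs_pos|].
    induction (seq 0 d) as [|j s IH]; simpl; [rewrite Rabs_R1; lra|].
    rewrite Rabs_mult. apply Rle_trans with (1 * 1); [|lra].
    apply Rmult_le_compat; try apply Rabs_pos; [|easy].
    rewrite <- RPow_abs. apply Rle_trans with (1 ^ nth j (snd m) 0%nat); [|rewrite pow1; lra].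
    apply pow_incr. split; [apply Rabs_pos|apply Hx]. }
  unfold mpoly_eval. induction P as [|m P [M IH]].
  - exists 0. intros x _. simpl. rewrite Rabs_R0. lra.
  - exists (Rabs (fst m) + M). intros x Hx. simpl.
    eapply Rle_trans; [apply Rabs_triang|]. apply Rplus_le_compat; [now apply Hm|now apply IH].
Qed.

Lemma spherical_harmonic_bounded d l Y : spherical_harmonic d l Y ->
  exists M, forall xi, on_sphere d xi -> Rabs (Y xi) <= M.
Proof.
  intros [P [_ [_ HP]]]. destruct (mpoly_eval_bounded d P) as [M HM].
  exists M. intros xi Hxi. rewrite HP by easy. apply HM.
  intros i. now apply (on_sphere_coord d).
Qed.

Lemma normalised_on_sphere d x : in_Rd d x -> 0 < norm_d d x ->
  on_sphere d (fun i => x i / norm_d d x).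
Proof.
  intros Hx Hn. split.
  - intros i Hi. rewrite Hx by easy. unfold Rdiv. ring.
  - replace (fun i => x i / norm_d d x) with (fun i => / norm_d d x * x i)
      by (apply functional_extensionality; intros; unfold Rdiv; ring).
    rewrite norm_d_scal by (left; now apply Rinv_0_lt_compat). field. lra.
Qed.

Lemma sup_norm_lub (S : (nat -> R) -> Prop) f M : (forall x, S x -> Rabs (f x) <= M) ->
  is_lub (fun y => y = 0 \/ exists x, S x /\ y = Rabs (f x)) (sup_norm S f).
Proof.
  intros HM. unfold sup_norm. apply epsilon_spec.
  destruct (completeness (fun y => y = 0 \/ exists x, S x /\ y = Rabs (f x))) as [L HL].
  - exists (Rmax 0 M). intros y [->|[x [Hx ->]]]; [apply Rmax_l|].
    apply Rle_trans with M; [now apply HM|apply Rmax_r].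
  - exists 0. now left.
  - now exists L.
Qed.

Lemma sup_norm_ratio (S S' : (nat -> R) -> Prop) f M eta : 0 <= eta ->
  (forall x, S' x -> S x) -> (forall x, S x -> Rabs (f x) <= M) ->
  (forall x, S' x -> exists y, S y /\ Rabs (f x) <= eta * Rabs (f y)) ->
  Rabs (sup_norm S' f / sup_norm S f) <= eta.
Proof.
  intros He Hsub HM Hdom.
  destruct (sup_norm_lub S f M HM) as [U1 L1].
  destruct (sup_norm_lub S' f M (fun x Hx => HM x (Hsub x Hx))) as [U2 L2].
  assert (P1 : 0 <= sup_norm S f) by (apply U1; now left).
  assert (P2 : 0 <= sup_norm S' f) by (apply U2; now left).
  assert (Hle : sup_norm S' f <= eta * sup_norm S f).
  { apply L2. intros y [->|[x [Hx ->]]]; [nra|].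
    destruct (Hdom x Hx) as [z [Hz Hxz]]. apply Rle_trans with (1 := Hxz).
    apply Rmult_le_compat_l; [easy|]. apply U1. right. now exists z. }
  destruct P1 as [P1|P1].
  - rewrite Rabs_pos_eq.
    + apply Rmult_le_reg_r with (sup_norm S f); [easy|].
      unfold Rdiv. rewrite Rmult_assoc, Rinv_l by lra. lra.
    + apply Rmult_le_pos; [easy|left; now apply Rinv_0_lt_compat].
  (* A vanishing denominator forces a vanishing numerator, and [0 / 0] is 0. *)
  - rewrite <- P1, Rmult_0_r in Hle. replace (sup_norm S' f) with 0 by lra.
    unfold Rdiv. rewrite Rmult_0_l, Rabs_R0. easy.
Qed.

Lemma Rpower_bounds Rr r p : 1 < r < Rr ->
  exp (- (Rabs p * ln Rr)) <= Rpower r p <= exp (Rabs p * ln Rr).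
Proof.
  intros Hr. unfold Rpower.
  assert (0 < ln r) by (rewrite <- ln_1; apply ln_increasing; lra).
  assert (ln r < ln Rr) by (apply ln_increasing; lra).
  assert (Rabs (p * ln r) <= Rabs p * ln Rr).
  { rewrite Rabs_mult, (Rabs_pos_eq (ln r)) by lra.
    apply Rmult_le_compat_l; [apply Rabs_pos|lra]. }
  apply Rabs_le_between in H1. split; apply exp_le; lra.
Qed.

(** [ln] has slope at least [/ Rr] up to [Rr]; this converts a distance of radii into one in the
    variable [t]. *)
Lemma ln_dist_ge Rr x y e : 0 < x <= Rr -> 0 < y <= Rr -> e <= Rabs (x - y) ->
  e / Rr <= Rabs (ln x - ln y).
Proof.
  assert (H : forall a b, 0 < b -> b <= a -> a <= Rr -> (a - b) / Rr <= ln a - ln b).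
  { intros a b Hb Hab Ha.
    pose proof (exp_ineq1_le (ln (b / a))) as HE.
    rewrite exp_ln in HE by (apply Rdiv_lt_0_compat; lra).
    unfold Rdiv in HE at 1. rewrite ln_mult, ln_Rinv in HE by (try apply Rinv_0_lt_compat; lra).
    apply Rle_trans with ((a - b) / a).
    - apply Rmult_le_compat_l; [lra|]. apply Rinv_le_contravar; lra.
    - replace ((a - b) / a) with (1 - b / a) by (field; lra). lra. }
  intros Hx Hy He. assert (HR : 0 < / Rr) by (apply Rinv_0_lt_compat; lra).
  destruct (Rle_dec y x) as [Hle|Hle].
  - pose proof (H x y ltac:(lra) Hle ltac:(lra)) as G. rewrite Rabs_pos_eq in He by lra.
    apply Rle_trans with (2 := Rle_abs _). apply Rle_trans with (2 := G).
    apply Rmult_le_compat_r; lra.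
  - pose proof (H y x ltac:(lra) ltac:(lra) ltac:(lra)) as G.
    rewrite <- Rabs_Ropp in He. rewrite Rabs_pos_eq in He by lra.
    rewrite <- Rabs_Ropp. apply Rle_trans with (2 := Rle_abs _).
    apply Rle_trans with ((y - x) / Rr); [apply Rmult_le_compat_r; lra|lra].
Qed.

Lemma nu_l_bounds d c l : (2 <= d)%nat -> 0 <= c ->
  INR l <= nu_l d c l <= INR l + (INR d / 2 + c).
Proof.
  intros Hd Hc. assert (HdR : 2 <= INR d) by (apply (le_INR 2); easy).
  pose proof (pos_INR l). unfold nu_l. set (a := INR l + INR d / 2 - 1).
  assert (Ha : INR l <= a) by (unfold a; lra).
  split.
  - apply Rle_trans with (sqrt (a ^ 2)); [rewrite sqrt_pow2; lra|].
    apply sqrt_le_1_alt. pose proof (pow2_ge_0 c). lra.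
  - apply Rle_trans with (sqrt ((a + c) ^ 2)); [apply sqrt_le_1_alt; nra|].
    rewrite sqrt_pow2 by lra. unfold a. lra.
Qed.

Lemma nat_to_infty_lim u : nat_to_infty u -> is_lim_seq (fun n => INR (u n)) p_infty.
Proof.
  intros Hu. apply is_lim_seq_spec. intros M.
  destruct (INR_unbounded M) as [m Hm]. destruct (Hu m) as [N HN].
  exists N. intros n Hn. specialize (HN n Hn). apply le_INR in HN. lra.
Qed.

Lemma nu_over_k_lim d c w lseq kseq : (2 <= d)%nat -> 0 <= c -> 0 < w ->
  nat_to_infty kseq -> Un_cv (fun n => INR (lseq n) / INR (kseq n)) w ->
  is_lim_seq (fun n => INR (kseq n) * PI / nu_l d c (lseq n)) (PI / w).
Proof.
  intros Hd Hc Hw Hk Hlk. apply is_lim_seq_Reals in Hlk.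
  set (K := INR d / 2 + c).
  assert (Hinv : is_lim_seq (fun n => / INR (kseq n)) 0).
  { apply (is_lim_seq_inv _ p_infty); [now apply nat_to_infty_lim|easy]. }
  assert (Hkp : Hierarchy.eventually (fun n => 0 < INR (kseq n))).
  { destruct (Hk 1%nat) as [N HN]. exists N. intros n Hn. specialize (HN n Hn).
    apply lt_0_INR. lia. }
  assert (Hup : is_lim_seq (fun n => INR (lseq n) / INR (kseq n) + K * / INR (kseq n)) w).
  { replace (Finite w) with (Finite (w + K * 0)) by (f_equal; ring).
    apply is_lim_seq_plus'; [easy|]. exact (is_lim_seq_scal_l _ K _ Hinv). }
  assert (Hnk : is_lim_seq (fun n => nu_l d c (lseq n) / INR (kseq n)) w).
  { apply (is_lim_seq_le_le_loc (fun n => INR (lseq n) / INR (kseq n)) _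
      (fun n => INR (lseq n) / INR (kseq n) + K * / INR (kseq n))); auto.
    destruct Hkp as [N HN]. exists N. intros n Hn. specialize (HN n Hn).
    assert (0 < / INR (kseq n)) by now apply Rinv_0_lt_compat.
    pose proof (nu_l_bounds d c (lseq n) Hd Hc) as Hb. fold K in Hb. unfold Rdiv. split.
    - apply Rmult_le_compat_r; lra.
    - rewrite <- Rmult_plus_distr_r. apply Rmult_le_compat_r; lra. }
  assert (Hfin : is_lim_seq (fun n => PI * / (nu_l d c (lseq n) / INR (kseq n))) (PI / w)).
  { refine (is_lim_seq_scal_l _ PI _ (is_lim_seq_inv _ (Finite w) Hnk _)).
    intros E. injection E. lra. }
  apply is_lim_seq_ext_loc with (2 := Hfin).
  destruct Hkp as [N HN]. exists N. intros n Hn. specialize (HN n Hn).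
  unfold Rdiv. rewrite Rinv_mult, Rinv_inv. ring.
Qed.

Lemma u_fun_eq d c Rr l k Y x : u_fun d c Rr l k Y x =
  Rpower (norm_d d x) (1 - INR d / 2)
  * radial (nu_l d c l) (a_zero (nu_l d c l) Rr k) (norm_d d x)
  * Y (fun i => x i / norm_d d x).
Proof. reflexivity. Qed.

(* Moving a point of the shell along its ray does not change the spherical factor. *)
Lemma u_fun_dominated d c Rr l k Y x r0 eta : 1 < Rr -> 0 < eta -> shell d Rr x -> 1 < r0 < Rr ->
  Rabs (radial (nu_l d c l) (a_zero (nu_l d c l) Rr k) (norm_d d x))
  <= eta * exp (- (2 * (Rabs (1 - INR d / 2) * ln Rr)))
     * Rabs (radial (nu_l d c l) (a_zero (nu_l d c l) Rr k) r0) ->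
  exists y, shell d Rr y /\
    Rabs (u_fun d c Rr l k Y x) <= eta * Rabs (u_fun d c Rr l k Y y).
Proof.
  intros HR He [Hin Hn] Hr0 Hrad. set (p := 1 - INR d / 2) in *. set (q := Rabs p * ln Rr) in *.
  set (r := norm_d d x) in *.
  set (y := fun i => r0 / r * x i).
  assert (Hny : norm_d d y = r0).
  { unfold y. rewrite norm_d_scal by (left; apply Rdiv_lt_0_compat; lra). fold r. field. lra. }
  exists y. split.
  { split; [|rewrite Hny; lra]. intros i Hi. unfold y. rewrite Hin by easy. ring. }
  rewrite !u_fun_eq, Hny. fold r. fold p.
  replace (fun i => y i / r0) with (fun i => x i / r)
    by (apply functional_extensionality; intros i; unfold y; field; lra).
  pose proof (Rpower_bounds Rr r p Hn) as B1. pose proof (Rpower_bounds Rr r0 p Hr0) as B2.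
  fold q in B1, B2.
  rewrite !Rabs_mult. rewrite (Rabs_pos_eq (Rpower r p)), (Rabs_pos_eq (Rpower r0 p))
    by (left; apply exp_pos).
  set (R1 := Rabs (radial _ _ r)) in *. set (R0 := Rabs (radial _ _ r0)) in *.
  rewrite <- Rmult_assoc. apply Rmult_le_compat_r; [apply Rabs_pos|].
  assert (H0 : 0 <= R0) by apply Rabs_pos. assert (H1 : 0 <= R1) by apply Rabs_pos.
  (* The power of the radius varies between [exp (- q)] and [exp q]; the factor [exp (- (2 * q))]
     pays for moving from [r] to [r0]. *)
  apply Rle_trans with (exp q * (eta * exp (- (2 * q)) * R0)).
  - apply Rmult_le_compat; try lra. left. apply exp_pos.
  - replace (exp q * (eta * exp (- (2 * q)) * R0)) with (eta * (exp (- q) * R0)).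
    + apply Rmult_le_compat_l; [lra|]. apply Rmult_le_compat_r; lra.
    + replace (- q) with (q + - (2 * q)) by ring. rewrite exp_plus. ring.
Qed.

Lemma u_fun_bounded d c Rr l k Y : 1 < Rr ->
  (exists M, forall xi, on_sphere d xi -> Rabs (Y xi) <= M) ->
  (exists M, forall r, 1 < r < Rr ->
     Rabs (radial (nu_l d c l) (a_zero (nu_l d c l) Rr k) r) <= M) ->
  exists M, forall x, shell d Rr x -> Rabs (u_fun d c Rr l k Y x) <= M.
Proof.
  intros HR [M1 H1] [M2 H2].
  exists (exp (Rabs (1 - INR d / 2) * ln Rr) * M2 * M1).
  intros x [Hin Hn]. rewrite u_fun_eq, !Rabs_mult.
  pose proof (Rpower_bounds Rr (norm_d d x) (1 - INR d / 2) Hn) as B.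
  rewrite (Rabs_pos_eq (Rpower _ _)) by (left; apply exp_pos).
  repeat apply Rmult_le_compat; try apply Rabs_pos.
  - apply Rmult_le_pos; [left; apply exp_pos|apply Rabs_pos].
  - left; apply exp_pos.
  - apply B.
  - now apply H2.
  - apply H1, normalised_on_sphere; [easy|lra].
Qed.

Theorem theorem3p4 (d : nat) (c Rr : R) (g : R -> R) (s w eps : R)
    (lseq kseq : nat -> nat) (Yseq : nat -> (nat -> R) -> R) :
  (2 <= d)%nat -> 0 <= c -> 1 < Rr ->
  is_gR Rr g ->
  0 < s -> g s = s -> (forall v, 0 < v -> g v = v -> v = s) ->
  s < w -> 0 < eps ->
  nat_to_infty lseq -> nat_to_infty kseq ->
  Un_cv (fun n => INR (lseq n) / INR (kseq n)) w ->
  (forall n, spherical_harmonic d (lseq n) (Yseq n) /\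
             exists xi, on_sphere d xi /\ Yseq n xi <> 0) ->
  Un_cv (fun n =>
     sup_norm (fun x => Dset d (w / g w) eps x /\ shell d Rr x)
              (u_fun d c Rr (lseq n) (kseq n) (Yseq n))
     / sup_norm (shell d Rr) (u_fun d c Rr (lseq n) (kseq n) (Yseq n))) 0.
Proof.
  intros Hd Hc HR Hg Hs Hgs Hu Hsw Heps Hl Hk Hlk HY.
  destruct (gR_turning_point Rr g s w HR Hg Hs Hgs Hu Hsw) as [[Hg0 Hgw] [HRg Hact]].
  set (tau0 := ln (g w / w)) in *.
  assert (Hq : 0 < g w / w) by (apply Rdiv_lt_0_compat; lra).
  assert (Htau0 : - ln Rr < tau0 < 0).
  { unfold tau0. split.
    - rewrite <- ln_Rinv by lra. apply ln_increasing; [apply Rinv_0_lt_compat; lra|].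
      apply Rmult_lt_reg_l with (Rr * w); [nra|].
      replace (Rr * w * / Rr) with w by (field; lra).
      replace (Rr * w * (g w / w)) with (Rr * g w) by (field; lra). lra.
    - rewrite <- ln_1. apply ln_increasing; [easy|].
      apply Rmult_lt_reg_r with w; [lra|]. unfold Rdiv. rewrite Rmult_assoc, Rinv_l by lra. lra. }
  assert (Hrs : ln (w / g w) = - tau0).
  { unfold tau0. rewrite <- ln_Rinv by easy. f_equal. field. lra. }
  intros e He.
  set (eta := e / 2 * exp (- (2 * (Rabs (1 - INR d / 2) * ln Rr)))).
  assert (Heta : 0 < eta) by (apply Rmult_lt_0_compat; [lra|apply exp_pos]).
  destruct (radial_localised Rr tau0 (eps / Rr) eta HR Htau0 ltac:(apply Rdiv_lt_0_compat; lra) Heta)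
    as [nu0 [e1 [He1 Hloc]]].
  rewrite Hact in Hloc.
  pose proof (nu_over_k_lim d c w lseq kseq Hd Hc ltac:(lra) Hk Hlk) as Hlim.
  apply is_lim_seq_Reals in Hlim. destruct (Hlim e1 He1) as [N1 HN1].
  destruct (INR_unbounded (Rmax nu0 0)) as [m Hm].
  destruct (Hl m) as [N2 HN2]. destruct (Hk 1%nat) as [N3 HN3].
  exists (N1 + N2 + N3)%nat. intros n Hn.
  specialize (HN1 n ltac:(lia)). specialize (HN2 n ltac:(lia)). specialize (HN3 n ltac:(lia)).
  destruct (HY n) as [HYn _]. apply spherical_harmonic_bounded in HYn.
  destruct (kseq n) as [|k] eqn:Ek; [lia|].
  assert (Hnu : Rmax nu0 0 < nu_l d c (lseq n)).
  { apply le_INR in HN2. pose proof (nu_l_bounds d c (lseq n) Hd Hc). lra. }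
  pose proof (Rmax_l nu0 0). pose proof (Rmax_r nu0 0).
  destruct (Hloc (nu_l d c (lseq n)) k ltac:(lra) ltac:(lra) HN1) as [Hbd Hdom].
  destruct (u_fun_bounded d c Rr (lseq n) (S k) (Yseq n) HR HYn Hbd) as [M HM].
  unfold Rdist. rewrite Rminus_0_r. apply Rle_lt_trans with (e / 2); [|lra].
  apply (sup_norm_ratio _ _ _ M); [lra|now intros x [_ Hx]|exact HM|].
  intros x [[_ HD] Hx]. assert (Hr := proj2 Hx).
  destruct (Hdom (norm_d d x) Hr) as [r0 [Hr0 Hle]].
  { replace (ln (norm_d d x) + tau0) with (ln (norm_d d x) - ln (w / g w)) by (rewrite Hrs; ring).
    apply ln_dist_ge; [lra| |lra]. split; [apply Rdiv_lt_0_compat; lra|].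
    apply Rmult_le_reg_r with (g w); [easy|]. unfold Rdiv. rewrite Rmult_assoc, Rinv_l by lra. lra. }
  apply (u_fun_dominated d c Rr (lseq n) (S k) (Yseq n) x r0 (e / 2)); auto. lra.
Qed.
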